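(* Let $m\ge4$ be even, let $d\ge7$ be odd, and put $p=(d-3)/2$, $k=\lfloor p/2\rfloor$. Starting from the initial factorization of $T_m(p-k+1,k+1,p+1)$ defined in the context, there is a sequence of $d-3$ balanced binary coordinate splits leading to a factorization $(\widehat S_c)$ of $T_m(1,\dots,1)=D_d(m)$ with the following property. Let $\widehat U$ be the copy of $U_m$ in the iterated zero section (the image of $U_m\times\{0\}\times\cdots\times\{0\}$ under the identifications of the successive splits), and recolour the three distinguished colours $F_0,F_1,F_2$ at each point of $\widehat U$ by the permutation of these colours that turns $F_0,F_1,F_2$ into $H_0,H_1,H_2$ at the corresponding point of $U_m$, changing nothing else. Then the result is a Hamilton decomposition of $D_d(m)$; and this final recolouring changes only three colours and changes them at exactly $$m^3-m^2-4m+7$$ sources, namely the points of $\widehat U$. This number is independent of $d$, and each source in $U_m$ has exactly one image, in the zero section, at every split.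
   Context: **Multitori, factorizations, splits.** For positive integers $a_1,\dots,a_n$ with sum $d$, $T_m(a_1,\dots,a_n)$ is the directed multigraph on $\mathbb Z_m^n$ with $a_i$ labelled arcs $x\to x+e_i$ at each vertex; $D_d(m)=T_m(1,\dots,1)$ with $d$ ones. A factorization is a list of $d$ permutations $S_c$ (one per colour) with direction functions $\partial_c$, $S_c(x)=x+e_{\partial_c(x)}$, such that each direction $i$ is used by exactly $a_i$ colours at each $x$. A balanced binary coordinate split of a direction $i$ with $a_i\ge2$ chooses $\delta_c(x)\in\{0,1\}$ with $\delta_c(x)=0$ unless $\partial_c(x)=i$ and $\sum_c\delta_c(x)=\lfloor a_i/2\rfloor$ at every $x$, and replaces $S_c$ by $\widehat S_c(x,t)=(S_cx,t+\delta_c(x))$, $t\in\mathbb Z_m$; through $(x,t)\mapsto(x_1,\dots,x_{i-1},x_i-t,t,x_{i+1},\dots,x_n)$ this is a factorization of the multitorus in which $a_i$ is replaced by the two entries $\lceil a_i/2\rceil,\lfloor a_i/2\rfloor$. The zero section of the split is the set of points with $t=0$. A factorization of $D_d(m)$ is a Hamilton decomposition if every $S_c$ is a single cycle on all vertices. **Initial factorization.** Coordinates $(x,y,w)\in\mathbb Z_m^3$, $h=x+y+w$ represented in $\{0,\dots,m-1\}$. It has $d=2p+3$ colours: $F_0,F_1,F_2$ (distinguished) and $A_i,B_i$ for $0\le i<p$ (auxiliary), with parallel arcs separately labelled. Directions of $(F_0,F_1,F_2)$: - $h=0$: $(e_w,e_y,e_x)$; - $h=1,w\in\{0,1\}$: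 $(e_x,e_w,e_y)$; - $h=1,w\notin\{0,1\}$: $(e_y,e_w,e_x)$; - $h=2,w=0$: $(e_y,e_x,e_w)$; - otherwise $(e_x,e_y,e_w)$. Auxiliary colours at height $h$: those in $W_h$ use $e_w$, where $W_0=\{B_0,A_1,\dots,A_{p-1}\}$, $W_1=\{A_0,B_1,\dots,B_{p-1}\}$, $W_h=\{A_0,\dots,A_{p-1}\}$ for $h\ge2$. Let $V_h$ be the complementary set of $p$ auxiliary colours. At each $(h,w)$, $k$ colours of $V_h$ are selected and use $e_y$; the remaining colours of $V_h$ use $e_x$. The selection uses the following ordered lists of ordered pairs (numbered $j=0,1,2,\dots$; lists are empty at other heights and empty index ranges are omitted): - $h=0$: $(A_0,B_1)$; - $h=1$, $p$ even: $(B_0,A_1),(A_2,A_3),\dots,(A_{p-2},A_{p-1})$; - $h=2$, $p$ even: $(B_2,B_3),(B_4,B_5),\dots,(B_{p-2},B_{p-1})$; - $h=1$, $p$ odd: $(A_1,A_2),(A_3,A_4),\dots,(A_{p-2},A_{p-1})$; - $h=2$, $p$ odd: $(B_0,B_2),(B_3,B_4),\dots,(B_{p-2},B_{p-1})$. From pair number $j$ select its second member at $w=1$ if $j=1$, and at $w=0$ if $j\ne1$; select its first member at all other values of $w$. Complete the selection to $k$ colours with the first colours of $V_h$ not in any pair of the list, in the order $A_0,\dots,A_{p-1},B_0,\dots,B_{p-1}$. **The factors $H_0,H_1,H_2$ and $U_m$.** On $\{0,1,2\}$ let $r(c)=c+1$, $\tau_z(c)=2z-c$ modulo 3; on $\mathbb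 Z_m^2$ let $R(a,b)=(-a-b,a)$. For $z\in\{0,1,2\}$ and $t\in\mathbb Z_m\setminus\{0\}$ let $\sigma^*(R^z(t,-t))$ be $r^{-1}$ if $t=1$, $r$ if $t=-1$, $\tau_z$ otherwise; let $\sigma^*=\mathrm{id}$ at all other points of $\mathbb Z_m^2$. At $h=1$ put $\sigma_{(x,y,w)}=\sigma^*(y,w-3)$; at other heights $\sigma_{(x,y,w)}=r^{s_h}$, where if $3\nmid m$: $s_2=1$, $s_h=2$ for $h\notin\{1,2\}$; if $3\mid m$: $s_2=1$, $s_0=s_3=s_4=2$, $s_h=0$ for $5\le h<m$. With $\pi=(1\ 2)$ and $(e_0,e_1,e_2)=(e_x,e_y,e_w)$ put $H_c(x,y,w)=(x,y,w)+e_{\sigma_{(x,y,w)}(\pi(c))}$. At every vertex both $(F_0,F_1,F_2)$ and $(H_0,H_1,H_2)$ use each of the three directions once. $U_m\subseteq\mathbb Z_m^3$ is the set of vertices at which the direction rows of $(F_0,F_1,F_2)$ and $(H_0,H_1,H_2)$ differ; at $v\in U_m$ the recolouring permutation $\sigma_v$ of $\{0,1,2\}$ is the one with $H_c(v)=F_{\sigma_v(c)}(v)$. *)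

(* Defs.v *)
From mathcomp Require Import all_boot all_fingroup all_algebra.

Set Implicit Arguments.
Unset Strict Implicit.
Unset Printing Implicit Defensive.

Import GRing.Theory.
Local Open Scope ring_scope.

(* Coordinates and directions are numbered from 0.  Since 'Z_m only means
   Z/mZ for 1 < m, all uses are under the hypothesis 4 <= m. *)
Definition vertex (m n : nat) := 'rV['Z_m]_n.

Definition unit_vec (m n : nat) (i : 'I_n) : vertex m n := delta_mx 0 i.

(* [factorizes a S dir]: the maps S c, with direction functions dir c, form a
   factorization of T_m(a_0, ..., a_(n-1)).  The counting condition forces
   #|C| to be the sum of the a_i. *)
Definition factorizes (m n : nat) (C : finType) (a : 'I_n -> nat)
    (S : C -> vertex m n -> vertex m n) (dir : C -> vertex m n -> 'I_n) : Prop :=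
  [/\ forall c, bijective (S c),
      forall c x, S c x = x + unit_vec m (dir c x)
    & forall x i, #|[set c | dir c x == i]| = a i].

Definition is_factorization (m n : nat) (C : finType) (a : 'I_n -> nat)
    (S : C -> vertex m n -> vertex m n) : Prop :=
  exists dir, factorizes a S dir.

Definition single_cycle (T : finType) (f : T -> T) : Prop :=
  injective f /\ forall x y, fconnect f x y.

(* Hamilton decomposition of D_d(m) = T_m(1, ..., 1), with d ones.  The
   dimension n is kept apart from d only because the iterated splits below
   produce it in the form j.+3. *)
Definition Hamilton_decomposition (m n d : nat) (C : finType)
    (S : C -> vertex m n -> vertex m n) : Prop :=
  [/\ n = d, #|C| = d, is_factorization (fun=> 1%N) S
    & forall c, single_cycle (S c)].

Definition new_coord (n : nat) (i : 'I_n) : 'I_n.+1 := lift ord0 i.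

(* (x, t) |-> (x_0, ..., x_(i-1), x_i - t, t, x_(i+1), ...) *)
Definition ident (m n : nat) (i : 'I_n) (xt : vertex m n * 'Z_m) :
    vertex m n.+1 :=
  \row_j if unlift (new_coord i) j is Some l
         then xt.1 0 l - (if l == i then xt.2 else 0) else xt.2.

Definition unident (m n : nat) (i : 'I_n) (y : vertex m n.+1) :
    vertex m n * 'Z_m :=
  let t := y 0 (new_coord i) in
  (\row_l (y 0 (lift (new_coord i) l) + (if l == i then t else 0)), t).

Lemma identK (m n : nat) (i : 'I_n) : cancel (@ident m n i) (unident i).
Proof.
case=> x t; rewrite /unident !mxE unlift_none; congr pair.
by apply/rowP=> l; rewrite !mxE liftK subrK.
Qed.

Lemma unidentK (m n : nat) (i : 'I_n) : cancel (unident i) (@ident m n i).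
Proof.
move=> y; apply/rowP=> j; rewrite !mxE.
by case: unliftP => [l|] -> //=; rewrite mxE addrK.
Qed.

Definition split_mult (n : nat) (a : 'I_n -> nat) (i : 'I_n) : 'I_n.+1 -> nat :=
  fun j => if unlift (new_coord i) j is Some l
           then (if l == i then uphalf (a i) else a l) else (a i)./2.

Definition split_map (m n : nat) (C : finType) (S : C -> vertex m n -> vertex m n)
    (i : 'I_n) (delta : C -> vertex m n -> bool) :
    C -> vertex m n.+1 -> vertex m n.+1 :=
  fun c y => let: (x, t) := unident i y in
    ident i (S c x, t + (delta c x)%:R).

Definition balanced_split (m n : nat) (C : finType) (a : 'I_n -> nat)
    (S : C -> vertex m n -> vertex m n) (i : 'I_n)
    (delta : C -> vertex m n -> bool) : Prop :=
  exists2 dir, factorizes a S dir &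
  [/\ (2 <= a i)%N,
      forall c x, delta c x -> dir c x = i
    & forall x, (\sum_(c : C) delta c x)%N = (a i)./2].

Definition zero_section (m n : nat) (i : 'I_n) : {set vertex m n.+1} :=
  [set y | (unident i y).2 == 0].

(* Starting from dimension 3, the stage after j splits has dimension j.+3; the
   split leading from stage j to stage j.+1 is given by i j and delta j. *)

Fixpoint iter_mult (a0 : 'I_3 -> nat) (i : forall j, 'I_j.+3) (j : nat) :
    'I_j.+3 -> nat :=
  match j with
  | 0 => a0
  | j'.+1 => split_mult (@iter_mult a0 i j') (i j')
  end.

Fixpoint iter_split (m : nat) (C : finType) (S0 : C -> vertex m 3 -> vertex m 3)
    (i : forall j, 'I_j.+3) (delta : forall j, C -> vertex m j.+3 -> bool)
    (j : nat) : C -> vertex m j.+3 -> vertex m j.+3 :=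
  match j with
  | 0 => S0
  | j'.+1 => split_map (@iter_split m C S0 i delta j') (i j') (delta j')
  end.

(* v |-> (v, 0, ..., 0) under the successive identifications *)
Fixpoint zero_lift (m : nat) (i : forall j, 'I_j.+3) (j : nat) :
    vertex m 3 -> vertex m j.+3 :=
  match j with
  | 0 => id
  | j'.+1 => fun v => ident (i j') (@zero_lift m i j' v, 0)
  end.

(* (v, t_1, ..., t_j) |-> v under the successive identifications *)
Fixpoint base (m : nat) (i : forall j, 'I_j.+3) (j : nat) :
    vertex m j.+3 -> vertex m 3 :=
  match j with
  | 0 => id
  | j'.+1 => fun y => @base m i j' (unident (i j') y).1
  end.

Arguments iter_mult a0 i j l : clear implicits.
Arguments iter_split {m C} S0 i delta j c x.
Arguments zero_lift {m} i j v.
Arguments base {m} i j y.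

Lemma zero_liftK (m : nat) (i : forall j, 'I_j.+3) (j : nat) :
  cancel (@zero_lift m i j) (base i j).
Proof.
elim: j => [|j IHj] v //.
change (base i j (unident (i j) (ident (i j) (zero_lift i j v, 0))).1 = v).
by rewrite identK; apply: IHj.
Qed.

Definition e_x : 'I_3 := 0.
Definition e_y : 'I_3 := 1.
Definition e_w : 'I_3 := 2.

Definition xc (m : nat) (v : vertex m 3) : 'Z_m := v 0 e_x.
Definition yc (m : nat) (v : vertex m 3) : 'Z_m := v 0 e_y.
Definition wc (m : nat) (v : vertex m 3) : 'Z_m := v 0 e_w.

(* the representative of x + y + w in {0, ..., m - 1} *)
Definition height (m : nat) (v : vertex m 3) : nat := val (xc v + yc v + wc v).

Definition row3 (i0 i1 i2 : 'I_3) : 'I_3 -> 'I_3 :=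
  fun c => nth i0 [:: i0; i1; i2] c.

Definition F_dir (m : nat) (v : vertex m 3) : 'I_3 -> 'I_3 :=
  let h := height v in
  let w : nat := val (wc v) in
  if h == 0%N then row3 e_w e_y e_x
  else if h == 1%N then
    if (w == 0%N) || (w == 1%N) then row3 e_x e_w e_y else row3 e_y e_w e_x
  else if (h == 2%N) && (w == 0%N) then row3 e_y e_x e_w
  else row3 e_x e_y e_w.

Local Open Scope nat_scope.

(* Labels of auxiliary colours: inl i is A_i and inr i is B_i, with i < p. *)
Definition label := (nat + nat)%type.
Notation lblA i := (inl i : label).
Notation lblB i := (inr i : label).

Definition in_W (h : nat) (l : label) : bool :=
  match l with
  | inl i => match h with 0 => i != 0 | 1 => i == 0 | _ => true end
  | inr i => match h with 0 => i == 0 | 1 => i != 0 | _ => false end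
  end.

Definition pairs (p h : nat) : seq (label * label) :=
  match h with
  | 0 => [:: (lblA 0, lblB 1)]
  | 1 => if odd p
         then [seq (lblA l.*2.+1, lblA l.*2.+2) | l <- iota 0 p./2]
         else (lblB 0, lblA 1)
              :: [seq (lblA l.*2, lblA l.*2.+1) | l <- iota 1 p./2.-1]
  | 2 => if odd p
         then (lblB 0, lblB 2)
              :: [seq (lblB l.*2.+1, lblB l.*2.+2) | l <- iota 1 p./2.-1]
         else [seq (lblB l.*2, lblB l.*2.+1) | l <- iota 1 p./2.-1]
  | _ => [::]
  end.

Definition from_pair (w : nat) (j : nat) (pr : label * label) : label :=
  if w == (if j == 1 then 1 else 0) then pr.2 else pr.1.

Definition selected (p k h w : nat) : seq label :=
  let ps := pairs p h in
  let chosen :=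
    [seq from_pair w jp.1 jp.2 | jp <- zip (iota 0 (size ps)) ps] in
  let order :=
    [seq lblA i | i <- iota 0 p] ++ [seq lblB i | i <- iota 0 p] in
  let unpaired :=
    [seq l <- order | ~~ in_W h l & l \notin unzip1 ps ++ unzip2 ps] in
  chosen ++ take (k - size chosen) unpaired.

Local Open Scope ring_scope.

Definition aux_dir (m p k : nat) (l : label) (v : vertex m 3) : 'I_3 :=
  if in_W (height v) l then e_w
  else if l \in selected p k (height v) (val (wc v)) then e_y
  else e_x.

(* inl c is F_c, inr (inl i) is A_i, inr (inr i) is B_i *)
Definition colour (p : nat) : finType := ('I_3 + ('I_p + 'I_p))%type.

Definition init_dir (m p k : nat) (c : colour p) (v : vertex m 3) : 'I_3 :=
  match c with
  | inl f => F_dir v f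
  | inr (inl i) => aux_dir p k (lblA (val i)) v
  | inr (inr i) => aux_dir p k (lblB (val i)) v
  end.

Definition init_map (m p k : nat) (c : colour p) (v : vertex m 3) : vertex m 3 :=
  v + unit_vec m (init_dir k c v).

Definition init_mult (p k : nat) (i : 'I_3) : nat :=
  if i == e_x then (p - k + 1)%N else if i == e_y then (k + 1)%N else (p + 1)%N.

Definition R_map (m : nat) (q : 'Z_m * 'Z_m) : 'Z_m * 'Z_m := (- q.1 - q.2, q.1).

(* The three sets {R^z(t,-t) : t <> 0} are {(t,-t)}, {(0,t)} and {(-t,0)}, so
   the pair (z, t) is unique when it exists.  'I_3 is used as the ring Z/3Z. *)
Definition sigma_star (m : nat) (q : 'Z_m * 'Z_m) (c : 'I_3) : 'I_3 :=
  if [pick zt : 'I_3 * 'Z_m |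
        (zt.2 != 0) && (q == iter (val zt.1) (@R_map m) (zt.2, - zt.2))]
    is Some (z, t)
  then if t == 1 then c - 1 else if t == -1 then c + 1 else 2 * z - c
  else c.

Definition s_exp (m h : nat) : nat :=
  (if h == 2 then 1
   else if 3 %| m then (if h \in [:: 0; 3; 4] then 2 else 0)
   else 2)%N.

(* r^s is c |-> c + s on Z/3Z *)
Definition sigma (m : nat) (v : vertex m 3) (c : 'I_3) : 'I_3 :=
  if height v == 1%N then sigma_star (yc v, wc v - 3%:R) c
  else c + (s_exp m (height v))%:R.

Definition H_dir (m : nat) (v : vertex m 3) (c : 'I_3) : 'I_3 :=
  sigma v (tperm (1 : 'I_3) (2 : 'I_3) c).

Definition H_map (m : nat) (c : 'I_3) (v : vertex m 3) : vertex m 3 :=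
  v + unit_vec m (H_dir v c).

Definition F_map (m : nat) (c : 'I_3) (v : vertex m 3) : vertex m 3 :=
  v + unit_vec m (F_dir v c).

Definition U_set (m : nat) : {set vertex m 3} :=
  [set v | [exists c, F_dir v c != H_dir v c]].

(* This is sigma_v: the permutation picked always exists, see [recolP]. *)
Definition recol (m : nat) (v : vertex m 3) : {perm 'I_3} :=
  odflt 1%g [pick s : {perm 'I_3} | [forall c, H_map c v == F_map (s c) v]].

Lemma row3_inj (i0 i1 i2 : 'I_3) :
  uniq [:: i0; i1; i2] -> injective (row3 i0 i1 i2).
Proof.
by move=> u c c' /eqP; rewrite /row3 nth_uniq // => /eqP/val_inj.
Qed.

Lemma F_dir_inj (m : nat) (v : vertex m 3) : injective (F_dir v).
Proof. by rewrite /F_dir; do !case: ifP => _; apply: row3_inj. Qed.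

Lemma H_dir_inj (m : nat) (v : vertex m 3) : injective (H_dir v).
Proof.
suff sI : injective (sigma v) by apply: inj_comp sI _; apply: perm_inj.
move=> c c'; rewrite /sigma; case: ifP => _; last exact: addIr.
rewrite /sigma_star; case: pickP => [[z t] _|_] //.
by do 2?[case: ifP => _; first exact: addIr]; move/addrI/oppr_inj.
Qed.

Lemma recolP (m : nat) (v : vertex m 3) (c : 'I_3) :
  H_map c v = F_map (recol v c) v.
Proof.
rewrite /recol; case: pickP => [s /forallP/(_ c)/eqP //|no_s] /=.
have gI : injective (fun c => invF (@F_dir_inj m v) (H_dir v c)).
  by move=> c1 c2 /(can_inj (f_invF _)); apply: H_dir_inj.
have/negbT/negP[] := no_s (perm gI); apply/forallP=> c'.
by rewrite /H_map /F_map permE f_invF.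
Qed.

(* lft v is the copy of v; it is meant to be injective, see [zero_liftK]. *)
Definition recolour (m n p : nat) (lft : vertex m 3 -> vertex m n)
    (S : colour p -> vertex m n -> vertex m n) :
    colour p -> vertex m n -> vertex m n :=
  fun c u =>
    if c is inl f then
      if [pick v in U_set m | lft v == u] is Some v
      then S (inl (recol v f)) u else S c u
    else S c u.

(* Main.v *)
Require Import Defs.
From mathcomp Require Import all_boot all_fingroup all_algebra.
From Stdlib Require Import ClassicalEpsilon.
From mathcomp Require Import zify ring.

(** Everything is a matter of keeping track of cycles. A split replaces each
    map S_c by a skew product over S_c with fibre Z/m, and the points over one
    cycle of S_c form one cycle of the skew product as soon as the increments
    of the fibre coordinate sum to a unit of Z/m along it ([skew_fconnect]).
    The base torus is itself an iterated skew product over the height, and the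
    same criterion shows that each colour of the initial factorization is a
    single cycle, except F_2, which has two cycles told apart by a parity
    ([init_cycle]). A colour with one of its cycles is called a node; there are
    2p + 4 of them. The nodes that use the direction i at x form the profile of
    i at x. A split of i chooses half of each profile, and the number of times
    that each node is chosen has to be a unit modulo m: then the nodes of the
    split factorization are again the given ones.

    Such choices exist if profiles are frequent. Among the vertices that see
    the profile P, four choose windows in an enumeration of P, which overlap so
    much that the two halves of P remain linked after the split; 2 (m - 1)
    others transfer prescribed numbers of choices between neighbours in the
    enumeration ([sum_sel_diff]). As frequent profiles link the nodes, the
    numbers of choices can be moved to any values with the right sum, in
    particular to units ([design_core]). The units and the links persist as an
    invariant ([good]). A split makes the profiles of the direction that it
    divides rarer, but it multiplies by m the number of vertices seeing a given
    profile of another direction; so the descendants of w and those of x and y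
    are split in turn ([inv_step]).

    The recolouring is controlled by first returns to the copy of the base
    torus. Distinguished nodes are last in every enumeration, and all splits
    but the first one choose the first half on the zero section; so they let
    F_0, F_1, F_2 move there as on the base torus. In the first split each
    distinguished node is chosen once, at one exit vertex ([first_step]):
    without a choice its cycle could not fill the fibre. In the final
    factorization F_c carries the copy of v to the copy of F_c(v) unless v is
    an exit. From an exit its orbit makes an excursion, and it comes back to
    the copy of F_c(v), since each other point of the copy already has its
    predecessor in the copy ([fconnect_lift]). Recolouring does not affect the
    exiting colour at its exit vertex, nor anything off the copy. So the
    recoloured F_c induces H_c on the copy of the base torus, and its orbits
    all meet this copy: it is a single cycle because H_c is one.

    For H_c, consider the return map to height one, a map of the plane (Z/m)^2.
    The map R carries the return map of one colour to that of another, so there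
    is one map to study: a fixed translation, with an extra step at the
    exceptional points of three lines. A shear turns the translation into a
    step along rows, and following each row to its few exceptional points links
    all rows to each other ([rowsA] if 3 does not divide m, [rowsB] if it
    does). The size of U_m is found by counting the vertices at which the rows
    of F and H agree ([card_U]). *)

Set Implicit Arguments.
Unset Strict Implicit.
Unset Printing Implicit Defensive.

Import GRing.Theory.
Local Open Scope ring_scope.

(** * Cycles of skew products *)

Lemma fconnect_semiconj (X Y : finType) (f : X -> X) (g : Y -> Y) (phi : X -> Y) :
  (forall x, g (phi x) = phi (f x)) ->
  forall x y, fconnect f x y -> fconnect g (phi x) (phi y).
Proof.
move=> fg x y /iter_findex <-; elim: (findex f x y) => [|n IHn] /=.
  exact: connect0.
by apply: connect_trans IHn _; rewrite -fg; apply: fconnect1.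
Qed.

Section Skew.
Variables (m : nat) (X : finType) (f : X -> X) (d : X -> 'Z_m).
Hypothesis f_inj : injective f.

Definition skew (xt : X * 'Z_m) : X * 'Z_m := (f xt.1, xt.2 + d xt.1).

Lemma skew_inj : injective skew.
Proof.
case=> x t [y s] /eqP; rewrite xpair_eqE /= => /andP[/eqP/f_inj-> /eqP].
by move/addIr->.
Qed.

Lemma iter_skew n x t :
  iter n skew (x, t) = (iter n f x, t + \sum_(i < n) d (iter i f x)).
Proof.
elim: n => [|n IHn]; first by rewrite big_ord0 addr0.
by rewrite iterS IHn /skew /= big_ord_recr /= addrA.
Qed.

Lemma sum_orbit x :
  \sum_(i < fingraph.order f x) d (iter i f x) = \sum_(z | fconnect f x z) d z.
Proof.
transitivity (\sum_(z <- fingraph.orbit f x) d z).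
  rewrite /fingraph.orbit -[traject f x _]/(traject f x (fingraph.order f x)).
  rewrite (big_nth x) size_traject big_mkord.
  by apply: eq_bigr => i _; rewrite nth_traject.
rewrite big_uniq ?orbit_uniq //=; apply: eq_bigl => z.
by rewrite fconnect_orbit.
Qed.

(** Following an orbit of [f] once around adds the total of [d] over it to the
    fibre coordinate; when that total is a unit, repeating this reaches the
    whole fibre. *)
Lemma skew_fconnect x y t s :
  \sum_(z | fconnect f x z) d z \is a GRing.unit -> fconnect f x y ->
  fconnect skew (x, t) (y, s).
Proof.
rewrite -sum_orbit; set u := \sum_(i < _) _ => uU.
have around k r : iter (k * fingraph.order f x) skew (x, r) = (x, r + u *+ k).
  elim: k r => [|k IHk] r; first by rewrite mulr0n addr0.
  rewrite mulSn iterD IHk iter_skew iter_order // mulrSr addrA.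
  by rewrite -/u -!addrA (addrC (u *+ k)).
move=> /iter_findex; set n := findex f x y => xy.
pose s' := s - \sum_(i < n) d (iter i f x).
have -> : (y, s) = iter n skew (x, s').
  by rewrite iter_skew xy /s' subrK.
apply: connect_trans (fconnect_iter _ _ _).
have -> : (x, s') = iter ((s' - t) / u : 'Z_m) (iter (fingraph.order f x) skew) (x, t).
  set k : nat := _ / u.
  rewrite -iterM around -mulr_natr /k natr_Zp mulrC divrK //.
  by rewrite addrC subrK.
by rewrite -iterM; apply: fconnect_iter.
Qed.

End Skew.

Lemma Zp_nat_eq0 m (k : nat) : (1 < m)%N -> ((k%:R : 'Z_m) == 0) = (m %| k)%N.
Proof.
by move=> m_gt1; rewrite -(inj_eq val_inj) /= val_Zp_nat.
Qed.

Lemma Zp_nat_eq m (j k : nat) :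
  (1 < m)%N -> ((j%:R : 'Z_m) == k%:R) = (j == k %[mod m]).
Proof.
by move=> m_gt1; rewrite -(inj_eq val_inj) /= !val_Zp_nat.
Qed.

Lemma Zp_nat_eq_small m (j k : nat) :
  (1 < m)%N -> (j < m)%N -> (k < m)%N -> ((j%:R : 'Z_m) == k%:R) = (j == k).
Proof. by move=> m_gt1 jm km; rewrite Zp_nat_eq // !modn_small. Qed.

Lemma natr_m0 m : (1 < m)%N -> m%:R = 0 :> 'Z_m.
Proof. by move=> m_gt1; apply/eqP; rewrite Zp_nat_eq0. Qed.

Lemma card_Zm m : (1 < m)%N -> #|'Z_m| = m.
Proof. by move=> m_gt1; rewrite card_ord Zp_cast. Qed.

Lemma val_Zm m (j : nat) : (1 < m)%N -> (j < m)%N -> val (j%:R : 'Z_m) = j.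
Proof. by move=> m_gt1 jm; rewrite /= val_Zp_nat // modn_small. Qed.

Lemma ltn_Zm m (t : 'Z_m) : (1 < m)%N -> (val t < m)%N.
Proof. by move=> m_gt1; rewrite -[m in X in (_ < X)%N](Zp_cast m_gt1) ltn_ord. Qed.

(** * Choosing half of the positions of a list *)

Lemma sum_nat_lt (M n : nat) : (n <= M)%N -> (\sum_(q < M) (q < n))%N = n.
Proof.
move=> nM; rewrite -(big_mkord xpredT (fun q => nat_of_bool (q < n)%N)).
rewrite (big_cat_nat (leq0n n) nM) /= big_nat (eq_bigr (fun=> 1%N)).
  rewrite -big_nat sum_nat_const_nat subn0 muln1 big_nat big1 ?addn0 // => i.
  by case/andP=> ni _; rewrite ltnNge ni.
by move=> i /andP[_ ->].
Qed.

Lemma sum_pairs (f : nat -> nat) k :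
  (forall j, j < k -> f j.*2 + f j.*2.+1 = 1)%N ->
  (\sum_(0 <= l < k.*2) f l = k)%N.
Proof.
elim: k => [|k IHk] f1; first by rewrite big_nil.
rewrite doubleS !big_nat_recr //= IHk => [|j jk]; last by rewrite f1 // ltnW.
by rewrite -addnA f1 // addn1.
Qed.

Lemma card_index (T : finType) (A : {set T}) (P : pred nat) :
  #|[set x in A | P (index x (enum A))]| = (\sum_(0 <= l < #|A|) P l)%N.
Proof.
rewrite -sum1dep_card (eq_bigl (fun x => (x \in A) && P (index x (enum A)))) //.
rewrite big_mkcondr /= -big_enum /=.
case E: (enum A) => [|x0 s]; first by rewrite cardE E !big_nil.
rewrite -E (big_nth x0) -cardE big_nat [RHS]big_nat.
apply: eq_bigr => i /andP[_ iA].
by rewrite index_uniq ?enum_uniq -?cardE //; case: (P i).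
Qed.

Section Design.
Variables (m a : nat).
Hypotheses (m_gt3 : (3 < m)%N) (a_ge2 : (2 <= a)%N).
Let b := a./2.

(** Two windows of length b at the start and two at the end of the positions 0,
    ..., a - 1, shifted by one against each other. Chains of overlapping
    windows link all positions, and so do chains of complements of windows,
    once these have two elements; see [child_profile]. *)
Definition window (r l : nat) : bool :=
  match r with
  | 0 => l < b
  | 1 => 0 < l <= b
  | 2 => a - b - 1 <= l < a.-1
  | _ => a - b <= l
  end%N.

(** The role r of a vertex decides which positions it chooses. Roles below 4
    choose a window. Each of the next m - 1 roles chooses one position of each
    pair 2j, 2j + 1, the larger one in n (2j) of these roles. The m - 1 roles
    after these do the same for the pairs 2j + 1, 2j + 2, adding position 0
    when a is even, as there is one pair less. All other roles choose the first
    half. *)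
Definition sel (r : nat) (n : nat -> nat) (l : nat) : bool :=
  (if r < 4 then window r l else
   if r - 4 < m.-1 then
     if odd l then r - 4 < n l.-1 else (l.+1 < a) && (n l <= r - 4)
   else if r - 4 - m.-1 < m.-1 then
     if odd l then (l.+1 < a) && (n l <= r - 4 - m.-1)
     else if l is l'.+1 then r - 4 - m.-1 < n l' else ~~ odd a
   else l < b)%N.

Lemma sum_interval (c d : nat) :
  (d <= a)%N -> (c <= d)%N -> (\sum_(0 <= l < a) (c <= l < d))%N = (d - c)%N.
Proof.
move=> da cd; rewrite (big_cat_nat (leq0n c) (leq_trans cd da)) /=.
rewrite (big_cat_nat cd da) /= big_nat big1; last first.
  by move=> i /andP[_ ic]; rewrite leqNgt ic.
rewrite add0n big_nat (eq_bigr (fun=> 1%N)) => [|i ->] //.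
rewrite -big_nat sum_nat_const_nat muln1 big_nat big1 ?addn0 // => i.
by case/andP=> di _; rewrite (ltnNge i) di andbF.
Qed.

(** In every role one position is chosen from each of b pairs, up to the
    position 0 that makes up for a missing pair, or b consecutive positions are
    chosen. *)
Lemma sum_sel r n : (\sum_(0 <= l < a) sel r n l)%N = b.
Proof.
have ab : a = (odd a + b.*2)%N by rewrite odd_double_half.
have low : (\sum_(0 <= l < a) (l < b))%N = b.
  rewrite (eq_bigr (fun l => nat_of_bool (0 <= l < b)%N)) //.
  by apply: etrans (sum_interval _ _) _; lia.
rewrite /sel; case: (boolP (r < 4)%N) => r4.
  case: r r4 => [|[|[|[|//]]]] _ /=; first exact: low.
  - rewrite (eq_bigr (fun l => nat_of_bool (1 <= l < b.+1)%N)) //.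
    by apply: etrans (sum_interval _ _) _; lia.
  - by apply: etrans (sum_interval _ _) _; lia.
  rewrite big_nat (eq_bigr (fun l => nat_of_bool (a - b <= l < a)%N)).
    by rewrite -big_nat; apply: etrans (sum_interval _ _) _; lia.
  by move=> l /andP[_ ->]; rewrite andbT.
case: (boolP (r - 4 < m.-1)%N) => rm.
  pose f l := nat_of_bool
    (if odd l then r - 4 < n l.-1 else (l.+1 < a) && (n l <= r - 4))%N.
  rewrite -[LHS]/(\sum_(0 <= l < a) f l)%N.
  have f1 j : (j < b -> f j.*2 + f j.*2.+1 = 1)%N.
    move=> jb; rewrite /f /= odd_double /=.
    have -> : (j.*2.+1 < a)%N by lia.
    by rewrite ltnNge; case: (_ <= _)%N.
  rewrite ab; case: (boolP (odd a)) => oa; last by rewrite add0n sum_pairs.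
  rewrite add1n big_nat_recr //= sum_pairs // /f odd_double.
  by rewrite (_ : (b.*2.+1 < a)%N = false) ?addn0 //; lia.
case: (boolP (r - 4 - m.-1 < m.-1)%N) => // rm2.
pose f l := nat_of_bool
  (if odd l then (l.+1 < a) && (n l <= r - 4 - m.-1)
   else if l is l'.+1 then r - 4 - m.-1 < n l' else ~~ odd a)%N.
rewrite -[LHS]/(\sum_(0 <= l < a) f l)%N.
pose k := (a.-1)./2.
have f1 j : (j < k -> f j.*2.+1 + f j.*2.+2 = 1)%N.
  move=> jb; rewrite /f /= odd_double /=.
  have -> : (j.*2.+2 < a)%N by rewrite /k in jb; lia.
  by rewrite ltnNge; case: (_ <= _)%N.
rewrite -[a]prednK; last by lia.
rewrite big_nat_recl //= {1}/f /=.
case: (boolP (odd a)) => oa /=; rewrite ?add0n.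
  rewrite (_ : a.-1 = k.*2); last by rewrite /k; lia.
  by rewrite (@sum_pairs (fun l => f l.+1)) // /k; lia.
rewrite (_ : a.-1 = k.*2.+1); last by rewrite /k; lia.
rewrite big_nat_recr //= (@sum_pairs (fun l => f l.+1)) //.
rewrite /f /= odd_double /= (_ : (k.*2.+2 < a)%N = false); last by rewrite /k; lia.
by rewrite /k; lia.
Qed.

(** What position l gains when w l' choices are moved from l' to l' + 1, for
    all l'. *)
Definition inflow (w : nat -> 'Z_m) (l : nat) : 'Z_m :=
  (if l is l'.+1 then w l' else 0) - (if (l.+1 < a)%N then w l else 0).

Lemma sum_lt_Zm (x : 'Z_m) : \sum_(q < m.-1) ((q < val x)%N)%:R = x :> 'Z_m.
Proof.
rewrite -natr_sum sum_nat_lt ?natr_Zp //.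
by have := @ltn_Zm m x; lia.
Qed.

Lemma sum_ge_Zm (x : 'Z_m) :
  \sum_(q < m.-1) (((val x <= q)%N)%:R - 1) = - x :> 'Z_m.
Proof.
rewrite -[x in RHS]sum_lt_Zm -sumrN; apply: eq_bigr => q _.
by rewrite leqNgt; case: (q < val x)%N; rewrite /= ?sub0r ?subrr ?oppr0.
Qed.

(** The pairs of the first group of m - 1 roles move choices out of even
    positions, those of the second group out of odd positions; in each group a
    pair can move any number from 0 to m - 1, hence any element of Z/m. *)
Lemma sum_sel_diff (w : nat -> 'Z_m) (l : nat) : (l < a)%N ->
  \sum_(0 <= r < m.*2.+2)
     ((sel r (fun i => val (w i)) l)%:R - (sel r (fun=> 0%N) l)%:R)
  = inflow w l.
Proof.
move=> la; pose g (r : nat) : 'Z_m :=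
  (sel r (fun i => val (w i)) l)%:R - (sel r (fun=> 0%N) l)%:R.
rewrite -[LHS]/(\sum_(0 <= r < m.*2.+2) g r).
have -> : m.*2.+2 = (4 + m.-1 + m.-1)%N by lia.
have h1 : (4 <= 4 + m.-1 + m.-1)%N by rewrite -addnA leq_addr.
rewrite (big_cat_nat (leq0n 4) h1) /=.
rewrite (big_cat_nat (leq_addr m.-1 4) (leq_addr _ _)) /=.
rewrite big_nat big1 ?add0r => [|r /andP[_ r4]]; last first.
  by rewrite /g /sel r4 subrr.
rewrite -{1}[4%N]add0n big_addn addKn big_mkord.
rewrite -{1}[(4 + m.-1)%N]add0n big_addn addKn big_mkord.
have ge4 (i j : nat) : (i + (4 + j) < 4)%N = false by lia.
have gE (i : 'I_m.-1) : g (i + 4)%N =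
    (if odd l then (i < val (w l.-1))%N else (l.+1 < a)%N && (val (w l) <= i)%N)%:R
    - (~~ odd l && (l.+1 < a)%N)%:R.
  rewrite /g /sel (_ : (i + 4 < 4)%N = false); last by lia.
  rewrite addnK ltn_ord /=; congr (_ - _%:R).
  by case: (odd l); rewrite /= ?ltn0 ?leq0n ?andbT.
have gO (i : 'I_m.-1) : g (i + (4 + m.-1))%N =
    (if odd l then (l.+1 < a)%N && (val (w l) <= i)%N
     else if l is l'.+1 then (i < val (w l'))%N else ~~ odd a)%:R
    - (if odd l then (l.+1 < a)%N else if l is l'.+1 then false else ~~ odd a)%:R.
  rewrite /g /sel ge4 addnCA addKn ltnNge leq_addl /= addnK ltn_ord /=.
  congr (_ - _%:R).
  by case: (odd l); rewrite // ?andbT //; case: (l).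
rewrite (eq_bigr _ (fun i _ => gE i)) (eq_bigr _ (fun i _ => gO i)) /inflow.
case: (boolP (odd l)) => ol /=.
  case: l ol {la g gE gO} => //= l ol; congr (_ + _).
    by rewrite -[RHS]sum_lt_Zm; apply: eq_bigr => i _; rewrite subr0.
  case: (l.+2 < a)%N; last by rewrite big1 ?oppr0 // => i _; rewrite /= ?addr0 ?subrr.
  by rewrite -sum_ge_Zm.
rewrite addrC; congr (_ + _).
  case: l ol {la g gE gO} => [|l] ol; first by rewrite big1 // => i _; rewrite subrr.
  by rewrite -[RHS]sum_lt_Zm; apply: eq_bigr => i _; rewrite subr0.
case: (l.+1 < a)%N; last by rewrite big1 ?oppr0 // => i _; rewrite /= ?addr0 ?subrr.
by rewrite -sum_ge_Zm.
Qed.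

End Design.

(** * Prescribing how often each node is chosen *)

Section DesignCore.
Variables (V Nd : finType) (m a : nat).
Hypotheses (m_gt3 : (3 < m)%N) (a_ge2 : (2 <= a)%N).
Variables (N : V -> {set Nd}) (ord : {set Nd} -> seq V).
Hypotheses (cardN : forall x, #|N x| = a) (ordN : forall P x, x \in ord P -> N x = P)
  (ord_uniq : forall P, uniq (ord P)).

(** [ord P] lists the vertices that play the roles 0, 1, 2, ... for the profile
    P; all roles other than the default one take 2m + 2 vertices. *)
Definition rich P := (m.*2.+2 <= size (ord P))%N.
Definition role x := if rich (N x) then index x (ord (N x)) else m.*2.+2.
Definition layout (w : {set Nd} -> nat -> 'Z_m) x :=
  [set nu in N x | sel m a (role x) (fun l => val (w (N x) l))
                     (index nu (enum (N x)))].
Definition total (w : {set Nd} -> nat -> 'Z_m) nu : 'Z_m :=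
  \sum_x (nu \in layout w x)%:R.

Lemma layout_sub w x : layout w x \subset N x.
Proof. by apply/subsetP=> nu; rewrite inE => /andP[]. Qed.

Lemma card_layout w x : #|layout w x| = a./2.
Proof.
rewrite (@card_index _ (N x) (fun l => sel m a (role x) (fun l => val (w (N x) l)) l)).
by rewrite cardN sum_sel.
Qed.

Lemma sel_big r n l : (m.*2.+2 <= r)%N -> sel m a r n l = (l < a./2)%N.
Proof.
move=> rm; rewrite /sel (_ : (r < 4)%N = false); last by lia.
rewrite (_ : (r - 4 < m.-1)%N = false); last by lia.
by rewrite (_ : (r - 4 - m.-1 < m.-1)%N = false); last by lia.
Qed.

Lemma rich_card P : rich P -> #|P| = a.
Proof.
rewrite /rich; case E: (ord P) => [|x s] // _.
by rewrite -(@ordN P x) ?cardN // E mem_head.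
Qed.

Lemma total_diff w nu :
  total w nu = total (fun _ _ => 0) nu
    + \sum_(P : {set Nd} | rich P && (nu \in P)) inflow a (w P) (index nu (enum P)).
Proof.
apply/eqP; rewrite addrC -subr_eq /total -sumrB.
rewrite (partition_big N xpredT) //= [X in _ == X]big_mkcond /=; apply/eqP.
apply: eq_bigr => P _.
set l := index nu (enum P).
pose g r : 'Z_m := (sel m a r (fun l => val (w P l)) l)%:R
                  - (sel m a r (fun=> 0%N) l)%:R.
have g0 r : (m.*2.+2 <= r)%N -> g r = 0.
  by move=> rm; rewrite /g !sel_big ?subrr.
rewrite (eq_bigr (fun x => if nu \in P then g (role x) else 0)); last first.
  move=> x /eqP NP; rewrite !inE NP; case: (nu \in P) => /=; last by rewrite subrr.
  by rewrite /g -/l.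
case: ifP => [/andP[rP nuP]|]; last first.
  case: (nu \in P) => /=; last by rewrite big1.
  rewrite andbT => rP; rewrite big1 // => x /eqP NP.
  by rewrite g0 // /role NP rP.
rewrite nuP.
have la : (l < a)%N by rewrite -(rich_card rP) cardE index_mem mem_enum.
rewrite -(sum_sel_diff m_gt3 a_ge2 (w P) la).
transitivity (\sum_(x <- ord P) g (index x (ord P))).
  rewrite big_uniq //= (bigID (mem (ord P))) /= [X in _ + X]big1 ?addr0.
    apply: eq_big => [x|x /andP[/eqP NP xP]]; last by rewrite /role NP rP.
    by rewrite andb_idl // => /ordN ->.
  move=> x /andP[/eqP NP xP]; apply: g0; rewrite /role NP rP.
  by rewrite (memNindex xP).
have [x0 _] : exists x0, x0 \in ord P.
  move: (rP); rewrite /rich; case: (ord P) => [|x s] // _.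
  by exists x; rewrite mem_head.
rewrite (big_nth x0) (big_cat_nat (leq0n _) rP) /=.
rewrite [X in _ + X]big_nat [X in _ + X]big1 ?addr0.
  rewrite big_nat [RHS]big_nat; apply: eq_bigr => i /andP[_ im].
  by rewrite index_uniq ?ord_uniq //; apply: leq_trans rP.
move=> i /andP[mi il]; apply: g0.
by rewrite index_uniq ?ord_uniq.
Qed.

Variables (fixed : pred Nd) (lab : Nd -> nat).
Hypothesis fixed_last : forall x nu, nu \in N x -> fixed nu ->
  index nu (enum (N x)) = a.-1.

(** A fixed node comes last in its profile, so its number of choices changes
    only through a move from the position before it. *)
Definition forbidden (P : {set Nd}) (l : nat) :=
  [exists nu in P, fixed nu && (index nu (enum P) == l.+1)].

(** The vectors by which the totals may be moved: flows along the edges joining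
    consecutive members of a rich profile, avoiding fixed nodes. *)
Definition reachable (r : Nd -> 'Z_m) :=
  exists2 w : {set Nd} -> nat -> 'Z_m,
    forall P l, forbidden P l -> w P l = 0
  & forall nu, r nu = \sum_(P : {set Nd} | rich P && (nu \in P))
                        inflow a (w P) (index nu (enum P)).

Lemma reachable0 : reachable (fun=> 0).
Proof.
exists (fun _ _ => 0) => // nu; rewrite big1 // => P _.
by rewrite /inflow; case: (index _ _) => [|?]; case: ifP; rewrite subrr.
Qed.

Lemma reachable_ext r r' : r =1 r' -> reachable r -> reachable r'.
Proof. by move=> e [w w0 rw]; exists w => // nu; rewrite -e. Qed.

Lemma reachableD r r' : reachable r -> reachable r' ->
  reachable (fun nu => r nu + r' nu).
Proof.
case=> w w0 rw [w' w0' rw']; exists (fun P l => w P l + w' P l) => [P l fP|nu].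
  by rewrite w0 ?w0' ?addr0.
rewrite rw rw' -big_split /=; apply: eq_bigr => P _; rewrite /inflow.
by case: (index _ _) => [|?]; case: ifP => _; ring.
Qed.

Lemma reachableZ c r : reachable r -> reachable (fun nu => c * r nu).
Proof.
case=> w w0 rw; exists (fun P l => c * w P l) => [P l fP|nu].
  by rewrite w0 ?mulr0.
rewrite rw big_distrr /=; apply: eq_bigr => P _; rewrite /inflow.
by case: (index _ _) => [|?]; case: ifP => _; ring.
Qed.

Lemma reachable_sum (I : finType) (F : I -> Nd -> 'Z_m) :
  (forall i, reachable (F i)) -> reachable (fun nu => \sum_i F i nu).
Proof.
move=> rF; pose G s nu := \sum_(i <- s) F i nu.
suff: reachable (G (index_enum I)) by [].
elim: (index_enum I) => [|i s IHs].
  by apply: reachable_ext reachable0 => nu; rewrite /G big_nil.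
by apply: reachable_ext (reachableD (rF i) IHs) => nu; rewrite /G big_cons.
Qed.

Definition shift (nu nu' : Nd) : Nd -> 'Z_m :=
  fun mu => (mu == nu')%:R - (mu == nu)%:R.

Lemma reachable_shiftC nu nu' : reachable (shift nu nu') -> reachable (shift nu' nu).
Proof.
move/(reachableZ (-1)); apply: reachable_ext => mu; rewrite /shift; ring.
Qed.

Lemma reachable_shift_trans nu1 nu2 nu3 :
  reachable (shift nu1 nu2) -> reachable (shift nu2 nu3) ->
  reachable (shift nu1 nu3).
Proof.
move=> r1 r2; apply: reachable_ext (reachableD r1 r2) => mu; rewrite /shift; ring.
Qed.

Lemma reachable_shift_next P l (x0 : Nd) : rich P -> (l.+1 < a)%N ->
  ~~ forbidden P l ->
  reachable (shift (nth x0 (enum P) l) (nth x0 (enum P) l.+1)).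
Proof.
move=> rP la fP.
have sP : size (enum P) = a by rewrite -cardE rich_card.
exists (fun Q i => ((Q == P) && (i == l))%:R) => [Q i|nu].
  by case: eqP => // -> ; case: eqP => // ->; rewrite (negPf fP).
have nuP : (nu \in P) = (index nu (enum P) < a)%N by rewrite -mem_enum -index_mem sP.
have eqn j : (j < a)%N -> (nu == nth x0 (enum P) j) = (index nu (enum P) == j).
  move=> ja; apply/eqP/eqP=> [->|E]; first by rewrite index_uniq ?enum_uniq ?sP.
  by rewrite -E nth_index // -index_mem sP E.
case: (boolP (nu \in P)) => nuP'; last first.
  rewrite big1 => [|Q /andP[_ nuQ]].
    move: nuP'; rewrite nuP /shift !eqn //; last by rewrite ltnW.
    rewrite -leqNgt; case: (index _ _) => [|i] h; first by lia.
    by rewrite !gtn_eqF ?subrr //; lia.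
  rewrite (_ : Q == P = false); last by apply: contraNF nuP' => /eqP <-.
  by rewrite /inflow /=; case: (index _ _) => [|?]; case: ifP; rewrite subrr.
rewrite (bigD1 P) /= ?rP // big1 ?addr0 => [|Q /andP[_ /negPf ->]]; last first.
  by rewrite /inflow /=; case: (index _ _) => [|?]; case: ifP; rewrite subrr.
rewrite /shift !eqn //; last by rewrite ltnW.
rewrite eqxx /= /inflow; move: nuP; rewrite nuP' => /esym.
case: (index _ _) => [|j] ja; rewrite /= ?eqSS; congr (_ - _).
  by case: ifP => // h; case: eqP => // E; rewrite -E h in la.
by case: ifP => // h; case: eqP => // E; rewrite E la in h.
Qed.

(** Moves between neighbours compose along the enumeration, and no fixed node
    lies in between, as it would come last. *)
Lemma reachable_shift_profile P nu nu' : rich P -> nu \in P -> nu' \in P ->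
  ~~ fixed nu -> ~~ fixed nu' -> reachable (shift nu nu').
Proof.
move=> rP.
have sP : size (enum P) = a by rewrite -cardE rich_card.
wlog le: nu nu' / (index nu (enum P) <= index nu' (enum P))%N.
  move=> W nuP nuP' f f'.
  have [le|/ltnW le] := leqP (index nu (enum P)) (index nu' (enum P)); first exact: W.
  by apply: reachable_shiftC; apply: W.
move=> nuP nuP' f f'.
rewrite -(nth_index nu (_ : nu \in enum P)) ?mem_enum //.
rewrite -[X in shift _ X](nth_index nu (_ : nu' \in enum P)) ?mem_enum //.
move: le; set i := index nu _; set j := index nu' _ => le.
have ja : (j < a)%N by rewrite -sP index_mem mem_enum.
rewrite -(subnKC le); have: (i + (j - i) <= j)%N by rewrite subnKC.
elim: (j - i)%N => [|d IHd] dj.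
  rewrite addn0; apply: reachable_ext reachable0 => mu; rewrite /shift; ring.
apply: reachable_shift_trans (IHd _) _; first by lia.
rewrite addnS; apply: reachable_shift_next => //; first by lia.
apply/existsP=> -[mu /and3P[muP fmu /eqP E]].
have [x xP] : exists x, N x = P.
  move: rP; rewrite /rich; case E': (ord P) => [|x s] // _.
  by exists x; rewrite (@ordN P x) // E' mem_head.
have E2 : index mu (enum P) = a.-1 by rewrite -xP fixed_last // xP.
have jE : index mu (enum P) = j by lia.
have: mu = nu'.
  have := nth_index mu (_ : mu \in enum P); rewrite mem_enum => /(_ muP) <-.
  by rewrite jE nth_index // mem_enum.
by move=> E3; rewrite E3 (negPf f') in fmu.
Qed.

Definition free_share : rel Nd := fun nu nu' =>
  [&& ~~ fixed nu, ~~ fixed nu' &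
   [exists P : {set Nd}, [&& rich P, nu \in P & nu' \in P]]].

Lemma reachable_connect nu nu' : connect free_share nu nu' ->
  reachable (shift nu nu').
Proof.
case/connectP=> s; elim: s nu => [|mu s IHs] nu /=.
  by move=> _ ->; apply: reachable_ext reachable0 => mu; rewrite /shift; ring.
case/andP=> /and3P[f f' /existsP[P /and3P[rP nuP muP]]] ps e.
by apply: reachable_shift_trans (IHs _ ps e); apply: reachable_shift_profile rP _ _ _ _.
Qed.

Hypothesis free_conn : forall nu nu', ~~ fixed nu -> ~~ fixed nu' ->
  lab nu = lab nu' -> connect free_share nu nu'.

(** A vector whose sum vanishes on each class is a combination of moves from
    one representative per class to the nodes of the class. *)
Lemma reachable_zero_sum (r : Nd -> 'Z_m) :
  (forall nu, fixed nu -> r nu = 0) ->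
  (forall k, \sum_(nu | lab nu == k) r nu = 0) -> reachable r.
Proof.
move=> rf r0.
(* One representative per class, outside the fixed nodes. *)
pose rep nu := odflt nu [pick mu | ~~ fixed mu && (lab mu == lab nu)].
have repP nu : ~~ fixed nu -> ~~ fixed (rep nu) /\ lab (rep nu) = lab nu.
  move=> f; rewrite /rep; case: pickP => [mu /andP[? /eqP ?]//|/(_ nu)].
  by rewrite f eqxx.
have repE nu mu : ~~ fixed nu -> lab nu = lab mu -> rep nu = rep mu.
  move=> f e; rewrite /rep e; case: pickP => // /(_ nu).
  by rewrite f e eqxx.
suff h nu : reachable (fun mu => r nu * shift (rep nu) nu mu).
  apply: reachable_ext (reachable_sum h) => mu.
  rewrite /shift (eq_bigr (fun nu => r nu * (mu == nu)%:R - r nu * (mu == rep nu)%:R)).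
    rewrite sumrB (bigD1 mu) //= eqxx mulr1 big1 ?addr0; last first.
      by move=> nu /negPf E; rewrite eq_sym E mulr0.
    suff -> : \sum_i r i * (mu == rep i)%:R = 0 by rewrite subr0.
    have [fmu|fmu] := boolP (fixed mu).
      rewrite big1 // => nu _; have [/rf ->|f] := boolP (fixed nu); first by rewrite mul0r.
      case: eqP => [E|]; last by rewrite mulr0.
      by have [] := repP _ f; rewrite -E fmu.
    have [Emu|Nmu] := eqVneq mu (rep mu); last first.
      rewrite big1 // => nu _; have [/rf ->|f] := boolP (fixed nu); first by rewrite mul0r.
      case: eqP => [E|]; last by rewrite mulr0.
      have [_ lE] := repP _ f; case/eqP: Nmu; rewrite -(@repE nu) //.
      by rewrite -lE -E.
    rewrite -[RHS](r0 (lab mu)) [RHS]big_mkcond /=.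
    apply: eq_bigr => nu _; have [/rf ->|f] := boolP (fixed nu).
      by rewrite mul0r if_same.
    case: eqP => [E|NE]; case: eqP => [lE|NlE]; rewrite ?mulr1 ?mulr0 //.
      by case: NlE; rewrite E; case: (repP _ f).
    by case: NE; rewrite Emu; apply/esym/repE.
  by move=> nu _; ring.
have [/rf ->|f] := boolP (fixed nu).
  by apply: reachable_ext reachable0 => mu; rewrite mul0r.
apply: reachableZ; apply: reachable_connect; have [f' lE] := repP _ f.
exact: free_conn.
Qed.

Hypothesis mono : forall x nu nu', nu \in N x -> nu' \in N x -> lab nu = lab nu'.

(** A vertex whose profile meets the class k has its whole profile there, so it
    makes a./2 choices in it, whatever w is. *)
Lemma total_class w k : \sum_(nu | lab nu == k) total w nu =
  (a./2 * #|[set x | [exists nu in N x, lab nu == k]]|)%:R.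
Proof.
rewrite exchange_big /= -sum1dep_card big_distrr /= natr_sum [RHS]big_mkcond /=.
apply: eq_bigr => x _; rewrite -natr_sum -big_mkcondr /=.
have -> : (\sum_(nu | (lab nu == k) && (nu \in layout w x)) 1 =
           if [exists nu in N x, lab nu == k] then a./2 * 1 else 0)%N; last by case: ifP.
case: ifP => [/existsP[nu /andP[nuN /eqP <-]]|/negbT/existsPn NE].
  rewrite muln1 -(card_layout w x) -sum1_card; apply: eq_bigl => mu.
  rewrite andb_idl // => muL; apply/eqP; apply: mono nuN.
  exact: (subsetP (layout_sub w x)).
rewrite big_pred0 // => mu; apply/negbTE/andP=> -[lm /(subsetP (layout_sub w x)) muN].
by have := NE mu; rewrite muN lm.
Qed.

(** The windows keep the two halves linked; the roles after the first four only
    correct the totals. A fixed node is last in its profile, and no amount is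
    moved to it, so it is chosen in role 3 only. *)
Lemma design_core (u : Nd -> 'Z_m) :
  (forall nu, fixed nu -> (2 < a)%N) ->
  (forall nu, fixed nu -> u nu = #|[set x | (nu \in N x) && (role x == 3)]|%:R) ->
  (forall k, \sum_(nu | lab nu == k) u nu =
     (a./2 * #|[set x | [exists nu in N x, lab nu == k]]|)%:R) ->
  exists D : V -> {set Nd},
  [/\ forall x, D x \subset N x, forall x, #|D x| = a./2,
      forall nu, \sum_x (nu \in D x)%:R = u nu,
      forall P x0 r, rich P -> (r < 4)%N ->
        D (nth x0 (ord P) r) = [set nu in P | window a r (index nu (enum P))]
    & forall x nu, nu \in N x ->
        (fixed nu -> (nu \in D x) = (role x == 3))
        /\ (index nu (enum (N x)) = a.-1 -> (m.*2.+2 <= role x)%N -> nu \notin D x)].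
Proof.
move=> fa uf uk.
(* A fixed node has position a - 1, which no role but 3 chooses. *)
have fixedD w x nu : (forall P l, forbidden P l -> w P l = 0) ->
    nu \in N x -> fixed nu -> (nu \in layout w x) = (role x == 3).
  move=> w0 nuN fnu; rewrite inE nuN /= (fixed_last nuN fnu).
  have a3 := fa _ fnu; set wx := fun l => _.
  have wx0 : wx a.-2 = 0%N.
    rewrite /wx w0 //; apply/existsP; exists nu; rewrite nuN fnu.
    by rewrite fixed_last //; apply/eqP; lia.
  have [r4|r4] := ltnP (role x) 4.
    rewrite /sel r4; case: (role x) r4 => [|[|[|[|//]]]] _ /=; lia.
  rewrite (_ : role x == 3 = false); last by lia.
  rewrite /sel ltnNge r4 /=; have -> : (a.-1.+1 < a)%N = false by lia.
  have -> : a.-1 = a.-2.+1 by lia.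
  rewrite /= wx0 !ltn0; case: (odd a.-2) => /=; case: ifP => //; case: ifP => //; lia.
pose T0 := total (fun _ _ => 0).
have [||w w0 rw] := @reachable_zero_sum (fun nu => u nu - T0 nu).
- move=> nu fnu; apply/eqP; rewrite subr_eq0 uf //; apply/eqP.
  rewrite -sum1dep_card natr_sum big_mkcond /=; apply: eq_bigr => x _.
  have [nuN|nuN] /= := boolP (nu \in N x).
    by rewrite fixedD //; case: ifP.
  by rewrite inE (negPf nuN).
- by move=> k; rewrite sumrB total_class uk subrr.
exists (layout w); split.
- exact: layout_sub.
- exact: card_layout.
- by move=> nu; rewrite -/(total w nu) total_diff -rw addrC subrK.
- move=> P x0 r rP r4.
  have rs : (r < size (ord P))%N by apply: leq_trans rP; lia.
  have E : N (nth x0 (ord P) r) = P by rewrite (@ordN P) // mem_nth.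
  rewrite /layout E /role E rP index_uniq //; apply/setP=> nu; rewrite !inE.
  by rewrite /sel r4.
move=> x nu nuN; split=> [fnu|E rx]; first exact: fixedD.
rewrite inE nuN /= sel_big // E; lia.
Qed.

End DesignCore.

(** * Profiles with enough links *)

Section Good.
Variables (m : nat) (Nd : finType).

(** The vertices of Z are set apart because the default choice will be imposed
    on them; they do not help to adjust the numbers of choices. *)
Definition share (V : finType) (N : V -> {set Nd}) (Z : {set V}) (K : nat) : rel Nd :=
  fun nu nu' => [exists P : {set Nd},
    [&& (K <= #|[set x | (x \notin Z) && (N x == P)]|)%N, nu \in P & nu' \in P]].

(** What one balanced choice needs. The nodes fall into classes, each profile
    lies in one class, and frequent profiles link each class. The units u are
    the numbers of choices to be realised; on each class their sum must agree
    with the number of choices available there, and modulo m both are 0. *)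
Definition good (V : finType) (N : V -> {set Nd}) (Z : {set V}) (K : nat) : Prop :=
  exists (lab : Nd -> nat) (u : Nd -> 'Z_m),
  [/\ forall nu, u nu \is a GRing.unit,
      forall k, \sum_(nu | lab nu == k) u nu = 0,
      forall x nu nu', nu \in N x -> nu' \in N x -> lab nu = lab nu',
      forall k, #|[set x | [exists nu in N x, lab nu == k]]|%:R = 0 :> 'Z_m
    & forall nu nu', lab nu = lab nu' -> connect (share N Z K) nu nu'].

Lemma good_weaken (V : finType) (N : V -> {set Nd}) Z K K' :
  (K' <= K)%N -> good N Z K -> good N Z K'.
Proof.
move=> le [lab [u [uU u0 mono c0 conn]]]; exists lab, u; split=> // nu nu' /conn.
apply: connect_sub => {}nu {}nu' /existsP[P /and3P[h nuP nuP']].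
by apply: connect1; apply/existsP; exists P; rewrite nuP nuP' (leq_trans le).
Qed.

Lemma card_prod_fst (V : finType) (A : {set V}) (B : {set 'Z_m}) :
  #|[set y : V * 'Z_m | (y.1 \in A) && (y.2 \in B)]| = (#|A| * #|B|)%N.
Proof. by rewrite -cardsX; apply: eq_card => y; rewrite !inE. Qed.

Lemma card_preim_bij (V1 V2 : finType) (g : V1 -> V2) (A : {set V2}) :
  bijective g -> #|[set y | g y \in A]| = #|A|.
Proof.
case=> h gK hK; rewrite -(card_imset _ (can_inj hK)); apply: eq_card => y.
rewrite inE; apply/idP/imsetP => [yA|[x xA ->]]; first by exists (g y); rewrite ?gK.
by rewrite hK.
Qed.

Section Lift.
Variables (V V1 : finType) (g : V1 -> V * 'Z_m) (Z : {set V}) (Z1 : {set V1}).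
Hypotheses (m_gt3 : (3 < m)%N) (g_bij : bijective g).
Hypothesis Z1P : forall y, y \in Z1 -> (g y).1 \in Z /\ (g y).2 = 0.

(** There are m points above each vertex. *)
Lemma count_lift (N : V -> {set Nd}) (Q : pred {set Nd}) :
  #|[set y | Q (N (g y).1)]|%:R = 0 :> 'Z_m.
Proof.
have -> : [set y | Q (N (g y).1)]
        = [set y | g y \in [set z : V * 'Z_m | (z.1 \in [set x | Q (N x)]) && (z.2 \in [set:
          'Z_m])]].
  by apply/setP=> y; rewrite !inE andbT.
rewrite card_preim_bij // card_prod_fst cardsT card_Zm ?natrM ?natr_m0 ?mulr0 //.
all: lia.
Qed.

Lemma card_fibre (N : V -> {set Nd}) P :
  (m.-1 * #|[set x | N x == P]|
     <= #|[set y | (y \notin Z1) && (N (g y).1 == P)]|)%N.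
Proof.
have -> : m.-1 = #|[set~ (0 : 'Z_m)]|.
  by rewrite cardsC1 card_Zm //; lia.
rewrite mulnC -card_prod_fst -(card_preim_bij _ g_bij).
apply: subset_leq_card; apply/subsetP=> y; rewrite !inE => /andP[-> t0].
by rewrite andbT; apply: contraNN t0 => /Z1P[_ /eqP].
Qed.

Lemma card_fibre_out (N : V -> {set Nd}) P :
  (m * #|[set x | (x \notin Z) && (N x == P)]|
     <= #|[set y | (y \notin Z1) && (N (g y).1 == P)]|)%N.
Proof.
rewrite -{1}(card_Zm (_ : 1 < m)%N) -?cardsT; last by lia.
rewrite mulnC -card_prod_fst -(card_preim_bij _ g_bij).
apply: subset_leq_card; apply/subsetP=> y; rewrite !inE andbT => /andP[xZ ->].
by rewrite andbT; apply: contraNN xZ => /Z1P[].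
Qed.

(** A direction other than the one being split keeps its profiles, and all
    points above a vertex outside Z stay outside Z1. *)
Lemma good_lift (N : V -> {set Nd}) K : good N Z K ->
  good (fun y => N (g y).1) Z1 (m * K)%N.
Proof.
case=> lab [u [uU u0 mono c0 conn]]; exists lab, u; split=> //.
- by move=> x nu nu'; apply: mono.
- by move=> k; apply: (count_lift N (fun P => [exists nu in P, lab nu == k])).
move=> nu nu' /conn; apply: connect_sub => {}nu {}nu' /existsP[P /and3P[h nuP nuP']].
apply: connect1; apply/existsP; exists P; rewrite nuP nuP' !andbT.
by apply: leq_trans (card_fibre_out N P); rewrite leq_mul2l h orbT.
Qed.

(** Of the m points above a vertex only the one with t = 0 can lie in Z1. *)
Lemma good_lift_base (N : V -> {set Nd}) K (lab : Nd -> nat) (u : Nd -> 'Z_m) :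
  (forall nu, u nu \is a GRing.unit) ->
  (forall k, \sum_(nu | lab nu == k) u nu = 0) ->
  (forall x nu nu', nu \in N x -> nu' \in N x -> lab nu = lab nu') ->
  (forall x, (K <= #|[set x' | N x' == N x]|)%N) ->
  (forall nu nu', lab nu = lab nu' ->
     connect (fun nu nu' => [exists x, (nu \in N x) && (nu' \in N x)]) nu nu') ->
  good (fun y => N (g y).1) Z1 (m.-1 * K)%N.
Proof.
move=> uU u0 mono cK conn; exists lab, u; split=> //.
- by move=> x nu nu'; apply: mono.
- by move=> k; apply: (count_lift N (fun P => [exists nu in P, lab nu == k])).
move=> nu nu' /conn; apply: connect_sub => {}nu {}nu' /existsP[x /andP[nuP nuP']].
apply: connect1; apply/existsP; exists (N x); rewrite nuP nuP' !andbT.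
by apply: leq_trans (card_fibre N (N x)); rewrite leq_mul2l cK orbT.
Qed.

Section Child.
Variables (a : nat) (N Nc : V -> {set Nd}) (rch : pred {set Nd}) (neg : bool).
Hypothesis (a_ge2 : (2 <= a)%N).
Hypothesis Nc_sub : forall x, Nc x \subset N x.
Hypothesis rch_card : forall P, rch P -> #|P| = a.
Hypothesis big_child : (2 <= (if neg then a - a./2 else a./2))%N.
Hypothesis windows : forall P r, rch P -> (r < 4)%N -> exists x,
  Nc x = [set nu in P | neg (+) window a r (index nu (enum P))].

Let cshare := share (fun y => Nc (g y).1) Z1 m.-1.

Lemma child_window P r nu nu' : rch P -> (r < 4)%N -> nu \in P -> nu' \in P ->
  neg (+) window a r (index nu (enum P)) ->
  neg (+) window a r (index nu' (enum P)) -> connect cshare nu nu'.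
Proof.
move=> rP r4 nuP nuP' h h'; have [x Ex] := windows rP r4.
apply: connect1; apply/existsP; exists (Nc x); rewrite Ex !inE nuP nuP' h h' !andbT -Ex.
apply: leq_trans (card_fibre Nc (Nc x)).
rewrite -[X in (X <= _)%N]muln1 leq_mul2l; apply/orP; right.
by apply/card_gt0P; exists x; rewrite inE.
Qed.

Lemma cshareC : connect_sym cshare.
Proof.
apply: sym_connect_sym => nu nu'; apply: eq_existsb => P.
by rewrite [(nu \in P) && _]andbC.
Qed.

(** Two members in a common window, or in a common complement of a window, are
    linked. Consecutive windows overlap once they have two elements; the
    complements for the roles 3, 1 and 0 overlap in the positions 0 and a -
    1. *)
Lemma child_profile P nu nu' : rch P -> nu \in P -> nu' \in P ->
  connect cshare nu nu'.
Proof.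
move=> rP nuP nuP'.
have sP : size (enum P) = a by rewrite -cardE rch_card.
have idx mu : mu \in P -> (index mu (enum P) < a)%N.
  by move=> muP; rewrite -sP index_mem mem_enum.
have nthP l : (l < a)%N -> exists2 mu, mu \in P & index mu (enum P) = l.
  move=> la; exists (nth nu (enum P) l); first by rewrite -mem_enum mem_nth ?sP.
  by rewrite index_uniq ?enum_uniq ?sP.
have step r mu1 mu2 : (r < 4)%N -> mu1 \in P -> mu2 \in P ->
    neg (+) window a r (index mu1 (enum P)) ->
    neg (+) window a r (index mu2 (enum P)) -> connect cshare mu1 mu2.
  by move=> *; apply: (@child_window P r).
suff [mu0 h] : exists mu0, forall mu, mu \in P -> connect cshare mu mu0.
  by apply: connect_trans (h _ nuP) _; rewrite cshareC h.
move: step big_child; case: neg => /= step big.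
  have [mu0 mu0P E0] := nthP 0%N (ltnW a_ge2); exists mu0 => mu muP.
  have [mue mueP Ee] := nthP a.-1 (ltac:(lia) : (a.-1 < a)%N).
  have la := idx _ muP.
  have [lt|ge] := ltnP (index mu (enum P)) (a - a./2).
    apply: (step 3) => //=; rewrite ?E0 //=; lia.
  apply: (@connect_trans _ _ mue).
    apply: (step 0) => //=; rewrite ?Ee; lia.
  apply: (step 1) => //=; rewrite ?Ee ?E0 //=; lia.
have [mu1 mu1P E1] := nthP 1%N a_ge2; exists mu1.
have [mub mubP Eb] := nthP a./2 (ltac:(lia) : (a./2 < a)%N).
have cb : connect cshare mub mu1.
  by apply: (step 1%N) => //=; rewrite ?Eb ?E1; lia.
have low mu : mu \in P -> (index mu (enum P) < a.-1)%N -> connect cshare mu mu1.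
  move=> muP la.
  have [lt|gt] := ltnP (index mu (enum P)) a./2.
    by apply: (step 0) => //=; rewrite ?E1; lia.
  apply: connect_trans cb; apply: (step 2%N) => //=; rewrite ?Eb; lia.
move=> mu muP; have la := idx _ muP.
have [lt|ge] := ltnP (index mu (enum P)) a.-1; first exact: low.
have [mue mueP Ee] := nthP a.-2 (ltac:(lia) : (a.-2 < a)%N).
apply: (@connect_trans _ _ mue); last by apply: low; rewrite ?Ee //; lia.
by apply: (step 3%N) => //=; rewrite ?Ee; lia.
Qed.

(** The classes and units of the parent remain valid for each half; the links
    of a rich profile are recovered from its windows. *)
Lemma good_child (lab : Nd -> nat) (u : Nd -> 'Z_m) :
  (forall nu, u nu \is a GRing.unit) ->
  (forall k, \sum_(nu | lab nu == k) u nu = 0) ->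
  (forall x nu nu', nu \in N x -> nu' \in N x -> lab nu = lab nu') ->
  (forall nu nu', lab nu = lab nu' -> connect (fun nu nu' =>
     [exists P : {set Nd}, [&& rch P, nu \in P & nu' \in P]]) nu nu') ->
  good (fun y => Nc (g y).1) Z1 m.-1.
Proof.
move=> uU u0 mono conn; exists lab, u; split=> //.
- by move=> x nu nu' h h'; apply: mono; apply: (subsetP (Nc_sub _)); eassumption.
- by move=> k; apply: (count_lift Nc (fun P => [exists nu in P, lab nu == k])).
move=> nu nu' /conn; apply: connect_sub => {}nu {}nu' /existsP[P /and3P[rP nuP nuP']].
exact: child_profile rP nuP nuP'.
Qed.

End Child.
End Lift.
End Good.

(** * Balanced choices that keep the links *)

Section DesignStep.
Variables (m : nat) (Nd V V1 : finType) (g : V1 -> V * 'Z_m).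
Variables (Z : {set V}) (Z1 : {set V1}).
Hypotheses (m_gt3 : (3 < m)%N) (g_bij : bijective g).
Hypothesis Z1P : forall y, y \in Z1 -> (g y).1 \in Z /\ (g y).2 = 0.
Variables (a : nat) (N : V -> {set Nd}) (F : pred Nd).
Hypotheses (a_ge2 : (2 <= a)%N) (cardN : forall x, #|N x| = a).
Hypothesis F_last : forall x nu, nu \in N x -> F nu -> index nu (enum (N x)) = a.-1.

(** [D x] is the part of the profile that goes to the new direction. A half
    with two nodes or more per vertex will be split again, and so it has to be
    good. *)
Definition split_design (D : V -> {set Nd}) : Prop :=
  [/\ forall x, D x \subset N x, forall x, #|D x| = a./2,
      forall nu, \sum_x ((nu \in D x)%:R : 'Z_m) \is a GRing.unit,
      (2 <= a./2)%N -> good m (fun y => D (g y).1) Z1 m.-1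
    & (2 <= a - a./2)%N -> good m (fun y => N (g y).1 :\: D (g y).1) Z1 m.-1].

Lemma split_design_windows (D : V -> {set Nd}) (ord : {set Nd} -> seq V)
    (lab : Nd -> nat) (u : Nd -> 'Z_m) :
  (forall P x, x \in ord P -> N x = P) ->
  (forall x, D x \subset N x) -> (forall x, #|D x| = a./2) ->
  (forall nu, \sum_x (nu \in D x)%:R = u nu) ->
  (forall P x0 r, rich m ord P -> (r < 4)%N ->
    D (nth x0 (ord P) r) = [set nu in P | window a r (index nu (enum P))]) ->
  (forall nu, u nu \is a GRing.unit) ->
  (forall k, \sum_(nu | lab nu == k) u nu = 0) ->
  (forall x nu nu', nu \in N x -> nu' \in N x -> lab nu = lab nu') ->
  (forall nu nu', lab nu = lab nu' -> connect (fun nu nu' =>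
     [exists P : {set Nd}, [&& rich m ord P, nu \in P & nu' \in P]]) nu nu') ->
  split_design D.
Proof.
move=> ordN Dsub Dcard Dtot Dwin uU u0 mono conn.
have first_vertex P r : rich m ord P -> (r < 4)%N ->
    exists x, N x = P /\ D x = [set nu in P | window a r (index nu (enum P))].
  move=> rP r4; have rs : (r < size (ord P))%N by apply: leq_trans rP; lia.
  case E: (ord P) (rs) => [|x0 s] // _; exists (nth x0 (ord P) r).
  by rewrite Dwin // (@ordN P) // mem_nth.
have rc P : rich m ord P -> #|P| = a.
  by move=> rP; have [x [<- _]] := first_vertex P 0%N rP isT.
split=> //.
- by move=> nu; rewrite Dtot.
- move=> big; apply: (@good_child _ _ _ _ g Z Z1 m_gt3 g_bij Z1P a N D (rich m ord) false) conn
  => //.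
  by move=> P r rP r4; have [x [_ E]] := first_vertex P r rP r4; exists x.
move=> big; apply: (@good_child _ _ _ _ g Z Z1 m_gt3 g_bij Z1P a N
  (fun x => N x :\: D x) (rich m ord) true) conn => //.
- by move=> x; apply: subsetDl.
move=> P r rP r4; have [x [EN E]] := first_vertex P r rP r4; exists x.
apply/setP=> nu; rewrite EN E !inE.
by case: (nu \in P); rewrite ?andbF ?andbT.
Qed.

(** The vertices of Z are left out of the lists [ord P], so they have the
    default role and choose the first half of their profiles; a node of F,
    being last, is not among these. *)
Lemma design_step : good m N Z m.*2.+2 ->
  exists2 D, split_design D & forall x nu, x \in Z -> F nu -> nu \notin D x.
Proof.
case=> lab [u [uU u0 mono c0 conn]].
pose ord P := enum [set x | (x \notin Z) && (N x == P)].
have ordN P x : x \in ord P -> N x = P.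
  by rewrite mem_enum inE => /andP[_ /eqP].
have conn' nu nu' : lab nu = lab nu' -> connect (fun nu nu' =>
    [exists P : {set Nd}, [&& rich m ord P, nu \in P & nu' \in P]]) nu nu'.
  move/conn; apply: connect_sub => {}nu {}nu' /existsP[P h].
  by apply: connect1; apply/existsP; exists P; rewrite /rich -cardE.
have [||||||D [Dsub Dcard Dtot Dwin Dlast]] :=
    @design_core V Nd m a m_gt3 a_ge2 N ord cardN ordN _ pred0 lab _ _ mono u.
- by move=> P; apply: enum_uniq.
- by [].
- move=> nu nu' _ _ /conn'; apply: connect_sub => {}nu {}nu' h.
  by apply: connect1; rewrite /free_share.
- by [].
- by [].
- by move=> k; rewrite u0 natrM c0 mulr0.
exists D; first exact: split_design_windows Dwin _ _ _ _.
move=> x nu xZ Fnu; have [nuN|nuN] := boolP (nu \in N x); last first.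
  by apply: contraNN nuN; apply: (subsetP (Dsub x)).
have [_] := Dlast _ _ nuN; apply; first exact: F_last.
rewrite /role; case: ifP => // rN; apply: leq_trans rN _.
by rewrite memNindex // mem_enum inE xZ.
Qed.

End DesignStep.

Section DesignFirst.
Variables (m : nat) (Nd V V1 : finType) (g : V1 -> V * 'Z_m).
Variables (Z1 : {set V1}).
Hypotheses (m_gt3 : (3 < m)%N) (g_bij : bijective g).
Hypothesis Z1P : forall y, y \in Z1 -> (g y).2 = 0.
Variables (a : nat) (N : V -> {set Nd}) (F : pred Nd) (ex : Nd -> V).
Hypotheses (a_ge3 : (3 <= a)%N) (cardN : forall x, #|N x| = a).
Hypothesis F_last : forall x nu, nu \in N x -> F nu -> index nu (enum (N x)) = a.-1.
Hypothesis exN : forall nu, F nu -> nu \in N (ex nu).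
Hypothesis F_profile : forall x nu, nu \in N x -> F nu -> N x = N (ex nu).
Hypothesis cardV : #|V|%:R = 0 :> 'Z_m.
Hypothesis all_rich : forall x, (m.*2.+2 <= #|[set x' | N x' == N x]|)%N.
Hypothesis F_unit : exists u : Nd -> 'Z_m,
  [/\ forall nu, u nu \is a GRing.unit, forall nu, F nu -> u nu = 1 & \sum_nu u nu = 0].
Hypothesis conn_free : forall nu nu', ~~ F nu -> ~~ F nu' -> connect (fun nu nu' =>
  [&& ~~ F nu, ~~ F nu' & [exists x, (nu \in N x) && (nu' \in N x)]]) nu nu'.

(** A node of F is last in its profiles and no amount is moved to it, so only
    the window of role 3 chooses it; it remains to give this role to the exit
    vertex. This is possible as a profile contains at most one node of F, which
    determines the profile. *)
Lemma design_first :
  exists2 D, split_design g Z1 a N D &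
    forall x nu, nu \in N x -> F nu -> (nu \in D x) = (x == ex nu).
Proof.
have a_ge2 : (2 <= a)%N by lia.
pose cls (P : {set Nd}) := enum [set x | N x == P].
(* The exit vertex of a profile is moved to place 3 of its list. *)
pose ord (P : {set Nd}) :=
  if [pick nu | [&& nu \in P, F nu & N (ex nu) == P]] is Some nu
  then let s := rem (ex nu) (cls P) in take 3 s ++ ex nu :: drop 3 s else cls P.
have Funiq x nu nu' : nu \in N x -> nu' \in N x -> F nu -> F nu' -> nu = nu'.
  move=> h h' f f'.
  have e : nu \in enum (N x) by rewrite mem_enum.
  have e' : nu' \in enum (N x) by rewrite mem_enum.
  by rewrite -(nth_index nu e) F_last // -(F_last h' f') nth_index.
have ordP P : perm_eq (ord P) (cls P).
  rewrite /ord; case: pickP => [nu /and3P[nuN f /eqP E]|//] /=.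
  have exc : ex nu \in cls P by rewrite mem_enum inE E.
  rewrite perm_sym (permPl (perm_to_rem exc)) -[X in perm_eq (_ :: X) _](cat_take_drop 3).
  by rewrite -cat1s -[X in perm_eq _ (_ ++ X)]cat1s perm_catCA.
have ordN P x : x \in ord P -> N x = P.
  by rewrite (perm_mem (ordP P)) mem_enum inE => /eqP.
have ord_uniq P : uniq (ord P) by rewrite (perm_uniq (ordP P)) enum_uniq.
have ord_mem x : x \in ord (N x) by rewrite (perm_mem (ordP _)) mem_enum inE.
have richN x : rich m ord (N x) by rewrite /rich (perm_size (ordP _)) -cardE all_rich.
have role3 x nu : nu \in N x -> F nu -> (role m N ord x == 3) = (x == ex nu).
  move=> nuN f; rewrite /role richN; have xo := ord_mem x.
  have ro : (2 < size (rem (ex nu) (cls (N x))))%N.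
    have exc : ex nu \in cls (N x) by rewrite mem_enum inE -(F_profile nuN f).
    rewrite size_rem // -cardE; have := all_rich x; lia.
  move: xo; rewrite /ord; case: pickP => [nu' /and3P[nuN' f' _]|/(_ nu)]; last first.
    by rewrite nuN f (F_profile nuN f) eqxx.
  rewrite -(Funiq x nu nu') //; set s := rem _ _ => xo.
  have st : size (take 3 s) = 3%N by rewrite size_takel.
  apply/eqP/eqP=> [E|->].
    by rewrite -(nth_index x xo) E nth_cat st ltnn subnn.
  have exs : ex nu \notin take 3 s.
    apply: contraTN (isT) => /mem_take; rewrite mem_rem_uniq ?enum_uniq //.
    by rewrite !inE eqxx.
  by rewrite index_cat (negPf exs) st /= eqxx addn0.
have [u [uU uF u0]] := F_unit.
have conn nu nu' : connect (fun nu nu' =>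
    [exists P : {set Nd}, [&& rich m ord P, nu \in P & nu' \in P]]) nu nu'.
  set R : rel Nd := fun _ _ => _.
  have RS mu mu' x : mu \in N x -> mu' \in N x -> R mu mu'.
    by move=> h h'; apply/existsP; exists (N x); rewrite richN h.
  have hub mu : exists mu', [/\ ~~ F mu', connect R mu mu' & connect R mu' mu].
    have [f|f] := boolP (F mu); last by exists mu; rewrite connect0.
    have /card_gt1P[y [y' [yN y'N neq]]] : (1 < #|N (ex mu)|)%N by rewrite cardN.
    have [mu' mu'N nmu'] : exists2 mu', mu' \in N (ex mu) & mu' != mu.
      have [E|ne] := eqVneq y mu; last by exists y.
      by exists y'; rewrite // -E eq_sym.
    exists mu'; have muN := exN f; split.
    - by apply: contraNN nmu' => f'; rewrite (Funiq _ _ _ muN mu'N).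
    - by apply: connect1; apply: RS muN mu'N.
    - by apply: connect1; apply: RS mu'N muN.
  have [mu [fmu c1 _]] := hub nu; have [mu' [fmu' _ c2]] := hub nu'.
  apply: connect_trans c1 (connect_trans _ c2).
  apply: connect_sub (conn_free fmu fmu') => x y /and3P[_ _ /existsP[v /andP[h h']]].
  by apply: connect1; apply: RS h h'.
have [|||||D [Dsub Dcard Dtot Dwin Dlast]] :=
    @design_core V Nd m a m_gt3 a_ge2 N ord cardN ordN ord_uniq F (fun=> 0%N) F_last _ _ u.
- move=> nu nu' f f' _; apply: connect_sub (conn_free f f') => {f f'}nu {}nu'.
  case/and3P=> f f' /existsP[x /andP[h h']]; apply: connect1.
  by rewrite /free_share f f'; apply/existsP; exists (N x); rewrite richN h.
- by [].
- by [].
- move=> nu f; rewrite uF // (_ : [set _ | _] = [set ex nu]) ?cards1 //.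
  apply/setP=> x; rewrite !inE; have [nuN|nuN] /= := boolP (nu \in N x).
    exact: role3.
  by apply/esym/negbTE; apply: contraNN nuN => /eqP ->; apply: exN.
- move=> k; case: k => [|k]; rewrite ?big_pred0_eq.
    rewrite (eq_bigl xpredT) // u0 natrM (_ : [set _ | _] = setT) ?cardsT ?cardV ?mulr0 //.
    apply/setP=> x; rewrite !inE; apply/existsP.
    have /card_gt0P[nu nuN] : (0 < #|N x|)%N by rewrite cardN; lia.
    by exists nu; rewrite nuN.
  rewrite (_ : [set _ | _] = set0) ?cards0 ?muln0 //.
  by apply/setP=> x; rewrite !inE; apply/existsP=> -[nu]; rewrite andbF.
exists D; last by move=> x nu nuN f; have [E _] := Dlast _ _ nuN; rewrite (E f) (role3 _ _ nuN f).
have Z1P' y : y \in Z1 -> (g y).1 \in [set: V] /\ (g y).2 = 0.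
  by move/Z1P=> ->; rewrite inE.
apply: (@split_design_windows _ _ _ _ g setT Z1 m_gt3 g_bij Z1P' a N a_ge2 cardN D ord (fun=>
  0%N) u) => //.
case=> [|k]; first by rewrite (eq_bigl xpredT).
by rewrite big_pred0_eq.
Qed.

End DesignFirst.

(** * Coordinates of a split *)

(** The enumeration of a sum type lists the left summand first. *)
Lemma index_last_inr (T1 T2 : finType) (A : {set T1 + T2}) (y : T2) :
  inr y \in A -> (forall y', inr y' \in A -> y' = y) ->
  index (inr y) (enum A) = #|A|.-1.
Proof.
move=> yA yU.
have EA : enum A = [seq z <- sum_enum T1 T2 | z \in A].
  by rewrite /enum_mem; congr filter; rewrite [in LHS]unlock.
have := mem_enum A (inr y); have := enum_uniq A; have := cardE A.
rewrite EA yA /sum_enum filter_cat.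
set s1 := [seq z <- _ | _]; set s2 := [seq z <- _ | _].
have s1y : inr y \notin s1.
  by rewrite mem_filter negb_and; apply/orP; right; apply/negP=> /mapP[].
have s2E z : z \in s2 -> z = inr y.
  by rewrite mem_filter => /andP[zA /mapP[y' _ E]]; rewrite E (yU y') // -E.
move=> -> ; rewrite cat_uniq mem_cat (negPf s1y) /= => /and3P[_ _ us2] ys2.
rewrite index_cat (negPf s1y) size_cat.
case: s2 s2E us2 ys2 => [|z s] // zE /andP[zs _] _.
have Ez : z = inr y by apply: zE; rewrite mem_head.
have -> : s = [::].
  case: s zE zs => // z' s zE; rewrite inE negb_or => /andP[/eqP[]].
  by rewrite Ez (zE z') // !inE eqxx orbT.
by rewrite Ez /= eqxx addn0 addn1.
Qed.

Section Split.
Variables (m n : nat).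
Implicit Types (i l : 'I_n) (x : vertex m n) (y : vertex m n.+1).

Lemma unident_bij i : bijective (@unident m n i).
Proof. exact: Bijective (@unidentK m n i) (@identK m n i). Qed.

Definition split_dir_at i l (e : bool) : 'I_n.+1 :=
  if (l == i) && e then new_coord i else lift (new_coord i) l.

Lemma ident_step i l (e : bool) x (t : 'Z_m) : (e -> l = i) ->
  ident i (x + unit_vec m l, t + e%:R) = ident i (x, t) + unit_vec m (split_dir_at i l e).
Proof.
move=> ei; apply/rowP=> j; rewrite !mxE /split_dir_at.
have [E|NE] := eqVneq l i; last first.
  have -> : e = false by apply/negbTE; apply: contraNN NE => /ei ->.
  case: unliftP => [l'|] -> /=; rewrite ?mxE /=; last first.
    by rewrite (negPf (neq_lift _ _)).
  by rewrite (inj_eq lift_inj) addr0 -!addrA; congr (_ + _); apply: addrC.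
rewrite E; case: e ei => ei /=; case: unliftP => [l'|] -> /=; rewrite ?mxE /= ?eqxx //=.
- rewrite [lift _ _ == _]eq_sym (negPf (neq_lift _ _)) addr0.
  by case: eqP => [->|_]; rewrite /= ?addr0 ?subr0 //; ring.
- by rewrite (inj_eq lift_inj); case: (l' == i); rewrite /= ?addr0 //; ring.
by rewrite (negPf (neq_lift _ _)).
Qed.

End Split.

(** * Stages of the iterated split *)

Local Opaque unident ident.

Section Stages.
Variables (m p k : nat).
Hypothesis m_gt3 : (3 < m)%N.

(** The auxiliary colours contribute one cycle each. In the last summand, 0 and
    1 stand for F_0 and F_1, and 2 and 3 for the two cycles of F_2. *)
Definition node_type : finType := ((('I_p + 'I_p) + 'I_4)%type : finType).

(** F_2 raises w exactly in the steps from a height h >= 2. Since m is even and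
    the subtraction is truncated, the parity of h - 2 changes in the same
    steps. *)
Definition parity_class (v : vertex m 3) : bool :=
  odd (val (wc v)) (+) odd (height v - 2).

Definition F_node (f : 'I_3) (e : bool) : 'I_4 :=
  inord (if val f == 2%N then (2 + e)%N else val f).

Definition node (c : colour p) (e : bool) : node_type :=
  match c with inl f => inr (F_node f e) | inr l => inl l end.

Definition is_F (nu : node_type) : bool := if nu is inr _ then true else false.

Lemma F_node_colour f f' e e' : F_node f e = F_node f' e' -> f = f'.
Proof.
move/(congr1 val); rewrite /= !inordK; last 2 first.
- by case: f' => [[|[|[|f']]] hf] //=; case: e'.
- by case: f => [[|[|[|f]]] hf] //=; case: e.
case: f => [[|[|[|f]]] hf] //=; case: f' => [[|[|[|f']]] hf'] //= E;
  by [apply: val_inj | case: e E; case: e'].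
Qed.

Lemma node_colour c c' e e' : node c e = node c' e' -> c = c'.
Proof.
by case: c c' => [f|l] [f'|l'] //= [] => [/(@F_node_colour f)|] ->.
Qed.

Section Profile.
Variables (n : nat) (bs : vertex m n -> vertex m 3) (dir : colour p -> vertex m n -> 'I_n).

Definition profile (i : 'I_n) (x : vertex m n) : {set node_type} :=
  [set node c (parity_class (bs x)) | c in [set c | dir c x == i]].

Lemma card_profile i x : #|profile i x| = #|[set c | dir c x == i]|.
Proof. by rewrite card_imset // => c c' /node_colour. Qed.

Lemma mem_profile c i x :
  (node c (parity_class (bs x)) \in profile i x) = (dir c x == i).
Proof.
apply/imsetP/eqP=> [[c']|dc]; last by exists c; rewrite ?inE ?dc.
by rewrite inE => /eqP <- /node_colour ->.
Qed.

Lemma profileP nu i x : nu \in profile i x ->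
  exists2 c, nu = node c (parity_class (bs x)) & dir c x = i.
Proof. by case/imsetP=> c; rewrite inE => /eqP; exists c. Qed.

(** The three distinguished colours have distinct directions at each vertex, so
    a profile contains at most one of them. *)
Lemma profile_F_last i x nu :
  (forall f f' x, dir (inl f) x = dir (inl f') x -> f = f') ->
  nu \in profile i x -> is_F nu ->
  index nu (enum (profile i x)) = #|profile i x|.-1.
Proof.
move=> dirF; case: nu => // y yP _; apply: index_last_inr => // y' y'P.
have [[f|l] //= [->] df] := profileP yP; have [[f'|l] //= [->] df'] := profileP y'P.
by rewrite (dirF f f' x) // df.
Qed.
End Profile.

(** A factorization obtained by successive splits, with the projection to the
    base torus and the zero section of this projection. The side of a direction
    is false if it descends from w, and true if it descends from x or y. *)
Record stage (n : nat) := Stage {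
  st_mult : 'I_n -> nat;
  st_map : colour p -> vertex m n -> vertex m n;
  st_dir : colour p -> vertex m n -> 'I_n;
  st_base : vertex m n -> vertex m 3;
  st_lift : vertex m 3 -> vertex m n;
  st_side : 'I_n -> bool }.

Definition zeros n (s : stage n) : {set vertex m n} := [set st_lift s v | v : vertex m 3].

Definition next n (s : stage n) (i : 'I_n) (delta : colour p -> vertex m n -> bool) :
    stage n.+1 :=
  Stage (split_mult (st_mult s) i) (split_map (st_map s) i delta)
    (fun c y => let x := (unident i y).1 in split_dir_at i (st_dir s c x) (delta c x))
    (fun y => st_base s (unident i y).1)
    (fun v => ident i (st_lift s v, 0))
    (fun j => if unlift (new_coord i) j is Some l then st_side s l else st_side s i).

(** The part of the invariant that does not concern the choice of the next
    split. [inv_cycle] says that the nodes are the cycles of the colours; [rem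
    e] is the number of splits that remain to be done on the side e. *)
Record pre_inv n (s : stage n) (rem : bool -> nat) : Prop := PreInv {
  inv_fact : factorizes (st_mult s) (st_map s) (st_dir s);
  inv_base : forall c x, st_base s (st_map s c x) = init_map k c (st_base s x);
  inv_lift : cancel (st_lift s) (st_base s);
  inv_cycle : forall c x y,
    node c (parity_class (st_base s x)) = node c (parity_class (st_base s y)) ->
    fconnect (st_map s c) x y;
  inv_F : forall f f' x, st_dir s (inl f) x = st_dir s (inl f') x -> f = f';
  inv_rem : forall e, (\sum_(i | st_side s i == e) (st_mult s i).-1)%N = rem e;
  inv_pos : forall i, (0 < st_mult s i)%N }.

Definition st_profile n (s : stage n) := profile (st_base s) (st_dir s).

Hypothesis node_inv : forall c (v : vertex m 3),
  node c (parity_class (init_map k c v)) = node c (parity_class v).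

Lemma inv_fconnect n (s : stage n) rem c x y : pre_inv s rem ->
  fconnect (st_map s c) x y =
  (node c (parity_class (st_base s x)) == node c (parity_class (st_base s y))).
Proof.
move=> I; apply/idP/eqP=> [/iter_findex <-|]; last exact: (inv_cycle I).
elim: (findex _ _ _) => [|j IHj] //=.
by rewrite (inv_base I) node_inv.
Qed.

Section PreStep.
Variables (n : nat) (s : stage n) (rem : bool -> nat) (i : 'I_n).
Variables (D : vertex m n -> {set node_type}).
Hypotheses (I : pre_inv s rem) (a_ge2 : (2 <= st_mult s i)%N).
Hypotheses (Dsub : forall x, D x \subset st_profile s i x)
  (Dcard : forall x, #|D x| = (st_mult s i)./2)
  (Dunit : forall nu, \sum_x ((nu \in D x)%:R : 'Z_m) \is a GRing.unit).

Definition delta_of (c : colour p) (x : vertex m n) : bool :=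
  node c (parity_class (st_base s x)) \in D x.

Lemma delta_dir c x : delta_of c x -> st_dir s c x = i.
Proof. by move/(subsetP (Dsub x)); rewrite /st_profile mem_profile => /eqP. Qed.

Lemma card_delta x : #|[set c | delta_of c x]| = (st_mult s i)./2.
Proof.
have nI : injective (fun c => node c (parity_class (st_base s x))).
  by move=> c c' /node_colour.
rewrite -(Dcard x) -(card_imset _ nI).
apply: eq_card => nu; apply/imsetP/idP=> [[c]|nuD]; first by rewrite inE => h ->.
have [c E _] := profileP (subsetP (Dsub x) _ nuD).
by exists c => //; rewrite inE /delta_of -E.
Qed.

Lemma balanced_delta : balanced_split (st_mult s) (st_map s) i delta_of.
Proof.
exists (st_dir s); first exact: inv_fact I.
split=> //; first exact: delta_dir.
by move=> x; rewrite -(card_delta x) -sum1dep_card [RHS]big_mkcond; apply: eq_bigr => c _; case: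
  (delta_of c x).
Qed.

Let s' := next s i delta_of.

Lemma next_profile_new y : st_profile s' (new_coord i) y = D (unident i y).1.
Proof.
apply/setP=> nu; apply/idP/idP.
  case/profileP=> c -> /=; rewrite /split_dir_at; case: ifP => [/andP[_]|_ /eqP] //.
  by rewrite eq_sym (negPf (neq_lift _ _)).
move=> nuD; have [c E dc] := profileP (subsetP (Dsub _) _ nuD).
apply/imsetP; exists c; rewrite ?inE //= /split_dir_at dc eqxx /delta_of -E nuD.
by rewrite eqxx.
Qed.

Lemma next_profile_lift l y : st_profile s' (lift (new_coord i) l) y =
  if l == i then st_profile s i (unident i y).1 :\: D (unident i y).1
  else st_profile s l (unident i y).1.
Proof.
set x := (unident i y).1; apply/setP=> nu.
have [->|NE] := eqVneq l i.
  rewrite inE; apply/idP/idP.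
    case/profileP=> c -> /=; rewrite -/x /split_dir_at; case: ifP => [_ /eqP|NE /lift_inj dc].
      by rewrite (negPf (neq_lift _ _)).
    rewrite mem_profile dc eqxx andbT; move: NE; rewrite dc eqxx /= => /negbT.
    by rewrite /delta_of.
  case/andP=> nuD /profileP[c E dc]; apply/imsetP; exists c; rewrite ?inE //=.
  by rewrite -/x /split_dir_at dc eqxx /delta_of -E (negPf nuD).
apply/idP/idP.
  case/profileP=> c -> /=; rewrite -/x /split_dir_at; case: ifP => [_ /eqP|_ /lift_inj <-].
    by rewrite (negPf (neq_lift _ _)).
  by rewrite mem_profile.
case/profileP=> c E dc; apply/imsetP; exists c; rewrite ?inE //=.
by rewrite -/x /split_dir_at dc (negPf NE).
Qed.

Lemma split_map_skew c y : split_map (st_map s) i delta_of c y =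
  ident i (skew (st_map s c) (fun x => (delta_of c x)%:R : 'Z_m) (unident i y)).
Proof. by rewrite /split_map; case: (unident i y). Qed.

Lemma map_inj c : injective (st_map s c).
Proof. by have [/(_ c)/bij_inj] := inv_fact I. Qed.

Lemma next_fact : factorizes (st_mult s') (st_map s') (st_dir s').
Proof.
have [_ Sdir Scard] := inv_fact I; split.
- move=> c; apply: injF_bij => y y'; rewrite /= !split_map_skew.
  move/(can_inj (@identK m n i))/(skew_inj (@map_inj c)).
  exact: (can_inj (@unidentK m n i)).
- move=> c y /=; rewrite split_map_skew -[X in _ = X + _](unidentK i) /skew.
  by case: (unident i y) => x t /=; rewrite Sdir ident_step // => /delta_dir.
move=> y j; rewrite -(card_profile (st_base s') (st_dir s')) -/(st_profile s' j y).
rewrite /= /split_mult; case: unliftP => [l|] ->; last first.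
  by rewrite next_profile_new Dcard.
rewrite next_profile_lift; case: eqP => _; last first.
  by rewrite /st_profile card_profile Scard.
rewrite cardsD (setIidPr (Dsub _)) Dcard /st_profile card_profile Scard.
by rewrite uphalf_half; lia.
Qed.

(** The number of choices of a node is the increment of the fibre coordinate
    along its cycle; as it is a unit, a single cycle lies above each cycle. *)
Lemma next_cycle c y y' :
  node c (parity_class (st_base s' y)) = node c (parity_class (st_base s' y')) ->
  fconnect (st_map s' c) y y'.
Proof.
move=> /= E; rewrite -[y](unidentK i) -[y'](unidentK i).
apply: (fconnect_semiconj (f := skew (st_map s c) (fun x => (delta_of c x)%:R))).
  by move=> z; rewrite split_map_skew identK.
move: E; case: (unident i y) => x t; case: (unident i y') => x' t' /= E.
apply: skew_fconnect; [exact: map_inj| |exact: (inv_cycle I)].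
pose nu := node c (parity_class (st_base s x)).
rewrite (_ : \sum_(_ | _) _ = \sum_z (nu \in D z)%:R) //.
rewrite big_mkcond /=; apply: eq_bigr => z _; rewrite (inv_fconnect _ _ _ I) -/nu.
case: eqP => [->|NE] //.
have [nuD|//] := boolP (nu \in D z).
have [c' E' _] := profileP (subsetP (Dsub z) _ nuD).
by case: NE; rewrite E' (node_colour E').
Qed.

Lemma next_rem e :
  (\sum_(j | st_side s' j == e) (st_mult s' j).-1)%N = (rem e - (e == st_side s i))%N.
Proof.
rewrite -(inv_rem I) big_mkcond (bigD1_ord (new_coord i)) //= unlift_none.
rewrite /split_mult unlift_none [in RHS]big_mkcond /= (bigD1 i) //= [in RHS](bigD1 i) //=.
rewrite liftK eqxx (eq_bigr (fun l => if st_side s l == e then (st_mult s l).-1 else 0)%N); last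
  first.
  by move=> l /negPf NE; rewrite liftK NE.
rewrite [e == _]eq_sym; case: (_ == e); rewrite ?subn0 //.
by have := a_ge2; rewrite uphalf_half; lia.
Qed.

Lemma pre_step : pre_inv s' (fun e => rem e - (e == st_side s i))%N.
Proof.
split.
- exact: next_fact.
- move=> c y /=; rewrite split_map_skew identK.
  exact: (inv_base I).
- by move=> v /=; rewrite identK /= (inv_lift I).
- exact: next_cycle.
- move=> f f' y /=; rewrite /split_dir_at => E.
  apply: (inv_F I (x := (unident i y).1)); move: E.
  case: ifP => [/andP[/eqP -> _]|_]; case: ifP => [/andP[/eqP -> _]|_] //.
  + by move/eqP; rewrite (negPf (neq_lift _ _)).
  + by move/eqP; rewrite eq_sym (negPf (neq_lift _ _)).
  exact: lift_inj.
- exact: next_rem.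
move=> j /=; rewrite /split_mult; case: unliftP => [l|] _; last by lia.
by case: eqP => [_|_]; [lia | exact: (inv_pos I)].
Qed.

End PreStep.

Variable ex : node_type -> vertex m 3.

(** Copies of base vertices move as on the base torus unless they are exits. On
    the side whose turn it is, profiles are frequent enough for a split; on the
    other side they become so through the next split, since m (m - 1) >= 2m +
    2. *)
Record inv n (s : stage n) (turn : bool) (rem : bool -> nat) : Prop := Inv {
  inv_pre : pre_inv s rem;
  inv_exit : forall f v, v != ex (node (inl f) (parity_class v)) ->
    st_map s (inl f) (st_lift s v) = st_lift s (init_map k (inl f : colour p) v);
  inv_good : forall i, (2 <= st_mult s i)%N ->
    good m (st_profile s i) (zeros s) (if st_side s i == turn then m.*2.+2 else m.-1) }.

Lemma zeros_next n (s : stage n) i delta y : y \in zeros (next s i delta) ->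
  (unident i y).1 \in zeros s /\ (unident i y).2 = 0.
Proof.
by case/imsetP=> v _ -> /=; rewrite identK /=; split=> //; apply/imsetP; exists v.
Qed.

Lemma good_ext (V : finType) (N N' : V -> {set node_type}) Z K :
  N =1 N' -> good m N Z K -> good m N' Z K.
Proof.
move=> E [lab [u [uU u0 mono c0 conn]]]; exists lab, u; split=> //.
- by move=> x nu nu'; rewrite -!E; apply: mono.
- move=> q; rewrite -(c0 q); congr _%:R; apply: eq_card => x.
  by rewrite !inE; apply: eq_existsb => nu; rewrite E.
move=> nu nu' /conn; apply: connect_sub => {}nu {}nu' /existsP[P /and3P[h h1 h2]].
apply: connect1; apply/existsP; exists P; rewrite h1 h2 !andbT.
by apply: leq_trans h _; apply: subset_leq_card; apply/subsetP=> x; rewrite !inE E.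
Qed.

(** Some direction on the side whose turn it is has multiplicity at least two,
    because splits remain to be done there. Both halves of it end up on the
    side that is not next. *)
Lemma inv_step n (s : stage n) turn rem : inv s turn rem -> (0 < rem turn)%N ->
  exists i delta, balanced_split (st_mult s) (st_map s) i delta /\
    inv (next s i delta) (~~ turn) (fun e => rem e - (e == turn))%N.
Proof.
case=> I Iex Igood rem_gt0.
have [i /eqP si ai] : exists2 i, st_side s i == turn & (2 <= st_mult s i)%N.
  move: rem_gt0; rewrite -(inv_rem I) lt0n sum_nat_eq0 => /forallPn[i].
  by rewrite negb_imply => /andP[si ai]; exists i => //; lia.
have [_ _ Scard] := inv_fact I.
have cardN x : #|st_profile s i x| = st_mult s i.
  by rewrite /st_profile card_profile Scard.
have gi := Igood i ai; rewrite si eqxx in gi.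
have F_last x nu : nu \in st_profile s i x -> is_F nu ->
    index nu (enum (st_profile s i x)) = (st_mult s i).-1.
  by move=> h h'; rewrite profile_F_last ?cardN //; apply: inv_F I.
have [D [Dsub Dcard Dunit Dnew Dold] DZ] :=
  design_step m_gt3 (unident_bij m i) (zeros_next (delta := fun _ _ => false)) ai cardN F_last gi.
exists i, (delta_of s D); split; first exact: (balanced_delta I ai Dsub Dcard).
have := pre_step I ai Dsub Dcard Dunit; rewrite si => I'.
split=> //=.
- move=> f v vx; rewrite /split_map identK /= (Iex _ _ vx).
  rewrite (_ : delta_of s D (inl f) (st_lift s v) = false) ?addr0 //.
  by apply/negbTE; apply: DZ => //; apply/imsetP; exists v.
move=> j; rewrite /split_mult; case: unliftP => [l|] ->; last first.
  move=> aj; rewrite si (_ : turn == ~~ turn = false); last by case: (turn).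
  by apply: good_ext (Dnew aj) => y; rewrite next_profile_new.
case: eqP => [->|/eqP NE] aj.
  rewrite si (_ : turn == ~~ turn = false); last by case: (turn).
  have {}aj : (2 <= st_mult s i - (st_mult s i)./2)%N by move: aj; rewrite uphalf_half; lia.
  by apply: good_ext (Dold aj) => y; rewrite next_profile_lift // eqxx.
have := good_lift m_gt3 (unident_bij m i) (@zeros_next n s i (delta_of s D)) (Igood l aj).
have mm : (m.*2.+2 <= m * m.-1)%N by nia.
move=> gl; apply: (good_weaken _ (good_ext _ gl)).
  by case: (turn); case: (st_side s l); rewrite //=; nia.
by move=> y; rewrite next_profile_lift // (negPf NE).
Qed.

End Stages.

Local Transparent unident ident.

(** * The selection lists *)

Local Close Scope ring_scope.

Definition valid (p : nat) (l : label) : bool :=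
  match l with inl i => i < p | inr i => i < p end.

Definition members (ps : seq (label * label)) := unzip1 ps ++ unzip2 ps.

Definition double_pairs (f : nat -> label) (c n : nat) :=
  [seq (f l.*2, f l.*2.+1) | l <- iota c n].

Lemma mem_double_pairs f c n x : x \in members (double_pairs f c n) <->
  exists2 i, c.*2 <= i < (c + n).*2 & x = f i.
Proof.
rewrite /members /unzip1 /unzip2 -!map_comp mem_cat; split.
  case/orP=> /mapP[l]; rewrite mem_iota => h ->.
    by exists l.*2 => //; lia.
  by exists l.*2.+1 => //; lia.
case=> i h ->; apply/orP; have [oi|ei] := boolP (odd i); [right|left].
  by apply/mapP; exists i./2; [rewrite mem_iota; lia | rewrite /=; congr f; lia].
by apply/mapP; exists i./2; [rewrite mem_iota; lia | rewrite /=; congr f; lia].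
Qed.

Lemma uniq_double_pairs f c n : injective f -> uniq (members (double_pairs f c n)).
Proof.
move=> fI; rewrite /members /unzip1 /unzip2 -!map_comp cat_uniq.
rewrite !map_inj_uniq ?iota_uniq //=; first 1 last.
- by move=> a b /= /fI [] /double_inj.
- by move=> a b /= /fI /double_inj.
rewrite andbT; apply/hasPn=> _ /mapP[b _ ->]; apply/negP=> /mapP[a _ /= /fI]; lia.
Qed.

(** Up to one pair, each list is a run of consecutive labels. *)
Lemma pairsE p h : pairs p h =
  match h with
  | 0 => [:: (lblA 0, lblB 1)]
  | 1 => if odd p then double_pairs (fun i => lblA i.+1) 0 p./2
         else (lblB 0, lblA 1) :: double_pairs (fun i => lblA i) 1 p./2.-1
  | 2 => if odd p then (lblB 0, lblB 2) :: double_pairs (fun i => lblB i.+1) 1 p./2.-1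
         else double_pairs (fun i => lblB i) 1 p./2.-1
  | _ => [::]
  end.
Proof. by case: h => [|[|[|h]]]. Qed.

Lemma members_cons a b ps : members ((a, b) :: ps) = a :: unzip1 ps ++ b :: unzip2 ps.
Proof. by []. Qed.

Lemma mem_members_cons a b ps x :
  (x \in members ((a, b) :: ps)) = [|| x == a, x == b | x \in members ps].
Proof. by rewrite members_cons /members inE !mem_cat inE; congr (_ || _); apply: orbCA. Qed.

Lemma mem_members1 a b x : (x \in members [:: (a, b)]) = (x == a) || (x == b).
Proof. by rewrite mem_members_cons orbF. Qed.

Lemma uniq_members_cons a b ps : uniq (members ((a, b) :: ps)) =
  [&& a != b, a \notin members ps, b \notin members ps & uniq (members ps)].
Proof.
have E : perm_eq (members ((a, b) :: ps)) (a :: b :: members ps).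
  by rewrite members_cons perm_cons perm_catC /= perm_cons perm_catC.
by rewrite (perm_uniq E) /= !inE negb_or -!andbA.
Qed.

Section Lists.
Variables (p : nat).
Hypothesis p_ge2 : 2 <= p.
Let k := p./2.

Lemma members_valid h l : l \in members (pairs p h) -> valid p l && ~~ in_W h l.
Proof.
have odd3 : odd p -> 3 <= p by move: p_ge2; case: (p) => [|[|[|]]].
case: h => [|[|[|h]]]; rewrite pairsE //.
- by rewrite mem_members1 => /orP[/eqP->|/eqP->] /=; lia.
- case: ifP => op.
    by case/mem_double_pairs=> i ? -> /=; lia.
  rewrite mem_members_cons => /or3P[/eqP->|/eqP->|/mem_double_pairs[i hi ->]] /=; lia.
case: ifP => op; last first.
  by case/mem_double_pairs=> i ? -> /=; lia.
have := odd3 op.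
rewrite mem_members_cons => ? /or3P[/eqP->|/eqP->|/mem_double_pairs[i hi ->]] /=; lia.
Qed.

Lemma members_uniq h : uniq (members (pairs p h)).
Proof.
have inlI : injective (fun i => lblA i) by move=> a b [].
have inrI : injective (fun i => lblB i) by move=> a b [].
have inlSI : injective (fun i => lblA i.+1) by move=> a b [].
have inrSI : injective (fun i => lblB i.+1) by move=> a b [].
case: h => [|[|[|h]]]; rewrite pairsE //.
- case: ifP => op; rewrite ?uniq_members_cons ?uniq_double_pairs // andbT /=.
  by apply/andP; split; apply/negP=> /mem_double_pairs[i hi E]; [discriminate | case: E; lia].
case: ifP => op; rewrite ?uniq_members_cons ?uniq_double_pairs // andbT /=.
by apply/andP; split; apply/negP=> /mem_double_pairs[i hi E]; case: E; lia.
Qed.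

Lemma size_pairs h : size (pairs p h) <= k.
Proof.
rewrite pairsE; case: h => [|[|[|h]]] //=; rewrite /k; first lia.
  by case: ifP; rewrite /= size_map size_iota; lia.
by case: ifP; rewrite /= size_map size_iota; lia.
Qed.

Definition labels : seq label := [seq lblA i | i <- iota 0 p] ++ [seq lblB i | i <- iota 0 p].

Lemma mem_labels l : (l \in labels) = valid p l.
Proof.
rewrite mem_cat; case: l => i /=.
  rewrite (mem_map (f := fun i => lblA i)); last by move=> a b [].
  by rewrite mem_iota add0n /= orbC; case: mapP => [[]|].
rewrite orbC (mem_map (f := fun i => lblB i)); last by move=> a b [].
by rewrite mem_iota add0n /= orbC; case: mapP => [[]|].
Qed.

Lemma uniq_labels : uniq labels.
Proof.
rewrite cat_uniq !map_inj_uniq ?iota_uniq //=; try by move=> a b [].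
by rewrite andbT; apply/hasPn=> _ /mapP[b _ ->]; apply/negP=> /mapP[].
Qed.

Definition special (j : nat) : nat := if j == 1 then 1 else 0.

Definition picked (h w : nat) : seq label :=
  [seq from_pair w jp.1 jp.2 | jp <- zip (iota 0 (size (pairs p h))) (pairs p h)].

Definition unpaired (h : nat) : seq label :=
  [seq l <- labels | ~~ in_W h l & l \notin members (pairs p h)].

Lemma selectedE h w : selected p k h w =
  picked h w ++ take (k - size (picked h w)) (unpaired h).
Proof. by []. Qed.

Lemma size_picked h w : size (picked h w) = size (pairs p h).
Proof. by rewrite size_map size_zip size_iota minnn. Qed.

Lemma mem_unpaired h l : (l \in unpaired h) =
  [&& valid p l, ~~ in_W h l & l \notin members (pairs p h)].
Proof. by rewrite mem_filter mem_labels andbC. Qed.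

Lemma nth_picked h w d j : j < size (pairs p h) ->
  nth d.1 (picked h w) j = from_pair w j (nth d (pairs p h) j).
Proof.
move=> jp; rewrite (nth_map (0, d)) ?size_zip ?size_iota ?minnn //.
by rewrite nth_zip ?size_iota //= nth_iota.
Qed.

Lemma unzip_uniq h d (b b' : bool) j j' :
  j < size (pairs p h) -> j' < size (pairs p h) ->
  (if b then (nth d (pairs p h) j).2 else (nth d (pairs p h) j).1) =
  (if b' then (nth d (pairs p h) j').2 else (nth d (pairs p h) j').1) ->
  b = b' /\ j = j'.
Proof.
set ps := pairs p h => jp j'p.
have s1 : size (unzip1 ps) = size ps by rewrite size_map.
have s2 : size (unzip2 ps) = size ps by rewrite size_map.
have pos (c : bool) i : i < size ps -> (if c then (nth d ps i).2 else (nth d ps i).1)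
    = nth d.1 (members ps) (if c then size ps + i else i).
  move=> ip; rewrite /members nth_cat s1; case: c.
    rewrite ltnNge leq_addr /= addKn (set_nth_default d.2) ?s2 //.
    by rewrite (nth_map d).
  by rewrite ip (nth_map d).
have posl (c : bool) i : i < size ps -> (if c then size ps + i else i) < size (members ps).
  by move=> ip; rewrite size_cat s1 s2; case: c; lia.
rewrite !pos // => /eqP; rewrite nth_uniq ?posl // ?members_uniq //.
by case: b; case: b' => /eqP; lia.
Qed.

Lemma selected_pair h w d (b : bool) j : j < size (pairs p h) ->
  ((if b then (nth d (pairs p h) j).2 else (nth d (pairs p h) j).1)
     \in selected p k h w) = ((w == special j) == b).
Proof.
move=> jp; rewrite selectedE mem_cat; set l := (if b then _ else _).
have lm : l \in members (pairs p h).
  rewrite /l /members mem_cat; case: (b); apply/orP; [right|left].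
    by apply: map_f; apply: mem_nth.
  by apply: map_f; apply: mem_nth.
have -> : (l \in take (k - size (picked h w)) (unpaired h)) = false.
  by apply/negP=> /mem_take; rewrite mem_unpaired lm !andbF.
have fpE i : from_pair w i (nth d (pairs p h) i) =
    if w == special i then (nth d (pairs p h) i).2 else (nth d (pairs p h) i).1.
  by [].
rewrite orbF; apply/(nthP d.1)/eqP.
  case=> i; rewrite size_picked => ip; rewrite nth_picked // fpE /l.
  by case/unzip_uniq=> // <- <-.
move=> E; exists j; first by rewrite size_picked.
by rewrite nth_picked // fpE E.
Qed.

Lemma mem_picked h w l : l \in picked h w -> l \in members (pairs p h).
Proof.
case/mapP=> -[j pr] /= jpr ->; have : pr \in pairs p h.
  by have := map_f snd jpr; rewrite -/(unzip2 _) unzip2_zip ?size_iota.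
rewrite /members mem_cat /from_pair => prp; case: (w == _); apply/orP; [right|left];
  exact: map_f.
Qed.

Lemma selected_other h w l : l \notin members (pairs p h) ->
  (l \in selected p k h w) = (l \in take (k - size (pairs p h)) (unpaired h)).
Proof.
move=> lm; rewrite selectedE mem_cat size_picked.
by rewrite (_ : l \in picked h w = false) //; apply: contraNF lm; apply: mem_picked.
Qed.

Lemma uniq_unpaired h : uniq (unpaired h).
Proof. exact/filter_uniq/uniq_labels. Qed.

Lemma selected_uniq h w : uniq (selected p k h w).
Proof.
rewrite selectedE cat_uniq take_uniq ?uniq_unpaired // andbT; apply/andP; split.
  set d := (lblA 0, lblA 0); apply/(uniqP d.1)=> i j.
  rewrite !inE !size_picked => ip jp; rewrite !nth_picked // /from_pair.
  by case/(@unzip_uniq h d (w == special i) (w == special j)).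
apply/hasPn=> l /mem_take; rewrite mem_unpaired => /and3P[_ _ lm].
by apply: contraNN lm; apply: mem_picked.
Qed.

Lemma selected_valid h w l : l \in selected p k h w -> valid p l && ~~ in_W h l.
Proof.
rewrite selectedE mem_cat => /orP[/mem_picked/members_valid //|/mem_take].
by rewrite mem_unpaired => /and3P[-> ->].
Qed.

Lemma count_W h : count (in_W h) labels = p.
Proof.
rewrite count_cat !count_map.
have count0 : count (fun i => i == 0) (iota 0 p) = 1.
  by rewrite (count_uniq_mem 0 (iota_uniq 0 p)) mem_iota; lia.
have countN0 : count (fun i => i != 0) (iota 0 p) = p.-1.
  have := count_predC (fun i => i == 0) (iota 0 p).
  by rewrite count0 size_iota => /(congr1 predn).
case: h => [|[|h]].
- transitivity (p.-1 + 1); last by rewrite addn1 prednK // ltnW.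
  by congr (_ + _); [apply: etrans countN0 | apply: etrans count0]; apply: eq_count.
- transitivity (1 + p.-1); last by rewrite add1n prednK // ltnW.
  by congr (_ + _); [apply: etrans count0 | apply: etrans countN0]; apply: eq_count.
rewrite (eq_count (a2 := predT)) // (eq_count (a1 := preim _ _) (a2 := pred0)) //.
by rewrite count_predT count_pred0 size_iota addn0.
Qed.

Lemma size_unpaired h : size (unpaired h) = p - (size (pairs p h)).*2.
Proof.
have E : perm_eq (unpaired h ++ members (pairs p h)) [seq l <- labels | ~~ in_W h l].
  apply: uniq_perm; rewrite ?filter_uniq ?uniq_labels //.
    rewrite cat_uniq uniq_unpaired members_uniq andbT /=.
    by apply/hasPn=> l lm; rewrite mem_unpaired lm !andbF.
  move=> l; rewrite mem_cat mem_unpaired mem_filter mem_labels.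
  case: (boolP (l \in members _)) => [/members_valid/andP[-> ->]|] //=.
  by rewrite andbT orbF andbC.
have s_labels : size labels = p + p by rewrite size_cat !size_map size_iota.
have := perm_size E; rewrite size_cat [RHS]size_filter [size (members _)]size_cat !size_map.
have := count_predC (in_W h) labels; rewrite count_W s_labels => /addnI.
by move=> cW cE; move: cE; rewrite [count _ _]cW; move=> e; rewrite -[X in _ = X - _]e -addnn addnK.
Qed.

Lemma size_selected h w : size (selected p k h w) = k.
Proof.
rewrite selectedE size_cat size_picked size_takel ?size_unpaired; have := size_pairs h; rewrite
  /k; lia.
Qed.

(** The height of the pair containing an auxiliary colour, the position of that
    pair in its list, and whether the colour is the second member. *)
Definition slot (l : label) : nat * nat * bool :=
  match l with
  | inl 0 => (0, 0, false)
  | inr 1 => (0, 0, true)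
  | inl i => if odd p then (1, i.-1./2, ~~ odd i) else (1, i./2, odd i)
  | inr 0 => (if odd p then 2 else 1, 0, false)
  | inr i => if odd p then (2, i.-1./2, ~~ odd i) else (2, i./2.-1, odd i)
  end.

Lemma nth_double_pairs f c n j d : j < n ->
  nth d (double_pairs f c n) j = (f (c + j).*2, f (c + j).*2.+1).
Proof. by move=> jn; rewrite (nth_map 0) ?size_iota // nth_iota. Qed.

Lemma slotP l d : valid p l -> let: (h, j, b) := slot l in
  j < size (pairs p h) /\
  (if b then (nth d (pairs p h) j).2 else (nth d (pairs p h) j).1) = l.
Proof.
have szd f c n : size (double_pairs f c n) = n by rewrite size_map size_iota.
case: l => [[|i]|[|[|i]]] vl //=; rewrite /valid in vl.
- case: (boolP (odd p)) => op; rewrite pairsE ?(negPf op) ?op /=.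
    rewrite szd nth_double_pairs; last by lia.
    split; first by lia.
    by case: (boolP (odd i)) => oi /=; congr (inl _); lia.
  case: i vl => [|i] vl //=; rewrite szd nth_double_pairs; last by lia.
  split; first by lia.
  by case: (boolP (odd i)) => oi /=; congr (inl _); lia.
- by case: (boolP (odd p)) => op; rewrite pairsE ?(negPf op) ?op.
case: (boolP (odd p)) => op; rewrite pairsE ?(negPf op) ?op /=.
  case: i vl => [|i] vl //=; rewrite szd nth_double_pairs; last by lia.
  split; first by lia.
  by case: (boolP (odd i)) => oi /=; congr (inr _); lia.
rewrite szd nth_double_pairs; last by lia.
split; first by lia.
by case: (boolP (odd i)) => oi /=; congr (inr _); lia.
Qed.

Lemma slot_notin l h : valid p l -> h != (slot l).1.1 -> l \notin members (pairs p h).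
Proof.
move=> vl hl; apply/negP; rewrite pairsE; move: hl.
case: h => [|[|[|h]]] //.
- by rewrite mem_members1 => hl /orP[/eqP E|/eqP E]; rewrite E in hl.
- case: ifP => op hl.
    by case/mem_double_pairs=> i _ E; rewrite E /= op in hl.
  rewrite mem_members_cons => /or3P[/eqP E|/eqP E|/mem_double_pairs[i ih E]];
    rewrite E /= ?op // in hl.
  by case: i ih hl {E} => // i; rewrite op.
case: ifP => op hl.
  rewrite mem_members_cons => /or3P[/eqP E|/eqP E|/mem_double_pairs[i ih E]];
    rewrite E /= ?op // in hl.
  by case: i ih hl {E} => // i; rewrite op.
case/mem_double_pairs=> i ih E; rewrite E /= in hl.
by case: i ih hl {E} => [|[|i]] //; rewrite op.
Qed.

Lemma slot_height l : (slot l).1.1 < 3.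
Proof. by case: l => [[|i]|[|[|i]]] //=; case: (odd p). Qed.

Lemma slot_not_W l : valid p l -> ~~ in_W (slot l).1.1 l.
Proof.
move=> vl; have := slotP (l, l) vl; case: (slot l) => [[h j] b] /= [jp E].
have : l \in members (pairs p h).
  rewrite -{1}E /members mem_cat; case: (b); apply/orP; [right|left];
  by apply: map_f; apply: mem_nth.
by case/members_valid/andP.
Qed.

(** A first member is selected for all w but one and a second member for
    exactly one w: this makes the number of its steps in direction y a unit. *)
Lemma selected_slot l w : valid p l ->
  (l \in selected p k (slot l).1.1 w) = ((w == special (slot l).1.2) == (slot l).2).
Proof.
move=> vl; have := slotP (l, l) vl; case: (slot l) => [[h j] b] /= [jp E].
by rewrite -{1}E selected_pair.
Qed.

Lemma selected_const l h w w' : valid p l -> h != (slot l).1.1 ->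
  (l \in selected p k h w) = (l \in selected p k h w').
Proof. by move=> vl hl; rewrite !selected_other ?slot_notin. Qed.

End Lists.

Local Open Scope ring_scope.

(** * Height, w and y as coordinates of the base torus *)

Section Coordinates.
Variable m : nat.
Hypothesis m_gt3 : (3 < m)%N.
Let m_gt1 : (1 < m)%N. Proof. by lia. Qed.

(** In the coordinates h, w, y the maps of the initial factorization are
    iterated skew products: h grows by one in each step, the motion of w
    depends on h, and that of y on h and w. *)
Definition vert (h w y : 'Z_m) : vertex m 3 :=
  \row_i (if i == e_x then h - y - w else if i == e_y then y else w).

Definition hgt (v : vertex m 3) : 'Z_m := xc v + yc v + wc v.

Lemma xc_vert h w y : xc (vert h w y) = h - y - w. Proof. by rewrite /xc mxE. Qed.
Lemma yc_vert h w y : yc (vert h w y) = y. Proof. by rewrite /yc mxE. Qed.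
Lemma wc_vert h w y : wc (vert h w y) = w. Proof. by rewrite /wc mxE. Qed.
Lemma hgt_vert h w y : hgt (vert h w y) = h.
Proof. by rewrite /hgt xc_vert yc_vert wc_vert; ring. Qed.
Lemma height_vert h w y : height (vert h w y) = val h.
Proof. by rewrite -[in RHS](hgt_vert h w y). Qed.

Lemma I3_ind (P : 'I_3 -> Prop) : P e_x -> P e_y -> P e_w -> forall i, P i.
Proof.
by move=> Px Py Pw [[|[|[|i]]] hi] //;
  [rewrite (_ : Ordinal hi = e_x) | rewrite (_ : Ordinal hi = e_y)
  | rewrite (_ : Ordinal hi = e_w)] => //; apply: val_inj.
Qed.

Lemma vertK v : vert (hgt v) (wc v) (yc v) = v.
Proof.
apply/rowP; apply: I3_ind; rewrite mxE //= /hgt /xc /yc /wc; ring.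
Qed.

Lemma vert_inj h w y h' w' y' : vert h w y = vert h' w' y' -> [/\ h = h', w = w' & y = y'].
Proof.
move=> E; split.
- by have := congr1 hgt E; rewrite !hgt_vert.
- by have := congr1 (@wc m) E; rewrite !wc_vert.
- by have := congr1 (@yc m) E; rewrite !yc_vert.
Qed.

Lemma vert_step h w y i : vert h w y + unit_vec m i =
  vert (h + 1) (w + (i == e_w)%:R) (y + (i == e_y)%:R).
Proof.
by apply/rowP; apply: I3_ind; elim/I3_ind: i; rewrite !mxE //=; ring.
Qed.

Lemma val_addZ1 (w : 'Z_m) : nat_of_ord (w + 1) = (w.+1 %% m)%N.
Proof. by rewrite -{1}[w]natr_Zp natr1 val_Zp_nat. Qed.

Lemma sum_eqZ (c : nat) : (c < m)%N -> \sum_(h : 'Z_m) ((val h == c)%:R : 'Z_m) = 1.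
Proof.
move=> cm; rewrite (bigD1 (c%:R : 'Z_m)) //= val_Zp_nat // modn_small // eqxx big1 ?addr0 //.
move=> h NE; case: eqP => // E; case/eqP: NE; apply: val_inj.
by rewrite /= val_Zp_nat // modn_small.
Qed.

Lemma sum_const_Zm (c : 'Z_m) : \sum_(h : 'Z_m) c = 0.
Proof. by rewrite sumr_const card_Zm // -mulr_natr natr_m0 ?mulr0. Qed.

Lemma sum_neqZ (c : nat) : (c < m)%N -> \sum_(h : 'Z_m) ((val h != c)%:R : 'Z_m) = -1.
Proof.
move=> cm; apply/eqP; rewrite -subr_eq0 opprK -[X in _ + X](sum_eqZ cm) -big_split /=.
rewrite (eq_bigr (fun=> 1)) ?sum_const_Zm // => h _.
by case: (_ == c); rewrite /= ?mulr0n ?mulr1n ?addr0 ?add0r.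
Qed.

Lemma connect_succ (h h' : 'Z_m) : fconnect (fun h : 'Z_m => h + 1) h h'.
Proof.
have it n (x : 'Z_m) : iter n (fun h : 'Z_m => h + 1) x = x + n%:R.
  elim: n => [|n IHn]; rewrite ?addr0 //= IHn -addrA -natr1; ring.
have -> : h' = iter (val (h' - h)) (fun h : 'Z_m => h + 1) h.
  by rewrite it natr_Zp; ring.
exact: fconnect_iter.
Qed.

Lemma succ_inj : injective (fun h : 'Z_m => h + 1).
Proof. exact: addIr. Qed.

End Coordinates.

Section Base.
Variables (m p : nat).
Hypotheses (m_gt3 : (3 < m)%N) (m_even : ~~ odd m) (p_ge2 : (2 <= p)%N).
Let k := p./2.
Let m_gt1 : (1 < m)%N. Proof. by lia. Qed.

Definition label_of (l : 'I_p + 'I_p) : label :=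
  match l with inl i => inl (val i) | inr i => inr (val i) end.

Lemma label_valid l : valid p (label_of l).
Proof. by case: l => i /=. Qed.

Lemma label_of_surj x : valid p x -> exists l, label_of l = x.
Proof. by case: x => i hi; [exists (inl (Ordinal hi)) | exists (inr (Ordinal hi))]. Qed.

Definition fdir (h w : nat) : 'I_3 -> 'I_3 :=
  if h == 0%N then row3 e_w e_y e_x
  else if h == 1%N then
    if (w == 0%N) || (w == 1%N) then row3 e_x e_w e_y else row3 e_y e_w e_x
  else if (h == 2%N) && (w == 0%N) then row3 e_y e_x e_w
  else row3 e_x e_y e_w.

Definition adir (l : label) (h w : nat) : 'I_3 :=
  if in_W h l then e_w else if l \in selected p k h w then e_y else e_x.

(** The directions depend on the vertex through h and w only. *)
Definition cdir (c : colour p) (h w : nat) : 'I_3 :=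
  match c with inl f => fdir h w f | inr l => adir (label_of l) h w end.

Lemma init_dirE c (v : vertex m 3) : init_dir k c v = cdir c (height v) (val (wc v)).
Proof. by case: c => [f|[i|i]]. Qed.

Definition wdir (c : colour p) (h : nat) : bool :=
  match c with
  | inl f => if val f == 0%N then h == 0%N else if val f == 1%N then h == 1%N else (1 < h)%N
  | inr l => in_W h (label_of l)
  end.

Lemma cdir_w c h w : (cdir c h w == e_w) = wdir c h.
Proof.
case: c => [f|l] /=; last by rewrite /adir; case: ifP => // _; case: ifP.
by rewrite /fdir; case: f => [[|[|[|f]]] hf] //; case: h => [|[|[|h]]] //=; case: ifP.
Qed.

Definition omega (c : colour p) (h : 'Z_m) : 'Z_m := (wdir c (val h))%:R.
Definition eta (c : colour p) (hw : 'Z_m * 'Z_m) : 'Z_m :=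
  (cdir c (val hw.1) (val hw.2) == e_y)%:R.
Definition hw_map (c : colour p) := skew (fun h : 'Z_m => h + 1) (omega c).
Definition vert3 (z : 'Z_m * 'Z_m * 'Z_m) : vertex m 3 := vert z.1.1 z.1.2 z.2.

Lemma init_map_skew c z :
  init_map k c (vert3 z) = vert3 (skew (hw_map c) (eta c) z).
Proof.
case: z => [[h w] y]; rewrite /init_map /vert3 /= vert_step init_dirE height_vert wc_vert.
by rewrite cdir_w.
Qed.

Lemma vert3_bij : bijective vert3.
Proof.
exists (fun v => ((hgt v, wc v), yc v)) => [[[h w] y]|v]; rewrite /vert3 /=.
  by rewrite hgt_vert wc_vert yc_vert.
exact: vertK.
Qed.

Lemma hw_map_inj c : injective (hw_map c).
Proof. exact: skew_inj (@succ_inj m). Qed.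

Lemma init_map_inj c : injective (@init_map m p k c).
Proof.
move=> v v'; have [g gK vK] := vert3_bij.
rewrite -[v]vK -[v']vK !init_map_skew => /(bij_inj vert3_bij).
by move/(skew_inj (@hw_map_inj c)) ->.
Qed.

Definition hw_class (hw : 'Z_m * 'Z_m) : bool := odd (val hw.2) (+) odd (val hw.1 - 2).

Lemma parity_class_vert h w y : parity_class (vert h w y) = hw_class (h, w).
Proof. by rewrite /parity_class wc_vert height_vert. Qed.

Lemma odd_succ (w : 'Z_m) : odd (nat_of_ord (w + 1)) = ~~ odd w.
Proof. by rewrite val_addZ1 // odd_mod //; apply: negbTE. Qed.

Lemma hw_class_step (f : 'I_3) hw : val f = 2%N -> hw_class (hw_map (inl f) hw) = hw_class hw.
Proof.
case: hw => h w f2.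
have -> : hw_map (inl f) (h, w) = (h + 1, w + (1 < h)%N%:R).
  by rewrite /hw_map /skew /omega /wdir f2.
rewrite -[hw_class _]/(odd (nat_of_ord (w + (1 < h)%N%:R)) (+) odd (nat_of_ord (h + 1) - 2)).
rewrite -[hw_class _]/(odd w (+) odd (h - 2)) val_addZ1 //.
have hm : (h < m)%N := ltn_Zm h m_gt1; move: (nat_of_ord h) hm => {}h hm.
have [h1|h1] := leqP h 1.
  rewrite addr0 modn_small; last by lia.
  by case: h h1 {hm} => [|[|h]].
rewrite odd_succ; move: (odd w) => e; have [hm1|hm1] := eqVneq h.+1 m.
  have -> : odd (h - 2) = true by lia.
  by rewrite hm1 modnn; case: e.
rewrite modn_small; last by lia.
have -> : odd (h.+1 - 2) = ~~ odd (h - 2) by lia.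
by case: e; case: (odd _).
Qed.

(** Every colour except F_2 uses the direction w at a single height or at all
    heights but one. *)
Lemma sum_omega c : (forall f, c = inl f -> (val f < 2)%N) ->
  \sum_h omega c h \is a GRing.unit.
Proof.
have U1 : (1 : 'Z_m) \is a GRing.unit by exact: unitr1.
have UN : (-1 : 'Z_m) \is a GRing.unit by rewrite unitrN1.
have inWl i h : in_W h (inl i) = (h != (if i == 0 then 0 else 1))%N.
  by case: h => [|[|h]]; case: i => [|i].
have inWr i h : in_W h (inr i) = (h == (if i == 0 then 0 else 1))%N.
  by case: h => [|[|h]]; case: i => [|i].
case: c => [f|[i|i]] cf; rewrite /omega /wdir.
- have := cf f erefl; case: f {cf} => [[|[|f]] hf] //= _.
    by rewrite sum_eqZ //; lia.
  by rewrite sum_eqZ //; lia.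
- rewrite (eq_bigr (fun h : 'Z_m => (val h != (if val i == 0 then 0 else 1))%N%:R)).
    by rewrite sum_neqZ //; case: ifP; lia.
  by move=> h _; rewrite -(inWl (val i)).
rewrite (eq_bigr (fun h : 'Z_m => (val h == (if val i == 0 then 0 else 1))%N%:R)).
  by rewrite sum_eqZ //; case: ifP; lia.
by move=> h _; rewrite -(inWr (val i)).
Qed.

Lemma hw_connect c hw hw' : (forall f, c = inl f -> (val f < 2)%N) ->
  fconnect (hw_map c) hw hw'.
Proof.
move=> cf; case: hw hw' => h w [h' w']; apply: skew_fconnect.
- exact: succ_inj.
- rewrite (eq_bigl xpredT); first exact: sum_omega.
  by move=> z; rewrite connect_succ.
exact: connect_succ.
Qed.

(** One round through all heights adds m - 2 to w, so F_2 reaches all w of the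
    same parity. *)
Lemma hw_connect2 (f : 'I_3) hw hw' : val f = 2%N -> hw_class hw = hw_class hw' ->
  fconnect (hw_map (inl f)) hw hw'.
Proof.
move=> f2 E; set F := hw_map _.
have sym := fconnect_sym (@hw_map_inj (inl f)).
have it1 n (x : 'Z_m) : iter n (fun h : 'Z_m => h + 1) x = x + n%:R.
  elim: n => [|n IHn]; rewrite ?addr0 //= IHn -addrA -natr1; ring.
have pF n z : hw_class (iter n F z) = hw_class z.
  by elim: n => //= n IHn; rewrite hw_class_step.
have to0 z : exists w, fconnect F z (0, w) /\ hw_class (0, w) = hw_class z.
  case: z => h w; have E1 := iter_skew (fun h : 'Z_m => h + 1) (omega (inl f)) (val (- h)) h w.
  rewrite it1 natr_Zp subrr in E1; move: E1; set w0 := w + _ => E1.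
  by exists w0; rewrite -E1 -/F pF fconnect_iter.
(* The heights 0 and 1 are the two at which w is not raised. *)
have round w : iter m F (0, w) = (0, w - 2%:R).
  rewrite iter_skew it1 add0r natr_m0 //; congr (_, _ + _).
  rewrite (eq_bigr (fun i : 'I_m => (1 < i)%N%:R)); last first.
    move=> i _; rewrite it1 add0r /omega /wdir f2 /= val_Zp_nat // modn_small //.
  rewrite -(big_mkord xpredT (fun i => ((1 < i)%N%:R : 'Z_m))).
  have h2 : (2 <= m)%N by lia.
  rewrite (big_cat_nat (leq0n 2) h2) /=.
  rewrite big_nat [X in _ + X]big_nat big1 ?add0r; last first.
    by move=> i /andP[_ i2]; rewrite ltnNge -ltnS i2.
  rewrite (eq_bigr (fun=> 1)); last by move=> i /andP[-> _].
  rewrite -big_nat sumr_const_nat -[RHS]add0r -(natr_m0 m_gt1) -natrB //; lia.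
have rounds n w : fconnect F (0, w) (0, w - (n.*2)%:R).
  elim: n w => [|n IHn] w; first by rewrite subr0.
  apply: connect_trans (IHn w) _.
  have -> : (0, w - n.+1.*2%:R) = iter m F (0, w - n.*2%:R).
    by rewrite round doubleS -!natr1; congr (_, _); ring.
  exact: fconnect_iter.
have [w [zw Ew]] := to0 hw; have [w' [zw' Ew']] := to0 hw'.
apply: connect_trans zw _; rewrite sym; apply: connect_trans zw' _; rewrite sym.
have : odd (nat_of_ord w) = odd (nat_of_ord w').
  by move: Ew Ew'; rewrite -E /hw_class /= !addbF => -> ->.
have wm : (w < m)%N := ltn_Zm w m_gt1; have wm' : (w' < m)%N := ltn_Zm w' m_gt1.
suff main (a b : nat) : (a < m)%N -> (b < m)%N -> odd a = odd b ->
    exists n : nat, b%:R = a%:R - n.*2%:R :> 'Z_m.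
  move=> oww; have [n En] := main _ _ wm wm' oww.
  by have := rounds n w; rewrite -{2}[w]natr_Zp -En natr_Zp.
move=> am bm oab; exists (a + m - b)./2.
have -> : ((a + m - b)./2).*2 = (a + m - b)%N by lia.
by rewrite natrB ?natrD ?natr_m0 //; [ring | lia].
Qed.

End Base.

(** * Cycles of the initial factorization *)

Section BaseCycles.
Variables (m p : nat).
Hypotheses (m_gt3 : (3 < m)%N) (m_even : ~~ odd m) (p_ge2 : (2 <= p)%N).
Let k := p./2.
Let m_gt1 : (1 < m)%N. Proof. by lia. Qed.

Lemma sum_pairZ (F : 'Z_m * 'Z_m -> 'Z_m) : \sum_hw F hw = \sum_h \sum_w F (h, w).
Proof. by rewrite pair_bigA; apply: eq_bigr => -[h w]. Qed.

Lemma etaE (c : colour p) (h w : 'Z_m) :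
  eta c (h, w) = (cdir c (val h) (val w) == e_y)%:R.
Proof. by []. Qed.

Lemma hw_classE (h w : 'Z_m) : hw_class (h, w) = odd (val w) (+) odd (val h - 2).
Proof. by []. Qed.

(** At the height of its pair, an auxiliary colour uses the direction y for one
    w or for all w but one. At any other height the use of y does not depend on
    w, so the m values of w contribute 0. *)
Lemma sum_eta_aux l : \sum_hw eta (m := m) (inr l : colour p) hw \is a GRing.unit.
Proof.
have vl := label_valid l.
pose h0 := (slot p (label_of l)).1.1.
have h0m : (h0 < m)%N by have := slot_height p (label_of l); rewrite -/h0; lia.
have h0Z : val (h0%:R : 'Z_m) = h0 by exact: val_Zm.
rewrite sum_pairZ (bigD1 (h0%:R : 'Z_m)) //= [X in _ + X]big1 ?addr0 => [|h hh0].
  rewrite (eq_bigr (fun w : 'Z_m => ((val w == special (slot p (label_of l)).1.2)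
                                      == (slot p (label_of l)).2)%:R)).
    have sm : (special (slot p (label_of l)).1.2 < m)%N.
      by rewrite /special; case: ifP; lia.
    case: (slot p _).2.
      by rewrite (eq_bigr _ (fun w _ => congr1 (fun b : bool => b%:R) (eqb_id _))) sum_eqZ ?unitr1.
    by rewrite (eq_bigr _ (fun w _ => congr1 (fun b : bool => b%:R) (eqbF_neg _))) sum_neqZ
      ?unitrN1.
  move=> w _; rewrite etaE /cdir /adir h0Z.
  by rewrite (negPf (slot_not_W _ vl)) // selected_slot //; case: ((val w == _) == _).
have hne : val h != h0.
  by apply: contraNN hh0 => /eqP E; rewrite -(natr_Zp h) E.
rewrite (eq_bigr (fun=> eta (inr l : colour p) (h, 0))) ?sum_const_Zm // => w _.
rewrite !etaE /cdir /adir.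
by case: ifP => // _; rewrite (selected_const (val w) (val (0 : 'Z_m)) vl hne).
Qed.

Lemma sum_eta_F (f : 'I_3) : (val f < 2)%N ->
  \sum_hw eta (m := m) (inl f : colour p) hw \is a GRing.unit.
Proof.
have e0 : \sum_(w : 'Z_m) ((val w == 0%N)%:R : 'Z_m) = 1 by rewrite sum_eqZ //; lia.
have e1 : \sum_(w : 'Z_m) ((val w == 1%N)%:R : 'Z_m) = 1 by rewrite sum_eqZ.
have e2 : \sum_(w : 'Z_m) ((val w == 2%N)%:R : 'Z_m) = 1 by rewrite sum_eqZ //; lia.
move=> f2; rewrite (_ : \sum_hw _ = -1) ?unitrN1 // sum_pairZ.
case: f f2 => [[|[|//]] hf] _.
  rewrite (eq_bigr (fun h : 'Z_m => (val h == 2%N)%:R - (val h == 1%N)%:R *+ 2)).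
    by rewrite big_split /= e2 sumrN sumrMnl e1; ring.
  move=> h _; rewrite (eq_bigr (fun w : 'Z_m =>
    (val h == 1%N)%:R * (1 - (val w == 0%N)%:R - (val w == 1%N)%:R)
    + (val h == 2%N)%:R * (val w == 0%N)%:R)).
    rewrite big_split /= -!big_distrr /= !big_split /= !sumrN e0 e1 sum_const_Zm //.
    by ring.
  move=> w _; rewrite etaE /cdir /fdir.
  case: (val h) => [|[|[|n]]]; case: (val w) => [|[|n']]; rewrite //= ?mul0r ?mul1r; ring.
rewrite (eq_bigr (fun h : 'Z_m => - (val h == 2%N)%:R)); first by rewrite sumrN e2.
move=> h _; rewrite (eq_bigr (fun w : 'Z_m =>
  (val h != 1%N)%:R * 1 - (val h == 2%N)%:R * (val w == 0%N)%:R)).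
  rewrite big_split /= sumrN -!big_distrr /= e0 sum_const_Zm //; ring.
move=> w _; rewrite etaE /cdir /fdir.
case: (val h) => [|[|[|n]]]; case: (val w) => [|[|n']]; rewrite //= ?mul0r ?mul1r; ring.
Qed.

Lemma sum_eta_F2 (f : 'I_3) (e : bool) : val f = 2%N ->
  \sum_(hw | hw_class hw == e) eta (m := m) (inl f : colour p) hw = 1.
Proof.
move=> f2; have em : (e < m)%N by case: e; lia.
have v1 : val (1%:R : 'Z_m) = 1%N by exact: val_Zm.
have ve : val (e%:R : 'Z_m) = e by exact: val_Zm.
have eta2E (h w : 'Z_m) : eta (inl f : colour p) (h, w) = ((val h == 1%N) && (val w < 2)%N)%:R.
  rewrite etaE /cdir /fdir.
  have -> : f = 2%:R by apply: val_inj; rewrite f2.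
  by case: (val h) => [|[|[|n]]] //=; case: (val w) => [|[|n']].
rewrite (bigD1 ((1%:R, e%:R) : 'Z_m * 'Z_m)) /=; last first.
  by rewrite hw_classE v1 ve; case: (e).
rewrite eta2E v1 ve big1 ?addr0 => [|[h w] /andP[/eqP pe ne]]; first by case: (e).
rewrite eta2E; case: (boolP (_ && _)) => // /andP[/eqP h1 w2]; case/eqP: ne.
have hE : h = 1%:R by rewrite -(natr_Zp h) h1.
move: pe; rewrite hw_classE h1 /= addbF => we.
congr (_, _); first exact: hE.
have : (nat_of_ord w < 2)%N := w2.
by rewrite -{2}(natr_Zp w) -we; case: (nat_of_ord w) => [|[|]].
Qed.

Lemma parity_inv (c : colour p) (v : vertex m 3) :
  node c (parity_class (init_map k c v)) = node c (parity_class v).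
Proof.
case: c => [f|l] //; have [g gK vK] := @vert3_bij m; rewrite -[v]vK init_map_skew.
case: (g v) => [[h w] y]; rewrite /vert3 !parity_class_vert -!surjective_pairing.
have [f2|f2] := eqVneq (val f) 2%N; first by rewrite hw_class_step.
by rewrite /node /F_node (negPf f2).
Qed.

(** The criterion for skew products is applied twice: to w over the height and
    to y over (h, w). *)
Lemma init_cycle (c : colour p) (v v' : vertex m 3) :
  node c (parity_class v) = node c (parity_class v') ->
  fconnect (init_map k c) v v'.
Proof.
have [g gK vK] := @vert3_bij m; rewrite -[v]vK -[v']vK => E.
apply: (fconnect_semiconj (f := skew (hw_map c) (eta c))).
  by move=> z; rewrite init_map_skew.
move: E; case: (g v) => [[h w] y]; case: (g v') => [[h' w'] y'].
rewrite /vert3 !parity_class_vert /= => E.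
have [/existsP[f /andP[/eqP cf /eqP f2]]|Nf] :=
    boolP [exists f : 'I_3, (c == inl f) && (val f == 2%N)].
  have {}E : hw_class (h, w) = hw_class (h', w').
    by move: E; rewrite cf /node /F_node f2 eqxx => -[]; case: (hw_class (h, w)); case:
      (hw_class (h', w')) => // /(congr1 val); rewrite /= !inordK.
  rewrite cf; apply: skew_fconnect.
  - exact: hw_map_inj.
  - rewrite (eq_bigl (fun z => hw_class z == hw_class (h, w))); first by rewrite sum_eta_F2 ?unitr1.
    move=> z; apply/idP/eqP=> [/iter_findex <-|e]; last by apply: hw_connect2.
    by elim: (findex _ _ _) => //= n IHn; rewrite hw_class_step.
  exact: hw_connect2.
have cf f : c = inl f -> (val f < 2)%N.
  move=> E'; move/existsPn/(_ f): Nf; rewrite E' eqxx /=.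
  by have := ltn_ord f; rewrite /=; lia.
apply: skew_fconnect.
- exact: hw_map_inj.
- rewrite (eq_bigl xpredT) => [|z]; last by rewrite hw_connect.
  case: (c) cf => [f|l] cf; last exact: sum_eta_aux.
  by apply: sum_eta_F; apply: cf.
exact: hw_connect.
Qed.

Lemma sum_count (Q : pred nat) n : (\sum_(i < n) Q i)%N = count Q (iota 0 n).
Proof.
rewrite -(big_mkord xpredT (fun i => nat_of_bool (Q i))) /index_iota subn0 -sum1_count.
by rewrite [RHS]big_mkcond; apply: eq_bigr => i _; case: (Q i).
Qed.

Lemma count_labels (P : pred label) :
  (\sum_(l : 'I_p + 'I_p) P (label_of l))%N = count P (labels p).
Proof.
rewrite big_sumType /= count_cat !count_map.
rewrite (sum_count (fun i => P (lblA i))) (sum_count (fun i => P (lblB i))).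
by [].
Qed.

Lemma card_fdir h w i : #|[set f | fdir h w f == i]| = 1%N.
Proof.
have fI : injective (fdir h w).
  by rewrite /fdir; do !case: ifP => _; apply: row3_inj.
apply: etrans (cards1 (invF fI i)); apply: eq_card => f; rewrite !inE.
by rewrite -(inj_eq fI f) f_invF.
Qed.

Lemma card_cdir h w i : #|[set c : colour p | cdir c h w == i]| = init_mult p k i.
Proof.
rewrite -sum1dep_card big_mkcond big_sumType /= -big_mkcond sum1dep_card card_fdir.
rewrite (eq_bigr (fun l => nat_of_bool (adir p (label_of l) h w == i))); last first.
  by move=> l _; case: (_ == i).
rewrite (count_labels (fun l => adir p l h w == i)).
have cW : count (in_W h) (labels p) = p by exact: count_W.
have cS : count (mem (selected p k h w)) (labels p) = k.
  rewrite -size_filter -[RHS](size_selected p_ge2 h w); apply: perm_size.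
  apply: uniq_perm; rewrite ?filter_uniq ?uniq_labels ?selected_uniq // => l.
  rewrite mem_filter mem_labels; apply: andb_idr => /selected_valid.
  by case/(_ p_ge2)/andP.
have SW l : l \in selected p k h w -> in_W h l = false.
  by move/(selected_valid p_ge2)/andP=> [_ /negbTE].
have c_w : count (fun l => adir p l h w == e_w) (labels p) = p.
  rewrite -[RHS]cW; apply: eq_count => l; rewrite /adir.
  by case: ifP => // _; case: ifP.
have c_y : count (fun l => adir p l h w == e_y) (labels p) = k.
  rewrite -[RHS]cS; apply: eq_count => l; rewrite /adir /=.
  have [/SW -> //|_] := boolP (l \in selected p k h w).
  by case: ifP.
elim/I3_ind: i; rewrite /init_mult /=; last 2 first.
- by rewrite c_y addnC.
- by rewrite c_w addnC.
have cN : count (fun l => (adir p l h w == e_x) || ((adir p l h w == e_y) || (adir p l h w == e_w)))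
    (labels p) = (p + p)%N.
  rewrite (eq_count (a2 := predT)) => [|l]; last by rewrite /adir; do 2?case: ifP.
  by rewrite count_predT size_cat !size_map size_iota.
have disj (a b : pred label) : (forall l, ~~ (a l && b l)) ->
    count (fun l => a l || b l) (labels p) = (count a (labels p) + count b (labels p))%N.
  move=> ab; rewrite -count_predUI (eq_count (a1 := predI a b) (a2 := pred0)) ?count_pred0
    ?addn0 //.
  by move=> l; apply/negbTE/ab.
move: cN; rewrite (disj (fun l => adir p l h w == e_x)) ?disj ?c_y ?c_w; last 2 first.
- by move=> l; rewrite /adir; do 2?case: ifP.
- by move=> l; rewrite /adir; do 2?case: ifP.
rewrite /k; lia.
Qed.

End BaseCycles.

(** * Nodes meeting in the directions x and y *)

Section BaseShare.
Variables (m p : nat).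
Hypotheses (m_gt3 : (3 < m)%N) (m_even : ~~ odd m) (p_ge2 : (2 <= p)%N).
Let k := p./2.
Let m_gt1 : (1 < m)%N. Proof. by lia. Qed.

Definition base_profile (i : 'I_3) (v : vertex m 3) : {set node_type p} :=
  profile (fun v => v) (@init_dir m p k) i v.

Lemma base_profileP i v nu : nu \in base_profile i v ->
  exists2 c, nu = node c (parity_class v) & cdir c (height v) (val (wc v)) = i.
Proof. by case/profileP=> c -> E; exists c => //; rewrite -(init_dirE c v). Qed.

Lemma mem_base_profile c i v :
  (node c (parity_class v) \in base_profile i v) = (cdir c (height v) (val (wc v)) == i).
Proof. by rewrite /base_profile mem_profile init_dirE. Qed.

Lemma card_base_profile i v : #|base_profile i v| = init_mult p k i.
Proof.
rewrite card_profile -(card_cdir m_gt3 m_even p_ge2 (height v) (val (wc v)) i).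
by apply: eq_card => c; rewrite !inE init_dirE.
Qed.

Definition meet_at (i : 'I_3) : rel (node_type p) :=
  fun nu nu' => [exists x, (nu \in base_profile i x) && (nu' \in base_profile i x)].

Definition class_at (h w : nat) : bool := odd w (+) odd (h - 2).

Lemma meet_hw i c c' h w : (h < m)%N -> (w < m)%N ->
  cdir c h w = i -> cdir c' h w = i ->
  meet_at i (node c (class_at h w)) (node c' (class_at h w)).
Proof.
move=> hm wm ci c'i; pose v : vertex m 3 := vert h%:R w%:R 0.
have hv : height v = h by rewrite height_vert val_Zm.
have wv : val (wc v) = w by rewrite wc_vert val_Zm.
have E : class_at h w = parity_class v by rewrite /parity_class hv wv.
by apply/existsP; exists v; rewrite E !mem_base_profile hv wv ci c'i eqxx.
Qed.

Lemma meet_atC i : connect_sym (meet_at i).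
Proof.
by apply: sym_connect_sym => nu nu'; apply: eq_existsb => x; rewrite andbC.
Qed.

Definition nF (j : nat) : node_type p := inr (inord j).

Lemma is_F_cases nu : is_F nu ->
  [\/ nu = nF 0, nu = nF 1, nu = nF 2 | nu = nF 3].
Proof.
case: nu => // -[[|[|[|[|j]]]] hj] // _; [apply: Or41|apply: Or42|apply: Or43|apply: Or44];
  by congr inr; apply: val_inj; rewrite /= inordK.
Qed.

Lemma fdir_surj h w i : exists f : 'I_3, fdir h w f = i.
Proof.
have : (0 < #|[set f | fdir h w f == i]|)%N by rewrite card_fdir.
by case/card_gt0P=> f; rewrite inE => /eqP; exists f.
Qed.

(** At each vertex some distinguished colour uses the direction i, so it
    suffices to link the distinguished nodes. *)
Lemma connect_hub i :
  (forall j, (j < 4)%N -> connect (meet_at i) (nF j) (nF 0)) ->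
  (forall l : 'I_p + 'I_p, exists h w, [/\ (h < m)%N, (w < m)%N & adir p (label_of l) h w = i]) ->
  forall nu nu', connect (meet_at i) nu nu'.
Proof.
move=> FF aux.
have F0 nu : is_F nu -> connect (meet_at i) nu (nF 0).
  by case/is_F_cases=> ->; apply: FF.
suff hub nu : connect (meet_at i) nu (nF 0).
  by move=> nu nu'; apply: connect_trans (hub nu) _; rewrite meet_atC hub.
case: nu => [l|j]; last exact: F0.
have [h [w [hm wm lE]]] := aux l; have [f fE] := fdir_surj h w i.
apply: connect_trans (F0 (node (inl f) (class_at h w)) isT).
exact/connect1/(@meet_hw i (inr l) (inl f) h w).
Qed.

(** An auxiliary colour that uses the direction i at two vertices links the
    distinguished colours that use i there. *)
Lemma connect_two i l h w h' w' f f' : valid p l ->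
  (h < m)%N -> (w < m)%N -> (h' < m)%N -> (w' < m)%N ->
  adir p l h w = i -> adir p l h' w' = i -> fdir h w f = i -> fdir h' w' f' = i ->
  connect (meet_at i) (node (inl f) (class_at h w)) (node (inl f') (class_at h' w')).
Proof.
case/label_of_surj=> l' <- hm wm hm' wm' lE lE' fE fE'.
apply: (@connect_trans _ _ (node (inr l') (class_at h w))).
  exact/connect1/(@meet_hw i (inl f) (inr l') h w).
exact/connect1/(@meet_hw i (inr l') (inl f') h' w').
Qed.

Lemma adir_slot l w : valid p l -> adir p l (slot p l).1.1 w =
  if (w == special (slot p l).1.2) == (slot p l).2 then e_y else e_x.
Proof. by move=> vl; rewrite /adir (negPf (slot_not_W _ vl)) ?selected_slot. Qed.

Lemma aux_use i (l : 'I_p + 'I_p) : i != e_w -> exists h w, [/\ (h < m)%N, (w < m)%N & adir p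
  (label_of l) h w = i].
Proof.
have vl := label_valid l; move=> iw.
have hm : ((slot p (label_of l)).1.1 < m)%N.
  by have := slot_height p (label_of l); lia.
set sp := special (slot p (label_of l)).1.2.
have sp2 : (sp < 2)%N by rewrite /sp /special; case: ifP.
have [w wm E] : exists2 w, (w < m)%N & ((w == sp) == (slot p (label_of l)).2) = (i == e_y).
  case: (slot p _).2; case: (i == e_y).
  - by exists sp; [lia|rewrite eqxx].
  - by exists 2%N; [lia|rewrite gtn_eqF].
  - by exists 2%N; [lia|rewrite gtn_eqF].
  by exists sp; [lia|rewrite eqxx].
exists (slot p (label_of l)).1.1, w; split=> //.
by rewrite adir_slot // E; elim/I3_ind: i iw {E} => //.
Qed.

(** The selection at height 2 is completed from this list, by at most one
    label. *)
Lemma unpaired2 : exists s, unpaired p 2 = (if odd p then lblB 1 else lblB 0) :: s.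
Proof.
have N l : valid p l -> (slot p l).1.1 != 2%N -> l \notin members (pairs p 2).
  by move=> vl ne; apply: slot_notin => //; rewrite eq_sym.
have N1 : lblB 1 \notin members (pairs p 2) by apply: N => //=; lia.
have N0 : (lblB 0 \notin members (pairs p 2)) = ~~ odd p.
  case: (boolP (odd p)) => op; first by rewrite pairsE op mem_members_cons eqxx.
  by apply: N => //=; rewrite ?(negPf op) //; lia.
pose Q l := ~~ in_W 2 l && (l \notin members (pairs p 2)).
have Q1 : Q (lblB 1) by rewrite /Q N1.
have Q0 : Q (lblB 0) = ~~ odd p by rewrite /Q N0.
rewrite -[unpaired p 2]/(filter Q _) filter_cat.
rewrite (_ : [seq l <- [seq lblA i | i <- iota 0 p] | Q l] = [::]); last first.
  by rewrite filter_map (eq_filter (a2 := pred0)) ?filter_pred0.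
rewrite (_ : iota 0 p = [:: 0, 1 & iota 2 (p - 2)]%N); last by rewrite -{1}(subnKC p_ge2).
move: (Q) Q0 Q1 => {}Q Q0 Q1; rewrite /= Q0 Q1.
by case: (odd p) => /=; eexists.
Qed.

Lemma size_pairs2 : size (pairs p 2) = if odd p then k else k.-1.
Proof.
rewrite pairsE; case: ifP => op; rewrite /= size_map size_iota //.
by rewrite prednK // /k; lia.
Qed.

Lemma B1_not_selected2 w : lblB 1 \notin selected p k 2 w.
Proof.
rewrite (@selected_other p 2 w); last by apply: slot_notin => //=; lia.
have [s ->] := unpaired2; rewrite size_pairs2; case: ifP => op; first by rewrite subnn take0.
have -> : (k - k.-1 = 1)%N by rewrite /k; lia.
by rewrite /= take0 inE.
Qed.

Lemma B0_selected2 w : ~~ odd p -> lblB 0 \in selected p k 2 w.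
Proof.
move=> op; rewrite (@selected_other p 2 w); last first.
  by apply: slot_notin => /=; rewrite ?(negPf op) //; lia.
have [s ->] := unpaired2; rewrite size_pairs2 (negPf op).
have -> : (k - k.-1 = 1)%N by rewrite /k; lia.
by rewrite /= take0 inE.
Qed.

Lemma connect_x nu nu' : connect (meet_at e_x) nu nu'.
Proof.
have vB1 : valid p (lblB 1) by [].
have B1 w : w != 0%N -> adir p (lblB 1) 0 w = e_x.
  by move=> w0; rewrite (@adir_slot (lblB 1)) //=; case: eqP w0.
have B12 w : adir p (lblB 1) 2 w = e_x by rewrite /adir /= (negPf (B1_not_selected2 w)).
have c23 : connect (meet_at e_x) (nF 3) (nF 2).
  by apply: (@connect_two e_x (lblB 1) 0 1 0 2 e_w e_w) => //; try lia; apply: B1.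
have c20 : connect (meet_at e_x) (nF 2) (nF 0).
  pose l := if odd p then lblA 2 else lblA 1.
  have [vl E] : valid p l /\ slot p l = (1, 0, true)%N.
    rewrite /l; case: (boolP (odd p)) => op; rewrite /= ?op ?(negPf op).
      by split=> //; case: (p) op p_ge2 => [|[|[|]]].
    by split.
  have lE w : w != 0%N -> adir p l 1 w = e_x.
    by move=> w0; have := @adir_slot l w vl; rewrite E /= => ->; case: eqP w0.
  by apply: (@connect_two e_x l 1 2 1 1 e_w e_x) => //; try lia; apply: lE.
have c10 : connect (meet_at e_x) (nF 1) (nF 0).
  by apply: (@connect_two e_x (lblB 1) 2 0 2 1 e_y e_x) => //; lia.
apply: connect_hub => [[|[|[|[|]]]] // _|l].
- exact: connect_trans c23 c20.
exact: aux_use.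
Qed.

(** For p = 2 and p = 3 there are too few auxiliary colours for this, and the
    nodes fall into several classes; see [base_good_y2] and [base_good_y3]. *)
Lemma connect_y nu nu' : (4 <= p)%N -> connect (meet_at e_y) nu nu'.
Proof.
move=> p_ge4.
have use l w : valid p l -> (w == special (slot p l).1.2) = (slot p l).2 ->
    adir p l (slot p l).1.1 w = e_y.
  by move=> vl E; rewrite adir_slot // E eqxx.
have [c10 [c20 c30]] : connect (meet_at e_y) (nF 1) (nF 0) /\
   (connect (meet_at e_y) (nF 2) (nF 0) /\ connect (meet_at e_y) (nF 3) (nF 0)).
  have [op|op] := boolP (odd p); last first.
    have sB0 : slot p (lblB 0) = (1, 0, false)%N by rewrite /= (negPf op).
    have sA2 : slot p (lblA 2) = (1, 1, false)%N by rewrite /= (negPf op).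
    have useB0 w := @use (lblB 0) w; rewrite sB0 in useB0.
    have useA2 w := @use (lblA 2) w; rewrite sA2 in useA2.
    have B02 w : adir p (lblB 0) 2 w = e_y by rewrite /adir /= B0_selected2.
    split; first by apply: (@connect_two e_y (lblB 0) 2 1 2 0 e_y e_x) => //=; lia.
    split; first by apply: (@connect_two e_y (lblA 2) 1 0 1 2 e_w e_x) => //=; try lia; apply:
      useA2 => //=; lia.
    by apply: (@connect_two e_y (lblB 0) 1 1 1 2 e_w e_x) => //=; try lia; apply: useB0 => //=; lia.
  have sB3 : slot p (lblB 3) = (2, 1, false)%N by rewrite /= op.
  have sA1 : slot p (lblA 1) = (1, 0, false)%N by rewrite /= op.
  have sA3 : slot p (lblA 3) = (1, 1, false)%N by rewrite /= op.
  have useB3 w := @use (lblB 3) w; rewrite sB3 in useB3.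
  have useA1 w := @use (lblA 1) w; rewrite sA1 in useA1.
  have useA3 w := @use (lblA 3) w; rewrite sA3 in useA3.
  split; first by apply: (@connect_two e_y (lblB 3) 2 2 2 0 e_y e_x) => //=; try lia; apply:
    useB3 => //=; lia.
  split; first by apply: (@connect_two e_y (lblA 3) 1 0 1 2 e_w e_x) => //=; try lia; apply:
    useA3 => //=; lia.
  by apply: (@connect_two e_y (lblA 1) 1 1 1 2 e_w e_x) => //=; try lia; apply: useA1 => //=; lia.
apply: connect_hub => [[|[|[|[|]]]] // _|l].
exact: aux_use.
Qed.

End BaseShare.

(** * Weights for the directions x and y *)

(** The conditions of [good] that concern the base torus; the frequency of
    profiles comes in with [good_lift_base]. *)
Definition base_good m p (i : 'I_3) : Prop :=
  exists (lab : node_type p -> nat) (u : node_type p -> 'Z_m),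
  [/\ forall nu, u nu \is a GRing.unit,
      forall q, \sum_(nu | lab nu == q) u nu = 0,
      forall (x : vertex m 3) nu nu', nu \in base_profile p i x -> nu' \in base_profile p i x ->
        lab nu = lab nu'
    & forall nu nu', lab nu = lab nu' -> connect (@meet_at m p i) nu nu'].

(** If all nodes are linked, any units with sum zero will do: A_i cancels B_i,
    and the distinguished nodes cancel each other. *)
Lemma base_good_connected m p i : (forall nu nu', connect (@meet_at m p i) nu nu') ->
  base_good m p i.
Proof.
move=> conn; pose u (nu : node_type p) : 'Z_m := match nu with
  | inl (inl _) => 1 | inl (inr _) => -1 | inr j => (-1) ^+ j end.
exists (fun=> 0%N), u; split=> // [[[i'|i']|j]|[|q]].
- exact: unitr1.
- by rewrite unitrN1.
- by rewrite /u unitrX ?unitrN1.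
- rewrite (eq_bigl xpredT) // !big_sumType /= !sumr_const card_ord.
  rewrite !big_ord_recl big_ord0 /=; rewrite mulNrn; ring.
by rewrite big_pred0_eq.
Qed.

Section SmallY.
Variable m : nat.
Hypotheses (m_gt3 : (3 < m)%N) (m_even : ~~ odd m).

Lemma base_mono p i (lab : node_type p -> nat) (labhw : nat -> nat -> nat) :
  (forall c h w, cdir c h w = i -> lab (node c (class_at h w)) = labhw h w) ->
  forall (x : vertex m 3) nu nu', nu \in base_profile p i x -> nu' \in base_profile p i x -> lab
    nu = lab nu'.
Proof.
move=> H x nu nu' /base_profileP[c -> dc] /base_profileP[c' -> dc'].
by rewrite [LHS](H c _ _ dc) [RHS](H c' _ _ dc').
Qed.

(** Here a profile of y has two nodes, and A_1 and one cycle of F_2 meet only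
    each other. *)
Lemma base_good_y2 : base_good m 2 e_y.
Proof.
pose lab (nu : node_type 2) : nat := match nu with
  | inl (inl i) => (val i == 1) | inr j => (val j == 2) | _ => 0 end%N.
pose u (nu : node_type 2) : 'Z_m := match nu with
  | inl (inl i) => if val i == 0%N then -1 else 1
  | inl (inr i) => if val i == 0%N then -1 else 1
  | inr j => if val j == 0%N then 1 else if val j == 1%N then 1 else -1 end.
have U1 : (1 : 'Z_m) \is a GRing.unit by exact: unitr1.
have UN : (-1 : 'Z_m) \is a GRing.unit by rewrite unitrN1.
exists lab, u; split.
- by case=> [[i|i]|j]; rewrite /u; do ?[case: ifP => _].
- case=> [|[|q]]; rewrite big_mkcond !big_sumType /= !big_ord_recl !big_ord0 /=; ring.
- apply: (base_mono (labhw := fun h w => ((h == 1) && (w == 0))%N)).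
  case=> [f|l] h w.
    rewrite /cdir /fdir; case: f => [[|[|[|f]]] hf] //; case: h => [|[|[|h]]] //=;
      case: w => [|[|w]] //= _; by rewrite /lab /= inordK.
  rewrite /cdir /adir; case: ifP => // _; case: ifP => // lS _; move: lS.
  case: h => [|[|[|h]]]; case: w => [|[|w]]; case: l => [[[|[|l]] hl]|[[|[|l]] hl]] //=.
move=> nu nu' E.
suff hub mu : connect (@meet_at m 2 e_y) mu (if lab mu == 1%N then nF 2 2 else nF 2 1).
  by apply: connect_trans (hub nu) _; rewrite E meet_atC hub.
have M (c c' : colour 2) h w : (h < m)%N -> (w < m)%N ->
    cdir c h w = e_y -> cdir c' h w = e_y ->
    connect (@meet_at m 2 e_y) (node c (class_at h w)) (node c' (class_at h w)).
  by move=> hm wm dc dc'; apply: connect1; apply: meet_hw.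
have B0F1 : connect (@meet_at m 2 e_y) (inl (inr 0)) (nF 2 1).
  by apply: (M (inr (inr 0)) (inl e_y) 2%N 1%N) => //; lia.
have [Fmu|] := boolP (is_F mu); last first.
  case: mu => // -[[[|[|i]] hi]|[[|[|i]] hi]] // _.
  - by apply: (M (inr (inl (Ordinal hi))) (inl e_y) 0%N 1%N) => //; lia.
  - by apply: (M (inr (inl (Ordinal hi))) (inl e_w) 1%N 0%N) => //; lia.
  - by apply: (M (inr (inr (Ordinal hi))) (inl e_y) 2%N 1%N) => //; lia.
  by apply: (M (inr (inr (Ordinal hi))) (inl e_y) 0%N 0%N) => //; lia.
case: (is_F_cases Fmu) => ->; rewrite /lab /nF /= inordK //=.
- apply: connect_trans B0F1.
  by apply: (M (inl e_x) (inr (inr 0)) 2%N 0%N) => //; lia.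
apply: connect_trans B0F1.
by apply: (M (inl e_w) (inr (inr 0)) 1%N 1%N) => //; lia.
Qed.

(** Here a profile of y has two nodes, and the meetings leave three classes. *)
Lemma base_good_y3 : base_good m 3 e_y.
Proof.
pose lab (nu : node_type 3) : nat := match nu with
  | inl (inl i) => if val i == 2 then 1 else if val i == 1 then 2 else 0
  | inl (inr i) => if val i == 2 then 2 else 0
  | inr j => if val j == 2 then 1 else if val j == 1 then 0 else 2 end%N.
pose u (nu : node_type 3) : 'Z_m := match nu with
  | inl (inl i) => -1
  | inl (inr i) => 1
  | inr j => if val j == 0%N then -1 else if val j == 1%N then -1 else 1 end.
have U1 : (1 : 'Z_m) \is a GRing.unit by exact: unitr1.
have UN : (-1 : 'Z_m) \is a GRing.unit by rewrite unitrN1.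
exists lab, u; split.
- by case=> [[i|i]|j]; rewrite /u; do ?[case: ifP => _].
- case=> [|[|[|q]]]; rewrite big_mkcond !big_sumType /= !big_ord_recl !big_ord0 /=; ring.
- apply: (base_mono (labhw := fun h w =>
    if h == 1 then (if w == 0 then 1 else 2) else if (h == 2) && (w == 0) then 2 else 0)%N).
  case=> [f|l] h w.
    rewrite /cdir /fdir; case: f => [[|[|[|f]]] hf] //; case: h => [|[|[|h]]] //=;
      case: w => [|[|w]] //= _; by rewrite /lab /= inordK.
  rewrite /cdir /adir; case: ifP => // _; case: ifP => // lS _; move: lS.
  by case: h => [|[|[|h]]]; case: w => [|[|w]]; case: l => [[[|[|[|l]]] hl]|[[|[|[|l]]] hl]] //=.
move=> nu nu' E.
suff hub mu : connect (@meet_at m 3 e_y) mu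
    (if lab mu == 1%N then nF 3 2 else if lab mu == 0%N then nF 3 1 else nF 3 0).
  by apply: connect_trans (hub nu) _; rewrite E meet_atC hub.
have M (c c' : colour 3) h w : (h < m)%N -> (w < m)%N ->
    cdir c h w = e_y -> cdir c' h w = e_y ->
    connect (@meet_at m 3 e_y) (node c (class_at h w)) (node c' (class_at h w)).
  by move=> hm wm dc dc'; apply: connect1; apply: meet_hw.
have A1F0 : connect (@meet_at m 3 e_y) (inl (inl 1)) (nF 3 0).
  by apply: (M (inr (inl 1)) (inl e_x) 1%N 2%N) => //; lia.
have [Fmu|] := boolP (is_F mu); last first.
  case: mu => // -[[[|[|[|i]]] hi]|[[|[|[|i]]] hi]] // _.
  - by apply: (M (inr (inl (Ordinal hi))) (inl e_y) 0%N 1%N) => //; lia.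
  - by apply: (M (inr (inl (Ordinal hi))) (inl e_x) 1%N 2%N) => //; lia.
  - by apply: (M (inr (inl (Ordinal hi))) (inl e_w) 1%N 0%N) => //; lia.
  - by apply: (M (inr (inr (Ordinal hi))) (inl e_y) 2%N 1%N) => //; lia.
  - by apply: (M (inr (inr (Ordinal hi))) (inl e_y) 0%N 0%N) => //; lia.
  by apply: (M (inr (inr (Ordinal hi))) (inl e_x) 2%N 0%N) => //; lia.
case: (is_F_cases Fmu) => ->; rewrite /lab /nF /= inordK //=.
apply: connect_trans A1F0.
by apply: (M (inl e_w) (inr (inl 1)) 1%N 1%N) => //; lia.
Qed.

End SmallY.

Lemma base_good_xy m p i : (3 < m)%N -> ~~ odd m -> (2 <= p)%N -> i != e_w ->
  base_good m p i.
Proof.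
move=> m_gt3 m_even p_ge2; elim/I3_ind: i => // _.
  by apply: base_good_connected => nu nu'; apply: connect_x.
have [p4|] := leqP 4 p.
  by apply: base_good_connected => nu nu'; apply: connect_y.
case: p p_ge2 => [|[|[|[|p]]]] // _ _; [exact: base_good_y2 | exact: base_good_y3].
Qed.

(** * The first split *)

Section FirstStep.
Variables (m p : nat).
Hypotheses (m_gt3 : (3 < m)%N) (m_even : ~~ odd m) (p_ge2 : (2 <= p)%N).
Let k := p./2.
Let m_gt1 : (1 < m)%N. Proof. by lia. Qed.

(** The vertices at which the distinguished colours leave the zero section. *)
Definition exit_vertex (nu : node_type p) : vertex m 3 :=
  match nu with
  | inr j => if val j == 0%N then vert 0 0 0 else if val j == 1%N then vert 1%:R 0 1
             else vert 2%:R (odd j)%:R 0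
  | _ => vert 0 0 0
  end.

(** The heights above 1 all have the same colours in direction w, namely F_2
    and the A_i, so the profile of w depends on the height only up to [minn h
    2]. *)
Definition wkey (v : vertex m 3) : nat * bool :=
  (minn (height v) 2, (1 < height v)%N && parity_class v).

Lemma wdir_min (c : colour p) h : wdir c h = wdir c (minn h 2).
Proof.
case: c => [f|[i|i]]; case: h => [|[|[|h]]] //=.
Qed.

Lemma w_profile_key v v' : wkey v = wkey v' -> base_profile p e_w v = base_profile p e_w v'.
Proof.
suff sub x x' : wkey x = wkey x' -> base_profile p e_w x \subset base_profile p e_w x'.
  by move=> E; apply/eqP; rewrite eqEsubset !sub.
case=> hE pE; apply/subsetP=> nu /base_profileP[c -> /eqP].
rewrite cdir_w wdir_min hE -wdir_min -(cdir_w _ _ (val (wc x'))) => dc.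
suff -> : node c (parity_class x) = node c (parity_class x').
  by rewrite mem_base_profile.
move: dc; rewrite cdir_w; case: c => [f|l] //=; case: ifP => [/eqP f0|f0].
  by rewrite /F_node /= f0.
case: ifP => [/eqP f1|f1]; first by rewrite /F_node /= f1.
move=> h2; have h2' : (1 < height x)%N by lia.
by move: pE; rewrite h2 h2' /= => ->.
Qed.

Lemma F_w_key nu v : nu \in base_profile p e_w v -> is_F nu -> wkey v = wkey (exit_vertex nu).
Proof.
case/base_profileP=> -[f|l] -> // /eqP; rewrite cdir_w => dw _.
move: dw; rewrite /wkey /=; case: ifP => [/eqP f0 /eqP ->|f0].
  rewrite /F_node /= f0 /= inordK //= height_vert.
  by have -> : val (0 : 'Z_m) = 0%N by [].
case: ifP => [/eqP f1 /eqP ->|f1 h2].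
  by rewrite /F_node /= f1 /= inordK //= height_vert val_Zm.
have f2 : val f = 2%N by move: f0 f1 (ltn_ord f) => /=; lia.
rewrite /F_node /= f2; move: (parity_class v) => b /=.
have E (e : bool) : wkey (vert 2%:R (nat_of_bool e)%:R 0) = (2%N, e).
  have ve : val (e%:R : 'Z_m) = e by apply: val_Zm => //; case: (e); lia.
  have v2 : val (2%:R : 'Z_m) = 2%N by apply: val_Zm; lia.
  by rewrite /wkey parity_class_vert hw_classE height_vert ve v2; case: (e).
rewrite h2 (minn_idPr h2); case: b; rewrite inordK //=.
  exact: (esym (E true)).
exact: (esym (E false)).
Qed.

Lemma F_w_profile (v : vertex m 3) nu : nu \in base_profile p e_w v -> is_F nu ->
  base_profile p e_w v = base_profile p e_w (exit_vertex nu).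
Proof. by move=> h f; apply: w_profile_key; apply: F_w_key. Qed.

Lemma exit_in_profile nu : is_F nu -> nu \in base_profile p e_w (exit_vertex nu).
Proof.
have Z0 : val (0 : 'Z_m) = 0%N by [].
have M (f : 'I_3) h w y : (h < m)%N -> (w < m)%N -> wdir (inl f : colour p) h ->
    node (inl f) (class_at h w) \in base_profile p e_w (vert h%:R w%:R y : vertex m 3).
  move=> hm wm wf.
  have := mem_base_profile (inl f : colour p) e_w (vert h%:R w%:R y : vertex m 3).
  rewrite parity_class_vert hw_classE height_vert wc_vert !val_Zm // -/(class_at h w) => ->.
  by rewrite cdir_w.
case/is_F_cases=> ->; rewrite /exit_vertex /nF /= inordK //=.
- by apply: (M e_x 0%N 0%N) => //; lia.
- by apply: (M e_y 1%N 0%N) => //; lia.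
- by apply: (M e_w 2%N 0%N) => //; lia.
by apply: (M e_w 2%N 1%N) => //; lia.
Qed.

Lemma w_profile_rich (v : vertex m 3) :
  (m.*2.+2 <= #|[set x : vertex m 3 | base_profile p e_w x == base_profile p e_w v]|)%N.
Proof.
have [hh key] : exists hh : 'Z_m -> 'Z_m, forall w y, wkey (vert (hh w) w y) = wkey v.
  case E: (height v) => [|[|h]].
  - exists (fun=> 0) => w y; rewrite /wkey E height_vert.
    by have -> : val (0 : 'Z_m) = 0%N by [].
  - by exists (fun=> 1%:R) => w y; rewrite /wkey E height_vert val_Zm.
  pose hh (w : 'Z_m) : 'Z_m := if odd (val w) == parity_class v then 2%:R else 3%:R.
  exists hh => w y.
  rewrite /wkey E parity_class_vert hw_classE height_vert.
  have v2 : val (2%:R : 'Z_m) = 2%N by apply: val_Zm; lia.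
  have v3 : val (3%:R : 'Z_m) = 3%N by apply: val_Zm; lia.
  by rewrite /hh; case: (odd (val w)); case: (parity_class v); case: eqP => // _; rewrite ?v2 ?v3.
have sub : [set vert (hh z.1) z.1 z.2 | z : 'Z_m * 'Z_m]
    \subset [set x : vertex m 3 | base_profile p e_w x == base_profile p e_w v].
  by apply/subsetP=> _ /imsetP[[w y] _ ->]; rewrite inE; apply/eqP/w_profile_key/key.
apply: leq_trans (subset_leq_card sub).
rewrite card_imset => [|[w y] [w' y'] /vert_inj[_ /= -> ->]] //.
by rewrite card_prod card_Zm //; nia.
Qed.

(** Profiles do not depend on y. *)
Lemma xy_profile_card i (v : vertex m 3) :
  (m <= #|[set x : vertex m 3 | base_profile p i x == base_profile p i v]|)%N.
Proof.
have sub : [set vert (hgt v) (wc v) y | y : 'Z_m]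
    \subset [set x : vertex m 3 | base_profile p i x == base_profile p i v].
  apply/subsetP=> _ /imsetP[y _ ->]; rewrite inE; apply/eqP.
  set v' := vert _ _ _.
  have hE : height v' = height v by rewrite height_vert.
  have wE : wc v' = wc v by rewrite wc_vert.
  have pE : parity_class v' = parity_class v by rewrite /parity_class hE wE.
  apply/setP=> nu; apply/idP/idP=> /base_profileP[c -> <-].
    by rewrite hE wE pE mem_base_profile.
  by rewrite -hE -wE -pE mem_base_profile.
apply: leq_trans (subset_leq_card sub).
by rewrite card_imset ?card_Zm // => y y' /vert_inj[].
Qed.

Lemma card_vertex0 : #|{: vertex m 3}|%:R = 0 :> 'Z_m.
Proof. by rewrite card_mx card_Zm // natrX natr_m0 // expr0n. Qed.

(** The weight 1 of a distinguished node is the number of its exits. The A_i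
    and two of the B_i get -1, the other B_i get 1. *)
Lemma w_units : exists u : node_type p -> 'Z_m,
  [/\ forall nu, u nu \is a GRing.unit, forall nu, is_F nu -> u nu = 1 & \sum_nu u nu = 0].
Proof.
have U1 : (1 : 'Z_m) \is a GRing.unit by exact: unitr1.
have UN : (-1 : 'Z_m) \is a GRing.unit by rewrite unitrN1.
exists (fun nu => match nu with
  | inl (inl i) => -1 | inl (inr i) => if (val i < 2)%N then -1 else 1 | inr j => 1 end).
split; [by case=> [[i|i]|j] //; case: ifP | by case=> [[i|i]|j] |].
have S : \sum_(i < p) (if (val i < 2)%N then -1 else 1) = p%:R - 4%:R :> 'Z_m.
  rewrite (eq_bigr (fun i : 'I_p => 1 - (i < 2)%N%:R *+ 2)) => [|i _]; last first.
    by case: (val i < 2)%N; rewrite /= ?mulr0n; ring.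
  by rewrite big_split /= sumrN sumrMnl -natr_sum sum_nat_lt // sumr_const card_ord; ring.
rewrite !big_sumType /= S !sumr_const !card_ord mulNrn; ring.
Qed.

(** Any two A_i meet at height 2; B_i with i > 0 meets A_0 at height 1, and B_0
    meets A_1 at height 0. *)
Lemma w_conn_free (nu nu' : node_type p) : ~~ is_F nu -> ~~ is_F nu' ->
  connect (fun nu nu' => [&& ~~ is_F nu, ~~ is_F nu' &
    [exists x : vertex m 3, (nu \in base_profile p e_w x) && (nu' \in base_profile p e_w x)]])
      nu nu'.
Proof.
set R : rel (node_type p) := fun _ _ => _.
have RC : connect_sym R.
  by apply: sym_connect_sym => a b; rewrite /R andbCA; do 2!congr (_ && _); apply: eq_existsb =>
    x; rewrite andbC.
have M l l' h : (h < m)%N -> in_W h (label_of l) -> in_W h (label_of l') ->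
    connect R (inl l) (inl l').
  move=> hm lW l'W; apply: connect1; rewrite /R /=.
  have : @meet_at m p e_w (node (inr l) (class_at h 0)) (node (inr l') (class_at h 0)).
    apply: meet_hw => //; [lia | |]; by apply/eqP; rewrite cdir_w.
  by [].
have p0 : (0 < p)%N by lia.
pose A0 : 'I_p + 'I_p := inl (Ordinal p0).
suff hub l : connect R (inl l) (inl A0).
  by case: nu nu' => [l|j] // [l'|j'] // _ _; apply: connect_trans (hub l) _; rewrite RC hub.
case: l => [i|i]; first by apply: (M _ _ 2%N) => //; lia.
have [i0|i0] := eqVneq (val i) 0%N; last first.
  by apply: (M _ _ 1%N) => //; case: (i) i0 => [[|j] hj].
apply: (@connect_trans _ _ (inl (inl (Ordinal p_ge2)))).
  by apply: (M _ _ 0%N) => //=; [lia | rewrite i0].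
by apply: (M _ _ 2%N) => //; lia.
Qed.

Definition stage0 : stage m p 3 :=
  Stage (init_mult p k) (@init_map m p k) (@init_dir m p k) (fun v => v) (fun v => v)
    (fun i => i != e_w).

Lemma init_factorizes : factorizes (init_mult p k) (@init_map m p k) (@init_dir m p k).
Proof.
split=> //.
- by move=> c; apply: injF_bij; apply: init_map_inj.
move=> v i; rewrite -(card_cdir m_gt3 m_even p_ge2 (height v) (val (wc v))).
by apply: eq_card => c; rewrite !inE init_dirE.
Qed.

Lemma pre_inv0 : pre_inv k stage0 (fun=> p).
Proof.
split=> //=.
- exact: init_factorizes.
- by move=> c x y; apply: init_cycle.
- by move=> f f' v; apply: F_dir_inj.
- case; rewrite big_mkcond !big_ord_recl big_ord0 /= /init_mult /=; rewrite /k; lia.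
- by elim/I3_ind; rewrite /init_mult /=; lia.
Qed.

Lemma first_step : exists delta,
  balanced_split (init_mult p k) (@init_map m p k) e_w delta /\
  inv k exit_vertex (next stage0 e_w delta) true (fun e => p - (e == false))%N.
Proof.
have aE : st_mult stage0 e_w = p.+1 by rewrite /= /init_mult /= addn1.
have aE0 : init_mult p k e_w = p.+1 := aE.
have cardN (x : vertex m 3) : #|base_profile p e_w x| = p.+1.
  by rewrite (card_base_profile m_gt3 m_even) // /init_mult /= addn1.
have F_last (x : vertex m 3) nu : nu \in base_profile p e_w x -> is_F nu ->
    index nu (enum (base_profile p e_w x)) = p.+1.-1.
  move=> h h'; rewrite profile_F_last ?cardN //.
  by move=> f f' v; apply: F_dir_inj.
pose Z1 := zeros (next stage0 e_w (fun _ _ => false)).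
have Z1P y : y \in Z1 -> (unident e_w y).1 \in zeros stage0 /\ (unident e_w y).2 = 0.
  exact: zeros_next.
have [D [Dsub Dcard Dunit Dnew Dold] Dex] :=
  @design_first m (node_type p) _ _ (@unident m 3 e_w) Z1 m_gt3 (unident_bij m e_w)
    (fun y h => (Z1P y h).2) p.+1 (base_profile p e_w) (@is_F p) exit_vertex
    p_ge2 cardN F_last exit_in_profile F_w_profile card_vertex0 w_profile_rich w_units w_conn_free.
have a2 : (2 <= st_mult stage0 e_w)%N by rewrite aE; lia.
have Dcard' x : #|D x| = (st_mult stage0 e_w)./2 by rewrite aE Dcard.
have node_inv := parity_inv m_gt3 m_even p_ge2.
exists (delta_of stage0 D); split; first exact: (balanced_delta pre_inv0 a2 Dsub Dcard').
split.
- exact: (pre_step m_gt3 node_inv pre_inv0 a2 Dsub Dcard' Dunit).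
- move=> f v vx; rewrite [LHS]/= /split_map identK.
  rewrite (_ : delta_of _ _ _ _ = false) ?addr0 //; apply/negbTE.
  rewrite /delta_of [st_base _ _]/=; set nu := node _ _.
  have [nuN|nuN] := boolP (nu \in base_profile p e_w v); last first.
    by apply: contraNN nuN; apply: (subsetP (Dsub v)).
  by rewrite Dex //.
move=> j; rewrite [st_mult _ _]/= /split_mult [st_side _ _]/=.
case: unliftP => [l|] ->; last first.
  rewrite aE0 => aj.
  by apply: good_ext (Dnew aj) => y; rewrite next_profile_new.
case: eqP => [->|/eqP NE] aj.
  have {}aj : (2 <= p.+1 - (p.+1)./2)%N by move: aj; rewrite aE0 uphalf_half; lia.
  by apply: good_ext (Dold aj) => y; rewrite next_profile_lift // eqxx.
have [lab [u [uU u0 mono conn]]] := base_good_xy m_gt3 m_even p_ge2 NE.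
have gl := good_lift_base m_gt3 (unident_bij m e_w) Z1P uU u0 mono (xy_profile_card l) conn.
apply: (good_weaken _ (good_ext _ gl)); first by nia.
by move=> y; rewrite next_profile_lift // (negPf NE).
Qed.

End FirstStep.

(** * The permutations sigma* *)

Section SigmaStar.
Variable m : nat.
Hypothesis m_gt3 : (3 < m)%N.
Let m_gt1 : (1 < m)%N. Proof. by lia. Qed.
Implicit Types (q : 'Z_m * 'Z_m) (t : 'Z_m) (z c : 'I_3).

(** The three lines outside which sigma* is the identity. *)
Definition line z t : 'Z_m * 'Z_m := iter (val z) (@R_map m) (t, - t).

Lemma line0 t : line 0 t = (t, - t). Proof. by []. Qed.
Lemma line1 t : line 1 t = (0, t).
Proof. by rewrite /line /= /R_map /=; congr (_, _); ring. Qed.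
Lemma line2 t : line 2 t = (- t, 0).
Proof. by rewrite /line /= /R_map /=; congr (_, _); ring. Qed.

Lemma R_mapD q q' : R_map (q + q') = R_map q + R_map q'.
Proof. by rewrite /R_map; congr (_, _) => /=; ring. Qed.

Lemma R_map3 q : R_map (R_map (R_map q)) = q.
Proof. by case: q => a b; rewrite /R_map /=; congr (_, _); ring. Qed.

Lemma R_map_inj : injective (@R_map m).
Proof. by move=> q q' E; rewrite -(R_map3 q) -(R_map3 q') E. Qed.

Lemma R_line z t : R_map (line z t) = line (z + 1) t.
Proof.
elim/I3_ind: z.
- by rewrite -[line e_x t]/(line 0 t) -[line (e_x + 1) t]/(line 1 t) line1 line0 /R_map /=;
  congr (_, _); ring.
- by rewrite -[line e_y t]/(line 1 t) -[line (e_y + 1) t]/(line 2 t) line2 line1 /R_map /=;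
  congr (_, _); ring.
by rewrite -[line e_w t]/(line 2 t) -[line (e_w + 1) t]/(line 0 t) line0 line2 /R_map /=; congr
  (_, _); ring.
Qed.

Lemma line_inj z z' t t' : t != 0 -> line z t = line z' t' -> z = z' /\ t = t'.
Proof.
move=> t0; have N0 : (- t == 0) = false by rewrite oppr_eq0; apply/negbTE.
have {t0} t0 := negbTE t0.
move/eqP; elim/I3_ind: z; elim/I3_ind: z'; rewrite ?(line0, line1, line2) xpair_eqE;
  try (by rewrite ?N0 ?t0 ?andbF);
  try (by move=> /andP[/eqP E /eqP _]; split=> //; move: E; try move/oppr_inj);
  try (by move=> /andP[_ /eqP E]; split=> //);
  move=> /andP[/eqP E /eqP E']; exfalso; move/eqP: E; move/eqP: E';
  rewrite ?[0 == _]eq_sym ?t0 ?N0 ?oppr_eq0 //.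
  by move=> /eqP E /eqP E'; move: t0 N0; rewrite ?E ?E' ?oppr0 eqxx.
by move=> /eqP -> ; rewrite N0.
Qed.

Definition line_act z t c : 'I_3 :=
  if t == 1 then c - 1 else if t == -1 then c + 1 else 2 * z - c.

Lemma sigma_star_line z t c : t != 0 -> sigma_star (line z t) c = line_act z t c.
Proof.
move=> t0; rewrite /sigma_star; case: pickP => [[z' t'] /andP[/= _ /eqP E]|/(_ (z, t))].
  by have [-> ->] := line_inj t0 E.
by rewrite /= t0 eqxx.
Qed.

Lemma sigma_star_off q c : (forall z t, t != 0 -> q != line z t) -> sigma_star q c = c.
Proof.
move=> off; rewrite /sigma_star; case: pickP => [[z t] /andP[/= t0 /eqP E]|//].
by case/eqP: (off z t t0).
Qed.

Lemma on_lineP q : (exists z t, t != 0 /\ q = line z t) \/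
  (forall z t, t != 0 -> q != line z t).
Proof.
have [/existsP[[z t] /andP[t0 /eqP E]]|N] :=
    boolP [exists zt : 'I_3 * 'Z_m, (zt.2 != 0) && (q == line zt.1 zt.2)].
  by left; exists z, t.
by right=> z t t0; move/existsPn/(_ (z, t)): N; rewrite /= t0.
Qed.

(** R permutes the three lines cyclically, raising z by one. *)
Lemma sigma_star_R q c : sigma_star (R_map q) (c + 1) = sigma_star q c + 1.
Proof.
have [[z [t [t0 ->]]]|off] := on_lineP q.
  rewrite R_line !sigma_star_line // /line_act.
  by case: ifP => _; [ring | case: ifP => _; ring].
rewrite !sigma_star_off // => z t t0; apply: contraNneq (off (z - 1) t t0) => E.
by apply/eqP/R_map_inj; rewrite E R_line subrK.
Qed.

(** The points where sigma* maps the colour 0 to e_w. *)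
Definition exceptional1 q :=
  [|| q == (1, -1), [&& q.1 == 0, q.2 != 0 & q.2 != -1] | q == (-1, 0)].
(** The points where sigma* maps the colour 0 to e_y. *)
Definition exceptional2 q :=
  [|| q == (-1, 1), q == (0, -1) | [&& q.2 == 0, q.1 != 0 & q.1 != -1]].

Let one0 : (1 == 0 :> 'Z_m) = false. Proof. exact: oner_eq0. Qed.
Let None0 : (-1 == 0 :> 'Z_m) = false. Proof. by rewrite oppr_eq0 oner_eq0. Qed.
Let oneN : (1 == -1 :> 'Z_m) = false.
Proof.
by rewrite -subr_eq0 opprK -(natrD _ 1 1) Zp_nat_eq0 // gtnNdvd //; lia.
Qed.

Lemma sigma_star0 q : sigma_star q 0 =
  if exceptional2 q then e_y else if exceptional1 q then e_w else e_x.
Proof.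
have N (x y : 'Z_m) : (- x == y) = (x == - y) by rewrite eqr_oppLR.
have [[z [t [t0 ->]]]|off] := on_lineP q; last first.
  rewrite sigma_star_off // /exceptional1 /exceptional2.
  have off0 t : t != 0 -> q != (t, - t) by move=> t0; rewrite -line0 off.
  have off1 t : t != 0 -> q != (0, t) by move=> t0; rewrite -line1 off.
  have off2 t : t != 0 -> q != (- t, 0) by move=> t0; rewrite -line2 off.
  have := off0 (-1); rewrite opprK None0 => /(_ isT)/negPf ->.
  have := off0 1; rewrite one0 => /(_ isT)/negPf ->.
  have := off1 (-1); rewrite None0 => /(_ isT)/negPf ->.
  have := off2 1; rewrite one0 => /(_ isT)/negPf -> /=.
  case: q off1 off2 {off off0} => a b off1 off2 /=.
  have -> : [&& b == 0, a != 0 & a != -1] = false.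
    apply/negP=> /and3P[/eqP b0 a0 _]; have := off2 (- a).
    by rewrite oppr_eq0 a0 opprK b0 eqxx => /(_ isT).
  have -> // : [&& a == 0, b != 0 & b != -1] = false.
  apply/negP=> /and3P[/eqP a0 b0 _]; have := off1 b b0.
  by rewrite a0 eqxx.
rewrite sigma_star_line // /line_act /exceptional1 /exceptional2.
elim/I3_ind: z; rewrite ?(line0, line1, line2) /= !xpair_eqE /=.
- rewrite !N (oppr0 'Z_m) opprK (negPf t0) /= !orbF !andbb.
  have [->|t1] := eqVneq t 1; first by rewrite oneN; apply: val_inj.
  by have [_|tN1] := eqVneq t (-1); apply: val_inj.
- rewrite t0 (negPf t0) /= ![0 == _]eq_sym None0 /= ?orbF.
  have [->|t1] := eqVneq t 1; first by rewrite oneN /=; apply: val_inj.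
  by have [_|tN1] := eqVneq t (-1); apply: val_inj.
rewrite eqxx ![0 == _]eq_sym None0 one0 !andbF /= !andbT !N (oppr0 'Z_m) opprK (negPf t0) /=.
have [_|t1] := eqVneq t 1; first by apply: val_inj.
by have [_|tN1] := eqVneq t (-1); apply: val_inj.
Qed.

End SigmaStar.

(** * Orbits along rows when 3 does not divide m *)

Local Open Scope nat_scope.

Section Rows.
Variables (m : nat) (T : Type) (R : T -> T -> Prop) (P : nat -> nat -> T).
Variables (e1 e2 : nat -> nat -> bool) (d : nat).
Hypotheses (R_refl : forall x, R x x) (R_sym : forall x y, R x y -> R y x).
Hypothesis R_trans : forall x y z, R x y -> R y z -> R x z.
Hypothesis P_per1 : forall a b, P (a + m) b = P a b.
Hypothesis P_per2 : forall a b, P a (b + m) = P a b.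
Hypothesis stepE : forall a b, 0 < a <= m -> b < m ->
  R (P a b) (if e2 a b then P a.+2 (b + d) else if e1 a b then P a.+1 b.+1 else P a.+1 b).

Lemma row_path a a' b : 0 < a <= a' -> a' <= m -> b < m ->
  (forall i, a <= i < a' -> ~~ e1 i b && ~~ e2 i b) -> R (P a b) (P a' b).
Proof.
move=> /andP[a0 aa'] a'm bm; have -> : a' = a + (a' - a) by rewrite subnKC.
move: (a' - a) (subnKC aa') => n; elim: n a' a'm {aa'} => [|n IHn] a' a'm E gen.
  by rewrite addn0.
apply: R_trans (IHn (a + n) _ erefl _) _; [lia | by move=> i hi; apply: gen; lia |].
have /andP[/negPf g1 /negPf g2] : ~~ e1 (a + n) b && ~~ e2 (a + n) b by apply: gen; lia.
have := @stepE (a + n) b; rewrite g1 g2 addnS; apply; lia.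
Qed.

Lemma step1 a b : 0 < a <= m -> b < m -> e1 a b -> ~~ e2 a b -> R (P a b) (P a.+1 b.+1).
Proof. by move=> am bm E1 /negPf E2; have := stepE am bm; rewrite E1 E2. Qed.

Lemma step2 a b : 0 < a <= m -> b < m -> e2 a b -> R (P a b) (P a.+2 (b + d)).
Proof. by move=> am bm E2; have := stepE am bm; rewrite E2. Qed.

Lemma step0 a b : 0 < a <= m -> b < m -> ~~ e1 a b -> ~~ e2 a b -> R (P a b) (P a.+1 b).
Proof. by move=> am bm /negPf E1 /negPf E2; have := stepE am bm; rewrite E1 E2. Qed.

End Rows.

(** [shearA1] and [shearA2] are the exceptional points of the two kinds in the
    coordinates of [ptA], for 1 <= a <= m and b < m. Here a = m, rather than a
    = 0, is the column through the origin, so that a row runs from a = 1 to a =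
    m. *)
Definition shearA1 (m a b : nat) : bool :=
  [|| (a == 1) && (b == 1), [&& a == m, b != 0 & b.+1 != m] | (a.+1 == m) && (b.+2 == m)].
Definition shearA2 (m a b : nat) : bool :=
  [|| (a.+1 == m) && (b.+1 == m), (a == m) && (b.+1 == m)
    | [&& (b == 2 * a) || (b + m == 2 * a), a != m & a.+1 != m]].

Section RowsA.
Variables (M : nat) (T : Type) (R : T -> T -> Prop) (P : nat -> nat -> T).
Let m := 2 * M.
Hypotheses (M_gt1 : 1 < M) (M_n3 : ~~ (3 %| M)).
Hypotheses (R_refl : forall x, R x x) (R_sym : forall x y, R x y -> R y x).
Hypothesis R_trans : forall x y z, R x y -> R y z -> R x z.
Hypothesis P_per1 : forall a b, P (a + m) b = P a b.
Hypothesis P_per2 : forall a b, P a (b + m) = P a b.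
Hypothesis stepE : forall a b, 0 < a <= m -> b < m ->
  R (P a b) (if shearA2 m a b then P a.+2 (b + 2)
             else if shearA1 m a b then P a.+1 b.+1 else P a.+1 b).

Let row := row_path R_refl R_trans stepE.
Let st0 := step0 stepE.
Let st1 := step1 stepE.
Let st2 := step2 stepE.

Ltac side := rewrite /shearA1 /shearA2 /m; lia.

(** Exceptional points with b = 2a or b = 2a - m cut the row b = 2j into three
    segments, which start at [nodeA 0 j], [nodeA 1 j] and [nodeA 2 j]. *)
Definition nodeA (s j : nat) : T :=
  P (match s with 0 => 1 | 1 => j.+1 | _ => (j + M).+1 end) (2 * j).

Let PS b : P m.+1 b = P 1 b. Proof. by rewrite -add1n P_per1. Qed.
Let PSS b : P m.+2 b = P 2 b. Proof. by rewrite -add2n P_per1. Qed.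

Lemma rowX j a : 0 < j < M -> 0 < a <= j -> R (P a (2 * j)) (P j.+2 (2 * j + 2)).
Proof.
move=> jM aj; apply: R_trans (@row a j (2 * j) _ _ _ _) _; try by side.
by apply: (@st2 _ _); side.
Qed.

Lemma rowY j a : 0 < j < M.-1 -> j < a <= j + M ->
  R (P a (2 * j)) (P (j + M).+2 (2 * j + 2)).
Proof.
move=> jM aj; apply: R_trans (@row a (j + M) (2 * j) _ _ _ _) _; try by side.
by apply: (@st2 _ _); side.
Qed.

Lemma rowZ j a : 0 < j < M -> j + M < a <= m ->
  R (P a (2 * j)) (P 1 (2 * j + 1)).
Proof.
rewrite /m => jM aj; apply: R_trans (@row a m (2 * j) _ _ _ _) _; try by side.
by rewrite -PS addn1; apply: (@st1 _ _); side.
Qed.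

Lemma row_odd b a : odd b -> b.+1 < m -> 0 < a <= m -> (b == 1) ==> (1 < a) ->
  R (P a b) (P 1 b.+1).
Proof.
rewrite /m => bo bm am b1; apply: R_trans (@row a m b _ _ _ _) _; try by side.
by rewrite -PS; apply: (@st1 _ _); side.
Qed.

Lemma row_last a : 0 < a < m -> R (P a m.-1) (P 2 2).
Proof.
rewrite /m => am; apply: R_trans (@row a m.-1 m.-1 _ _ _ _) _; try by side.
apply: (@R_trans _ (P 1 1)).
  have := @st2 m.-1 m.-1.
  rewrite (_ : m.-1.+2 = m.+1); last by side.
  rewrite (_ : m.-1 + 2 = 1 + m) ?P_per2 ?PS; last by side.
  by apply; side.
by apply: (@st1 _ _); side.
Qed.

Lemma row_zero a : 0 < a <= M -> R (P a 0) (P M.+2 2).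
Proof.
move=> am; apply: R_trans (@row a M 0 _ _ _ _) _; try by side.
by apply: (@st2 _ _); side.
Qed.

Lemma row_zero' a : M < a <= m -> R (P a 0) (P M.+2 2).
Proof.
rewrite /m => am; apply: R_trans (@row a m 0 _ _ _ _) _; try by side.
apply: (@R_trans _ (P 1 0)); last by apply: row_zero; lia.
by rewrite -PS; apply: (@st0 _ _); side.
Qed.

Lemma row_minus2 a : M <= a < m -> R (P a (2 * M.-1)) (P 1 2).
Proof.
rewrite /m => am; apply: R_trans (@row a m.-1 (2 * M.-1) _ _ _ _) _; try by side.
apply: (@R_trans _ (P m m.-1)).
  have := @st1 m.-1 (2 * M.-1).
  rewrite (_ : m.-1.+1 = m); last by side.
  rewrite (_ : (2 * M.-1).+1 = m.-1); last by side.
  by apply; side.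
apply: (@R_trans _ (P 2 1)); last by apply: row_odd; side.
have := @st2 m m.-1; rewrite PSS (_ : m.-1 + 2 = 1 + m) ?P_per2; last by side.
by apply; side.
Qed.

Lemma nodeA_next s j : s < 3 -> 0 < j -> j.+1 < M ->
  R (nodeA s j) (nodeA (s.+1 %% 3) j.+1).
Proof.
move=> s3 j0 jM; rewrite /nodeA mulnSr.
case: s s3 => [|[|[|//]]] _.
- by apply: rowX; lia.
- by apply: rowY; lia.
apply: R_trans (@rowZ j (j + M).+1 _ _) _; try by side.
rewrite (_ : 2 * j + 2 = (2 * j + 1).+1); last by lia.
by apply: row_odd; side.
Qed.

(** Going from the last even row round to the first one shifts the segment by
    two, where the passage between other even rows shifts it by one. *)
Lemma nodeA_wrap s : s < 3 -> R (nodeA s M.-1) (nodeA (s.+2 %% 3) 1).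
Proof.
rewrite /nodeA; case: s => [|[|[|//]]] _.
- apply: R_trans (@rowX M.-1 1 _ _) _; try by lia.
  rewrite (_ : 2 * M.-1 + 2 = 0 + m) ?P_per2 /m; last by lia.
  by apply: row_zero'; side.
- by rewrite prednK; [apply: row_minus2; side | lia].
apply: R_trans (@rowZ M.-1 (M.-1 + M).+1 _ _) _; try by side.
rewrite (_ : 2 * M.-1 + 1 = m.-1); last by side.
by apply: row_last; side.
Qed.

Lemma nodeA_run s n : s < 3 -> n.+1 < M -> R (nodeA s 1) (nodeA ((s + n) %% 3) n.+1).
Proof.
move=> s3; elim: n => [|n IHn] nM; first by rewrite addn0 modn_small.
apply: R_trans (IHn _) _; first by lia.
have := @nodeA_next ((s + n) %% 3) n.+1.
rewrite (_ : ((s + n) %% 3).+1 %% 3 = (s + n.+1) %% 3); last by lia.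
by apply; rewrite ?ltn_mod; lia.
Qed.

Lemma nodeA_shift s : s < 3 -> R (nodeA s 1) (nodeA ((s + M) %% 3) 1).
Proof.
move=> s3; apply: R_trans (@nodeA_run s M.-2 s3 _) _; first by lia.
rewrite (_ : M.-2.+1 = M.-1); last by lia.
have := @nodeA_wrap ((s + M.-2) %% 3).
rewrite (_ : ((s + M.-2) %% 3).+2 %% 3 = (s + M) %% 3); last by lia.
by apply; rewrite ltn_mod.
Qed.

(** A round through all even rows shifts the segment by M modulo 3, and 3 does
    not divide M. *)
Lemma nodeA_one s : s < 3 -> R (nodeA s 1) (nodeA 0 1).
Proof.
move=> s3; have := nodeA_shift s3; have := @nodeA_shift ((s + M) %% 3).
rewrite ltn_mod modnDml => /(_ isT).
have : (s == 0) || ((s + M) %% 3 == 0) || ((s + M + M) %% 3 == 0) by move: M_n3; lia.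
case/orP=> [/orP[]|] /eqP -> // H1 H2; exact: R_trans H2 H1.
Qed.

Lemma nodeA_all s j : s < 3 -> 0 < j < M -> R (nodeA s j) (nodeA 0 1).
Proof.
move=> s3 jM; have s'3 : (s + 2 * j.-1) %% 3 < 3 by rewrite ltn_mod.
have := @nodeA_run _ j.-1 s'3.
rewrite (_ : ((s + 2 * j.-1) %% 3 + j.-1) %% 3 = s); last by lia.
rewrite prednK; last by lia.
move=> H; apply: R_trans (R_sym (H _)) (nodeA_one s'3); lia.
Qed.

Theorem rowsA a b : 0 < a <= m -> b < m -> R (P a b) (nodeA 0 1).
Proof.
move=> am bm; have r12 : R (P 1 2) (nodeA 0 1) by apply: (@nodeA_all 0 1); lia.
have r22 : R (P 2 2) (nodeA 0 1) by apply: (@nodeA_all 1 1); lia.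
have rZ : R (P M.+2 2) (nodeA 0 1).
  by have := @nodeA_all 2 1; rewrite /nodeA add1n; apply; lia.
have rE j a' : 0 < j < M -> 0 < a' <= m -> R (P a' (2 * j)) (nodeA 0 1).
  rewrite {1}/m => jM am'; have [aj|ja] := leqP a' j.
    have H := @rowX j a' jM; apply: R_trans (H _) _; first by lia.
    by apply: R_trans (R_sym (@rowX j 1 _ _)) (@nodeA_all 0 j _ _); lia.
  have [aj|ja'] := leqP a' (j + M).
    have [jM1|jM1] := eqVneq j M.-1.
      have [am1|am1] := eqVneq a' m.
        have := @nodeA_all 2 j; rewrite /nodeA (_ : (j + M).+1 = a'); last by side.
        by apply; side.
      by apply: R_trans r12; rewrite jM1; apply: row_minus2; side.
    apply: R_trans (@rowY j a' _ _) _; try by lia.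
    by apply: R_trans (R_sym (@rowY j j.+1 _ _)) (@nodeA_all 1 j _ _); lia.
  apply: R_trans (@rowZ j a' _ _) _; try by side.
  by apply: R_trans (R_sym (@rowZ j (j + M).+1 _ _)) (@nodeA_all 2 j _ _); side.
have rO b' a' : odd b' -> b'.+1 < m -> 0 < a' <= m -> R (P a' b') (nodeA 0 1).
  move=> ob bm' am'; have [/andP[/eqP-> /eqP->]|g] := boolP ((a' == 1) && (b' == 1)).
    by apply: R_trans r22; apply: (@st1 _ _); side.
  apply: R_trans (@row_odd b' a' ob bm' am' _) _; first by side.
  rewrite (_ : b'.+1 = 2 * uphalf b'); last by lia.
  by apply: rE; move: bm'; side.
have [->|b0] := eqVneq b 0.
  by apply: R_trans rZ; have [?|?] := leqP a M; [apply: row_zero|apply: row_zero']; side.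
have [ob|eb] := boolP (odd b); last first.
  by rewrite (_ : b = 2 * b./2); [apply: rE; move: bm; side | lia].
have [bm1|bm1] := leqP m b.+1; last exact: rO.
have -> : b = m.-1 by move: bm bm1; side.
have [->|am1] := eqVneq a m; last by apply: R_trans r22; apply: row_last; side.
apply: (@R_trans _ (P 2 1)); last by apply: rO; side.
have := @st2 m m.-1; rewrite PSS (_ : m.-1 + 2 = 1 + m) ?P_per2; last by side.
by apply; side.
Qed.

End RowsA.

Local Open Scope ring_scope.

(** * Orbits along rows when 3 divides m *)

Local Open Scope nat_scope.

(** [shearB1] and [shearB2] are the exceptional points in the coordinates of
    [ptB], with the same ranges as for [shearA1]. *)
Definition shearB1 (m a b : nat) : bool :=
  [|| (a == 1) && (b + 4 == m), [&& a == m, b != 0 & b.+1 != m] | (a.+1 == m) && (b == 3)].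
Definition shearB2 (m a b : nat) : bool :=
  [|| (a.+1 == m) && (b == 4), (a == m) && (b.+1 == m)
    | [&& [|| b + 3 * a == m, b + 3 * a == 2 * m | b + 3 * a == 3 * m],
          a != m & a.+1 != m]].

Section RowsB.
Variables (M : nat) (T : Type) (R : T -> T -> Prop) (P : nat -> nat -> T).
Let m := 3 * M.
Hypotheses (M_gt1 : 1 < M) (M_even : ~~ odd M).
Hypotheses (R_refl : forall x, R x x) (R_sym : forall x y, R x y -> R y x).
Hypothesis R_trans : forall x y z, R x y -> R y z -> R x z.
Hypothesis P_per1 : forall a b, P (a + m) b = P a b.
Hypothesis P_per2 : forall a b, P a (b + m) = P a b.
Hypothesis stepE : forall a b, 0 < a <= m -> b < m ->
  R (P a b) (if shearB2 m a b then P a.+2 (b + (m - 3))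
             else if shearB1 m a b then P a.+1 b.+1 else P a.+1 b).

Let row := row_path R_refl R_trans stepE.
Let st0 := step0 stepE.
Let st1 := step1 stepE.
Let st2 := step2 stepE.

Ltac side := rewrite /shearB1 /shearB2 /m; lia.

Let PS b : P m.+1 b = P 1 b. Proof. by rewrite -add1n P_per1. Qed.
Let PSS b : P m.+2 b = P 2 b. Proof. by rewrite -add2n P_per1. Qed.

(** A step of the second kind adds m - 3 to b, that is, it subtracts 3. *)
Lemma down a b : 0 < a <= m -> 2 < b < m -> shearB2 m a b -> R (P a b) (P a.+2 (b - 3)).
Proof.
rewrite {2}/m => am bm E; rewrite -[P _ (b - 3)]P_per2 (_ : b - 3 + m = b + (m - 3)).
  by apply: (@st2 _ _) E => //; move: am; side.
by side.
Qed.

(** Exceptional points with b + 3a = m, 2m or 3m cut the row b = 3 (M - j) into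
    four segments. The index j grows as b decreases, in the direction of the
    steps of the second kind. *)
Definition nodeB (s j : nat) : T :=
  P (match s with 0 => 1 | 1 => j.+1 | 2 => (j + M).+1 | _ => (j + 2 * M).+1 end)
    (3 * (M - j)).

(** Four passages out of the rows divisible by three, one for each segment. *)
Lemma rowB0 j a : 0 < j < M -> 0 < a <= j ->
  R (P a (3 * (M - j))) (P j.+2 (3 * (M - j.+1))).
Proof.
move=> jM aj; apply: R_trans (@row a j _ _ _ _ _) _; try by side.
rewrite (_ : 3 * (M - j.+1) = 3 * (M - j) - 3); last by lia.
by apply: down; side.
Qed.

Lemma rowB1 j a : 0 < j < M -> j < a <= j + M ->
  R (P a (3 * (M - j))) (P (j + M).+2 (3 * (M - j.+1))).
Proof.
move=> jM aj; apply: R_trans (@row a (j + M) _ _ _ _ _) _; try by side.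
rewrite (_ : 3 * (M - j.+1) = 3 * (M - j) - 3); last by lia.
by apply: down; side.
Qed.

Lemma rowB2 j a : 0 < j < M.-1 -> j + M < a <= j + 2 * M ->
  R (P a (3 * (M - j))) (P (j + 2 * M).+2 (3 * (M - j.+1))).
Proof.
move=> jM aj; apply: R_trans (@row a (j + 2 * M) _ _ _ _ _) _; try by side.
rewrite (_ : 3 * (M - j.+1) = 3 * (M - j) - 3); last by lia.
by apply: down; side.
Qed.

Lemma rowB3 j a : 0 < j < M -> j + 2 * M < a <= m ->
  R (P a (3 * (M - j))) (P 1 (3 * (M - j)).+1).
Proof.
rewrite {1}/m => jM aj; apply: R_trans (@row a m _ _ _ _ _) _; try by side.
by rewrite -PS; apply: (@st1 _ _); side.
Qed.

Lemma rowB4 j a : 0 < j < M.-1 -> 0 < a <= m ->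
  R (P a (3 * (M - j)).+1) (P 1 (3 * (M - j)).+2).
Proof.
rewrite {1}/m => jM aj; apply: R_trans (@row a m _ _ _ _ _) _; try by side.
by rewrite -PS; apply: (@st1 _ _); side.
Qed.

Lemma rowB5 j a : 1 < j <= M -> 0 < a <= m -> (j == 2) ==> (1 < a) ->
  R (P a (3 * (M - j)).+2) (P 1 (3 * (M - j.-1))).
Proof.
rewrite {1}/m => jM aj j2; apply: R_trans (@row a m _ _ _ _ _) _; try by side.
rewrite -PS (_ : 3 * (M - j.-1) = (3 * (M - j)).+3); last by lia.
by apply: (@st1 _ _); side.
Qed.

Lemma row_zeroB1 a : 0 < a <= M -> R (P a 0) (nodeB 2 1).
Proof.
move=> aM; apply: R_trans (@row a M _ _ _ _ _) _; try by side.
rewrite /nodeB (_ : 3 * (M - 1) = 0 + (m - 3)); last by side.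
by rewrite add1n; apply: (@st2 _ _); side.
Qed.

Lemma row_zeroB2 a : M < a <= 2 * M -> R (P a 0) (nodeB 3 1).
Proof.
move=> aM; apply: R_trans (@row a (2 * M) _ _ _ _ _) _; try by side.
rewrite /nodeB (_ : 3 * (M - 1) = 0 + (m - 3)); last by side.
by rewrite add1n; apply: (@st2 _ _); side.
Qed.

Lemma row_zeroB3 a : 2 * M < a <= m -> R (P a 0) (nodeB 2 1).
Proof.
rewrite /m => aM; apply: R_trans (@row a m _ _ _ _ _) _; try by side.
apply: (@R_trans _ (P 1 0)); last by apply: row_zeroB1; lia.
by rewrite -PS; apply: (@st0 _ _); side.
Qed.

(** In the top row the exceptional point in the column [a = m] is of the second
    kind and leads back down. *)
Lemma row_topB a : 0 < a <= m -> R (P a m.-1) (P 2 (m - 4)).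
Proof.
rewrite {1}/m => am; apply: R_trans (@row a m _ _ _ _ _) _; try by side.
rewrite -PSS (_ : m - 4 = m.-1 - 3); last by side.
by apply: down; side.
Qed.

Lemma row_oneB a : 0 < a <= m -> R (P a 1) (P 1 2).
Proof.
rewrite {1}/m => am; apply: R_trans (@row a m _ _ _ _ _) _; try by side.
by rewrite -PS; apply: (@st1 _ _); side.
Qed.

Lemma row_fourB a : 0 < a < m -> R (P a 4) (P 1 2).
Proof.
rewrite {1}/m => am; apply: R_trans (@row a m.-1 _ _ _ _ _) _; try by side.
apply: R_trans _ (@row_oneB 1 _); last by side.
rewrite -PS (_ : m.+1 = m.-1.+2); last by side.
by apply: (@down _ 4); side.
Qed.

Lemma row_threeB a : 2 * M <= a < m -> R (P a 3) (P m 4).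
Proof.
rewrite {1}/m => am; apply: R_trans (@row a m.-1 _ _ _ _ _) _; try by side.
rewrite -[in X in R _ (P X _)](@prednK m); last by side.
by apply: (@st1 m.-1 3); side.
Qed.

Lemma nodeB_next s j : s < 3 -> 0 < j -> j.+1 < M -> R (nodeB s j) (nodeB s.+1 j.+1).
Proof.
rewrite /nodeB => s3 j0 jM; case: s s3 => [|[|[|//]]] _.
- by apply: rowB0; lia.
- by rewrite -addSn addSn; apply: rowB1; lia.
by apply: rowB2; lia.
Qed.

Lemma nodeB_back j : 2 < j -> j.+1 < M -> R (nodeB 3 j) (nodeB 0 j.-1).
Proof.
move=> j2 jM; apply: R_trans (@rowB3 j _ _ _) _; try by side.
by apply: R_trans (@rowB4 j _ _ _) (@rowB5 j _ _ _ _); side.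
Qed.

Lemma nodeB_back2 : 3 < M -> R (nodeB 3 2) (nodeB 1 1).
Proof.
move=> M3; apply: R_trans (@rowB3 2 _ _ _) _; try by side.
apply: R_trans (@rowB4 2 _ _ _) _; try by side.
rewrite /nodeB (_ : 3 * (M - 1) = (3 * (M - 2)).+3); last by side.
by apply: (@st1 _ _); side.
Qed.

Lemma nodeB_back1 : 3 < M -> R (nodeB 3 1) (nodeB 0 1).
Proof.
move=> M3; apply: R_trans (@rowB3 1 _ _ _) _; try by side.
apply: R_trans (@rowB4 1 _ _ _) _; try by side.
rewrite (_ : (3 * (M - 1)).+2 = m.-1); last by side.
apply: R_trans (row_topB _) _; first by side.
rewrite (_ : m - 4 = (3 * (M - 2)).+2); last by side.
by apply: (@rowB5 2); side.
Qed.

Lemma nodeB_last3 : 3 < M -> R (nodeB 3 M.-1) (nodeB 0 M.-1).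
Proof.
move=> M3; apply: R_trans (@rowB3 M.-1 _ _ _) _; try by side.
rewrite (_ : (3 * (M - M.-1)).+1 = 4); last by side.
apply: R_trans (row_fourB _) _; first by side.
have := @rowB5 M 1; rewrite subnn /nodeB; apply; side.
Qed.

Lemma nodeB_last2 : 3 < M -> R (nodeB 2 M.-1) (nodeB 0 M.-2).
Proof.
move=> M3; rewrite /nodeB (_ : 3 * (M - M.-1) = 3); last by lia.
apply: R_trans (row_threeB _) _; first by side.
have s : R (P m 4) (P 1 5) by rewrite -PS; apply: (@st1 _ _); side.
apply: R_trans s _.
have := @rowB5 M.-1 1; rewrite (_ : 3 * (M - M.-1) = 3); last by lia.
by apply; side.
Qed.

Lemma nodeB_last0 : R (nodeB 0 M.-1) (nodeB 3 1).
Proof.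
apply: R_trans (@rowB0 M.-1 1 _ _) _; try by lia.
rewrite prednK ?subnn; last by lia.
by apply: row_zeroB2; lia.
Qed.

Lemma nodeB_last1 : R (nodeB 1 M.-1) (nodeB 2 1).
Proof.
apply: R_trans (@rowB1 M.-1 _ _ _) _; try by lia.
rewrite prednK ?subnn; last by lia.
by apply: row_zeroB3; side.
Qed.

(** Segment 0 of row j leads to segment 3 of row j + 3 and from there back to
    segment 0 of row j + 2. So rows of equal parity are linked, and since M is
    even, passages near the last rows and across the row 0 link both
    parities. *)
Lemma nodeB_all s j : 3 < M -> s < 4 -> 0 < j < M -> R (nodeB s j) (nodeB 0 1).
Proof.
move=> M3 s4 jM.
have b3 : R (nodeB 0 M.-1) (nodeB 0 1).
  exact: R_trans nodeB_last0 (nodeB_back1 M3).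
have up i : 0 < i -> i + 3 < M -> R (nodeB 0 i) (nodeB 3 (i + 3)).
  move=> i0 iM; apply: R_trans (@nodeB_next 0 i _ _ _) _; try by lia.
  apply: R_trans (@nodeB_next 1 i.+1 _ _ _) _; try by lia.
  by rewrite addn3; apply: nodeB_next; lia.
have two i : 0 < i -> i + 4 < M -> R (nodeB 0 i) (nodeB 0 i.+2).
  move=> i0 iM; apply: R_trans (up i _ _) _; try by lia.
  by rewrite addn3; apply: nodeB_back; lia.
have odds n : n.*2 + 2 < M -> R (nodeB 0 n.*2.+1) (nodeB 0 1).
  elim: n => // n IHn nM; apply: R_trans (R_sym (two n.*2.+1 _ _)) (IHn _); lia.
have M2 : R (nodeB 0 M.-2) (nodeB 0 1).
  apply: R_trans _ (odds (M - 4)./2 _); last by lia.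
  rewrite (_ : ((M - 4)./2).*2.+1 = M - 3); last by lia.
  apply: R_sym; apply: R_trans (@nodeB_next 0 (M - 3) _ _ _) _; try by lia.
  apply: R_trans (@nodeB_next 1 _ _ _ _) _; try by lia.
  rewrite (_ : (M - 3).+2 = M.-1); last by lia.
  exact: nodeB_last2.
have evens n : n.*2.+2 < M -> R (nodeB 0 (M - n.*2.+2)) (nodeB 0 1).
  elim: n => [|n IHn] nM; first by rewrite subn2.
  have [n0|n0] := eqVneq n 0.
    rewrite n0; apply: R_trans (up _ _ _) _; try by lia.
    rewrite (_ : M - 4 + 3 = M.-1); last by lia.
    exact: R_trans (nodeB_last3 M3) b3.
  apply: R_trans (two _ _ _) _; try by lia.
  by rewrite (_ : (M - _).+2 = M - n.*2.+2); [apply: IHn; lia | lia].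
have r0 i : 0 < i < M -> R (nodeB 0 i) (nodeB 0 1).
  move=> iM; have [->|i1] := eqVneq i M.-1; first exact: b3.
  have [oi|ei] := boolP (odd i).
    by rewrite (_ : i = i./2.*2.+1); [apply: odds; lia | lia].
  rewrite (_ : i = M - ((M - i).-2./2).*2.+2); last by lia.
  by apply: evens; lia.
have r3' i : 2 < i < M -> R (nodeB 3 i) (nodeB 0 1).
  move=> iM; have [->|i1] := eqVneq i M.-1; first exact: R_trans (nodeB_last3 M3) b3.
  by apply: R_trans (nodeB_back _ _) (r0 _ _); lia.
have r3 i : 0 < i < M -> R (nodeB 3 i) (nodeB 0 1).
  case: i => [|[|[|i]]] // iM; first exact: nodeB_back1.
    apply: R_trans (nodeB_back2 M3) _; apply: R_trans (@nodeB_next 1 1 _ _ _) _ => //; try by lia.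
    by apply: R_trans (@nodeB_next 2 2 _ _ _) (r3' 3 _) => //; lia.
  by apply: r3'; lia.
have r2 i : 0 < i < M -> R (nodeB 2 i) (nodeB 0 1).
  move=> iM; have [->|i1] := eqVneq i M.-1.
    by apply: R_trans (nodeB_last2 M3) (r0 _ _); lia.
  by apply: R_trans (@nodeB_next 2 i _ _ _) (r3 _ _); lia.
have r1 i : 0 < i < M -> R (nodeB 1 i) (nodeB 0 1).
  move=> iM; have [->|i1] := eqVneq i M.-1.
    by apply: R_trans nodeB_last1 (r2 _ _); lia.
  by apply: R_trans (@nodeB_next 1 i _ _ _) (r2 _ _); lia.
by case: s s4 => [|[|[|[|//]]]] _; [apply: r0 | apply: r1 | apply: r2 | apply: r3].
Qed.

Lemma rowsB_large a b : 3 < M -> 0 < a <= m -> b < m -> R (P a b) (nodeB 0 1).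
Proof.
move=> M3 am bm; have N s j := @nodeB_all s j M3.
have r13 : R (P 1 2) (nodeB 0 1).
  apply: (@R_trans _ (nodeB 0 M.-1)); last by apply: N; lia.
  by have := @rowB5 M 1; rewrite subnn /nodeB; apply; side.
have rE j a' : 0 < j < M -> 0 < a' <= m -> R (P a' (3 * (M - j))) (nodeB 0 1).
  rewrite {1}/m => jM am'; have [aj|ja] := leqP a' j.
    apply: R_trans (@rowB0 j a' _ _) _; try by lia.
    by apply: R_trans (R_sym (@rowB0 j 1 _ _)) (N 0 j _ _); lia.
  have [aj|ja'] := leqP a' (j + M).
    apply: R_trans (@rowB1 j a' _ _) _; try by lia.
    by apply: R_trans (R_sym (@rowB1 j j.+1 _ _)) (N 1 j _ _); lia.
  have [aj|ja''] := leqP a' (j + 2 * M).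
    have [jM1|jM1] := eqVneq j M.-1.
      apply: (@R_trans _ (nodeB 2 j)); last by apply: N; lia.
      rewrite /nodeB (_ : 3 * (M - j) = 3); last by lia.
      by apply: R_trans (row_threeB _) (R_sym (row_threeB _)); side.
    apply: R_trans (@rowB2 j a' _ _) _; try by lia.
    by apply: R_trans (R_sym (@rowB2 j (j + M).+1 _ _)) (N 2 j _ _); lia.
  apply: R_trans (@rowB3 j a' _ _) _; try by side.
  by apply: R_trans (R_sym (@rowB3 j (j + 2 * M).+1 _ _)) (N 3 j _ _); side.
have r2 j a' : 1 < j <= M -> 0 < a' <= m -> R (P a' (3 * (M - j)).+2) (nodeB 0 1).
  move=> jM am'; have [/andP[/eqP j2 /eqP ->]|g] := boolP ((j == 2) && (a' == 1)).
    apply: (@R_trans _ (nodeB 1 1)); last by apply: N; lia.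
    rewrite j2 /nodeB (_ : 3 * (M - 1) = (3 * (M - 2)).+3); last by lia.
    by apply: (@st1 _ _); side.
  apply: R_trans (@rowB5 j a' _ _ _) (N 0 j.-1 _ _); lia.
have r2' j a' : 0 < j <= M -> 0 < a' <= m -> R (P a' (3 * (M - j)).+2) (nodeB 0 1).
  move=> jM am'; have [j1|j1] := eqVneq j 1; last by apply: r2; lia.
  rewrite j1 (_ : (3 * (M - 1)).+2 = m.-1); last by side.
  apply: R_trans (row_topB am') _.
  by rewrite (_ : m - 4 = (3 * (M - 2)).+2); [apply: r2; side | side].
have r1 j a' : 0 < j <= M -> 0 < a' <= m -> R (P a' (3 * (M - j)).+1) (nodeB 0 1).
  move=> jM am'; have [jM0|jM0] := eqVneq j M.
    by rewrite jM0 subnn; apply: R_trans (row_oneB am') r13.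
  have [jM1|jM1] := eqVneq j M.-1.
    rewrite (_ : (3 * (M - j)).+1 = 4); last by lia.
    have [->|am1] := eqVneq a' m; last by apply: R_trans (row_fourB _) r13; lia.
    apply: (@R_trans _ (nodeB 2 M.-1)); last by apply: N; lia.
    rewrite /nodeB (_ : 3 * (M - M.-1) = 3); last by lia.
    by apply: R_sym; apply: row_threeB; side.
  by apply: R_trans (@rowB4 j a' _ _) (r2' j 1 _ _); side.
have bE : b = 3 * (b %/ 3) + b %% 3 by lia.
have jE : M - (M - b %/ 3) = b %/ 3 by move: bm; side.
have jM : 0 < M - b %/ 3 <= M by move: bm; side.
have := ltn_pmod b (isT : 0 < 3); move: (b %% 3) bE => [|[|[|//]]] bE _.
- have [b0|b0] := eqVneq (b %/ 3) 0.
    rewrite bE b0 /=; have [aM|aM] := leqP a M.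
      by apply: R_trans (row_zeroB1 _) (N 2 1 _ _); lia.
    have [aM'|aM'] := leqP a (2 * M).
      by apply: R_trans (row_zeroB2 _) (N 3 1 _ _); lia.
    by apply: R_trans (row_zeroB3 _) (N 2 1 _ _); move: am; side.
  by rewrite bE addn0 -jE; apply: rE; lia.
- by rewrite bE addn1 -jE; apply: r1; lia.
by rewrite bE addn2 -jE; apply: r2'; lia.
Qed.

(** For m = 6 several of the passages used above degenerate, and all 36 points
    are visited by computation. *)
Lemma rowsB_six a b : M = 2 -> 0 < a <= m -> b < m -> R (P a b) (nodeB 0 1).
Proof.
move=> M2 am bm; have m6 : m = 6 by rewrite /m M2.
pose norm a b : nat * nat := (if 6 < a then a - 6 else a, if b < 6 then b else b - 6).
pose nx (ab : nat * nat) := let: (a, b) := ab in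
  if shearB2 6 a b then norm a.+2 (b + 3)
  else if shearB1 6 a b then norm a.+1 b.+1 else norm a.+1 b.
have Pn a' b' : P (norm a' b').1 (norm a' b').2 = P a' b'.
  rewrite /norm /=; have -> : P (if 6 < a' then a' - 6 else a') (if b' < 6 then b' else b' - 6) =
     P a' (if b' < 6 then b' else b' - 6).
    by case: ifP => // ?; rewrite -P_per1 m6; congr P; lia.
  by case: ifP => // ?; rewrite -P_per2 m6; congr P; lia.
have wn a' b' : 0 < a' <= 12 -> b' < 12 -> 0 < (norm a' b').1 <= 6 /\ (norm a' b').2 < 6.
  by rewrite /norm /= => ? ?; split; case: ifP; lia.
have wf n : 0 < (iter n nx (1, 3)).1 <= 6 /\ (iter n nx (1, 3)).2 < 6.
  elim: n => //= n; case: (iter n nx (1, 3)) => a' b' /= [a'6 b'6].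
  by do 2?[case: ifP => _]; apply: wn; lia.
have Rn n : R (nodeB 0 1) (P (iter n nx (1, 3)).1 (iter n nx (1, 3)).2).
  elim: n => [|n IHn] /=; first by rewrite /nodeB M2.
  apply: R_trans IHn _; have := wf n; case: (iter n nx (1, 3)) => a' b' [a'6 b'6].
  have := @stepE a' b'; rewrite m6 => /(_ a'6 b'6); rewrite /nx.
  by case: ifP => _; [|case: ifP => _]; rewrite Pn.
have all6 : all (fun ab => ab \in traject nx (1, 3) 36)
    [seq (a, b) | a <- iota 1 6, b <- iota 0 6] by vm_compute.
have /trajectP[n _ E] : (a, b) \in traject nx (1, 3) 36.
  apply: (allP all6); apply: allpairs_f; rewrite mem_iota; [move: am | move: bm];
    by rewrite m6; lia.
by apply: R_sym; have := Rn n; rewrite -E.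
Qed.

Theorem rowsB a b : 0 < a <= m -> b < m -> R (P a b) (nodeB 0 1).
Proof.
have [M3|M3] := ltnP 3 M; first exact: rowsB_large.
by apply: rowsB_six; move: M_gt1 M_even M3; case: (M) => [|[|[|[|n]]]].
Qed.

End RowsB.

Local Open Scope ring_scope.

(** * The return map of H to height one *)

Section HCycles.
Variable m : nat.
Hypothesis m_gt3 : (3 < m)%N.
Let m_gt1 : (1 < m)%N. Proof. by lia. Qed.
Implicit Types (q : 'Z_m * 'Z_m) (e c i : 'I_3).

(** The plane coordinates are (y, w - 3), the arguments of sigma* at height
    one. *)
Definition vq (h : 'Z_m) q : vertex m 3 := vert h (q.2 + 3%:R) q.1.
Definition plane_step i : 'Z_m * 'Z_m := ((i == e_y)%:R, (i == e_w)%:R).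
Local Notation pi := (tperm (1 : 'I_3) (2 : 'I_3)).

Lemma vqK v : exists h q, v = vq h q.
Proof.
exists (hgt v), (yc v, wc v - 3%:R); rewrite /vq /= subrK.
by rewrite vertK.
Qed.

Lemma vq_inj h h' q q' : vq h q = vq h' q' -> h = h' /\ q = q'.
Proof. by case: q q' => a b [a' b'] /vert_inj[-> /addIr /= -> ->]. Qed.

Lemma H_dir_vq h q c : H_dir (vq h q) c =
  if val h == 1%N then sigma_star q (pi c) else pi c + (s_exp m (val h))%:R.
Proof.
rewrite /H_dir /sigma height_vert yc_vert wc_vert addrK -surjective_pairing.
by [].
Qed.

Lemma H_step h q c : H_map c (vq h q) = vq (h + 1) (q + plane_step (H_dir (vq h q) c)).
Proof.
rewrite /H_map {1}/vq vert_step; congr vert.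
by rewrite -[RHS]/(q.2 + _ + 3%:R) addrAC.
Qed.

(** At the heights 2, ..., m - 1, 0 the direction of a colour does not depend
    on the vertex. *)
Definition drift e : 'Z_m * 'Z_m :=
  \sum_(i < m.-1) plane_step (e + (s_exp m ((2 + i) %% m))%:R).
Definition section_step e q : 'Z_m * 'Z_m := q + plane_step (sigma_star q e).
(** The return map to height one, see [return_H]: a step governed by sigma*,
    then the drift. *)
Definition section_map e q : 'Z_m * 'Z_m := section_step e q + drift e.

Lemma iter_H_vq n q c : (n < m)%N ->
  iter n (H_map c) (vq 2%:R q) =
  vq (2 + n)%:R (q + \sum_(i < n) plane_step (pi c + (s_exp m ((2 + i) %% m))%:R)).
Proof.
elim: n => [|n IHn] nm; first by rewrite big_ord0 addr0 addn0.
rewrite iterS IHn; last by lia.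
rewrite H_step H_dir_vq [val _]val_Zp_nat // big_ord_recr /= addrA ifF.
  by rewrite natr1 addnS.
apply/negbTE; have [h|h] := ltnP (2 + n) m; first by rewrite modn_small.
by rewrite (_ : (2 + n)%N = m) ?modnn; [|lia].
Qed.

Lemma return_H q c : iter m (H_map c) (vq 1 q) = vq 1 (section_map (pi c) q).
Proof.
have -> : iter m (H_map c) (vq 1 q) = iter m.-1.+1 (H_map c) (vq 1 q).
  by congr iter; lia.
rewrite iterSr H_step H_dir_vq (_ : val (1 : 'Z_m) = 1%N); last first.
  by rewrite -[1]/(1%:R) val_Zm.
rewrite -[1 + 1]/(2%:R) iter_H_vq; last by lia.
rewrite /section_map /section_step /drift (_ : (2 + m.-1)%N = (m + 1)%N); last by lia.
by rewrite natrD natr_m0 // add0r.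
Qed.

Lemma plane_step_succ i : plane_step (i + 1) = R_map (plane_step i) + (1, 0).
Proof.
by elim/I3_ind: i; rewrite /plane_step /R_map -[_ + (1, 0)]/(_ + 1, _ + 0) /=; congr (_, _); ring.
Qed.

Lemma section_step_R e q : section_step (e + 1) (R_map q) = R_map (section_step e q) + (1, 0).
Proof. by rewrite /section_step sigma_star_R // plane_step_succ R_mapD addrA. Qed.

(** The term (1, 0) of [plane_step_succ] occurs m - 1 times here and once more
    in [section_step_R], so it disappears from the return map. *)
Lemma drift_succ e : drift (e + 1) = R_map (drift e) - (1, 0).
Proof.
have m1 : (1, 0) *+ m.-1 = - (1, 0) :> 'Z_m * 'Z_m.
  apply/eqP; rewrite -addr_eq0 -mulrSr prednK; last by lia.
  have mulE n : (1, 0) *+ n = (n%:R, 0) :> 'Z_m * 'Z_m.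
    by elim: n => [|n IHn] //; rewrite mulrSr IHn -natr1 -[LHS]/(_ + _, _ + _) addr0.
  by rewrite mulE natr_m0.
have R0 : @R_map m 0 = 0 by rewrite /R_map -[RHS]/(0, 0); congr (_, _) => /=; ring.
rewrite /drift (big_morph _ (@R_mapD m) R0) -m1.
rewrite -[X in _ *+ X]card_ord -sumr_const -big_split /=.
by apply: eq_bigr => i _; rewrite -plane_step_succ addrAC.
Qed.

Lemma section_map_R e q : section_map (e + 1) (R_map q) = R_map (section_map e q).
Proof. by rewrite /section_map section_step_R drift_succ R_mapD addrACA subrr addr0. Qed.

Lemma I3_R (Q : 'I_3 -> Prop) : Q 0 -> (forall e, Q e -> Q (e + 1)) -> forall e, Q e.
Proof.
move=> Q0 QS; apply: I3_ind => //; first by rewrite (_ : e_y = 0 + 1); [apply: QS | apply: val_inj].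
by rewrite (_ : e_w = 0 + 1 + 1); [apply/QS/QS | apply: val_inj].
Qed.

Lemma R_surj q : exists q', q = R_map q'.
Proof. by exists (R_map (R_map q)); rewrite R_map3. Qed.

(** For e = 0 the exceptional points are permuted cyclically: up the line (0,
    b) to (0, -1), over (1, -1) to (1, 0), along (a, 0) to (-1, 0), and over
    (-1, 1) back to (0, 1). Giving preimages is shorter than comparing
    images. *)
Lemma section_step_inj e : injective (section_step e).
Proof.
elim/I3_R: e => [|e IHe]; last first.
  move=> q q'; have [{}q ->] := R_surj q; have [{}q' ->] := R_surj q'.
  by rewrite !section_step_R => /addIr/(@R_map_inj m)/IHe ->.
suff surj q : exists q', section_step 0 q' = q.
  have [g gK] := fin_all_exists surj.
  by apply: can_inj; apply: canF_sym gK.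
have one0 : (1 == 0 :> 'Z_m) = false by exact: oner_eq0.
have None0 : (-1 == 0 :> 'Z_m) = false by rewrite oppr_eq0.
have oneN : (1 == -1 :> 'Z_m) = false.
  by rewrite -subr_eq0 opprK -(natrD _ 1 1) Zp_nat_eq0 // gtnNdvd //; lia.
have tE a b : section_step 0 (a, b) =
    if exceptional2 (a, b) then (a + 1, b) else if exceptional1 (a, b) then (a, b + 1) else (a, b).
  rewrite /section_step sigma_star0 // -[_ + _]/(_ + _, _ + _) /=.
  by case: ifP => _; [|case: ifP => _]; rewrite /= ?addr0.
case: q => a b; have [->|a0] := eqVneq a 0.
  have [->|b0] := eqVneq b 0.
    exists (0, 0); rewrite tE /exceptional2 /exceptional1 !xpair_eqE /=.
    by rewrite ![0 == _]eq_sym None0 one0 !eqxx.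
  have [->|b1] := eqVneq b 1.
    exists (-1, 1); rewrite tE /exceptional2 !xpair_eqE /= !eqxx /=.
    by congr (_, _); ring.
  exists (0, b - 1); rewrite tE /exceptional2 /exceptional1 !xpair_eqE /=.
  rewrite ![0 == _]eq_sym None0 /= andbF.
  have -> : (b - 1 == -1) = false by rewrite -subr_eq0 opprK subrK (negPf b0).
  by rewrite subr_eq0 b1 /= subrK.
have [->|b0] := eqVneq b 0.
  have [->|a1] := eqVneq a 1.
    exists (1, -1); rewrite tE /exceptional2 /exceptional1 !xpair_eqE /=.
    by rewrite ?one0 ?None0 ?oneN ?eqxx /=; congr (_, _); ring.
  exists (a - 1, 0); rewrite tE /exceptional2 !xpair_eqE /=.
  have -> : (a - 1 == -1) = false by rewrite -subr_eq0 opprK subrK (negPf a0).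
  by rewrite subr_eq0 a1 ?eqxx /= !orbT subrK.
have [/andP[/eqP-> /eqP->]|g1] := boolP ((a == 1) && (b == -1)).
  exists (0, -1); rewrite tE /exceptional2 !xpair_eqE /= ?eqxx orbT.
  by rewrite add0r.
have [/andP[/eqP-> /eqP->]|g2] := boolP ((a == -1) && (b == 1)).
  exists (-1, 0); rewrite tE /exceptional2 /exceptional1 !xpair_eqE /=.
  rewrite ![0 == _]eq_sym ?None0 ?one0 ?eqxx /= !andbF /=.
  by rewrite ?orbT /= add0r.
exists (a, b); rewrite tE /exceptional2 /exceptional1 !xpair_eqE /=.
by rewrite (negPf a0) (negPf b0) (negPf g1) (negPf g2) /= andbF.
Qed.

Lemma section_map_inj e : injective (section_map e).
Proof. by move=> q q' /addIr/section_step_inj. Qed.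

Lemma H_inj c : injective (@H_map m c).
Proof.
move=> v v'; have [h [q ->]] := vqK v; have [h' [q' ->]] := vqK v'.
rewrite !H_step !H_dir_vq => /vq_inj[/addIr <-].
by case: ifP => _ => [/section_step_inj ->|/addIr ->].
Qed.

Lemma sum_indicator (n c : nat) : \sum_(i < n) ((val i == c)%:R : 'Z_m) = (c < n)%N%:R.
Proof.
have [cn|nc] := ltnP c n.
  rewrite (bigD1 (Ordinal cn)) //= eqxx big1 ?addr0 // => i ic.
  by case: eqP => // E; case/eqP: ic; apply: val_inj.
rewrite big1 // => i _; case: eqP => // E.
by have := leq_trans (ltn_ord i) nc; rewrite -E ltnn.
Qed.

Lemma sum_pair (n : nat) (f g : 'I_n -> 'Z_m) :
  \sum_(i < n) (f i, g i) = (\sum_(i < n) f i, \sum_(i < n) g i).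
Proof. by elim/big_rec3: _ => // i x y z _ ->. Qed.

Lemma plane_stepE i : plane_step i = ((i == e_y)%:R, (i == e_w)%:R). Proof. by []. Qed.

Lemma drift0 : drift 0 = if (3 %| m)%N then (1, 3%:R) else (1, - 2%:R).
Proof.
rewrite /drift; case: ifP => m3.
  pose f (i : 'I_m.-1) : 'Z_m * 'Z_m := ((val i == 0%N)%:R,
    (val i == 1%N)%:R + (val i == 2%N)%:R + (val i == m - 2)%N%:R).
  rewrite (eq_bigr f) => [|i _].
    have lt (c : nat) : (c < 3)%N || (c == m - 2)%N -> (c < m.-1)%N by lia.
    by rewrite sum_pair !big_split /= !sum_indicator !lt ?eqxx ?orbT // -!natrD.
  have im : (i < m.-1)%N := ltn_ord i.
  rewrite add0r /s_exp m3 /f /= plane_stepE.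
  have [im2|im2] := eqVneq (val i) (m - 2)%N.
    rewrite (_ : (2 + i)%N = m) ?modnn /=; last by move: im2; rewrite /=; lia.
    have ne (c : nat) : (c < 3)%N -> ((m - 2)%N == c) = false by lia.
    have im2' : nat_of_ord i = (m - 2)%N := im2.
    by rewrite im2' !ne // !add0r.
  rewrite modn_small; last by move: im2; rewrite /=; lia.
  case: (nat_of_ord i) im2 im => [|[|[|n]]] // _ _; rewrite /= ?addr0 ?add0r //.
pose f (i : 'I_m.-1) : 'Z_m * 'Z_m := ((val i == 0%N)%:R, 1 - (val i == 0%N)%:R).
rewrite (eq_bigr f) => [|i _].
  rewrite sum_pair big_split /= sumrN sumr_const card_ord !sum_indicator.
  rewrite (_ : (0 < m.-1)%N = true); last by lia.
  rewrite (_ : m.-1 = m - 1)%N; last by lia.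
  by rewrite natrB ?natr_m0 -?[true%:R]/(1%:R); [congr (_, _); ring | lia | lia].
have im : (i < m.-1)%N := ltn_ord i.
rewrite add0r /s_exp m3 /f /= plane_stepE.
have [im2|im2] := eqVneq (val i) (m - 2)%N.
  rewrite (_ : (2 + i)%N = m) ?modnn /=; last by move: im2; rewrite /=; lia.
  by rewrite (_ : (nat_of_ord i == 0%N) = false) ?subr0 //; move: im2; rewrite /=; lia.
rewrite modn_small; last by move: im2; rewrite /=; lia.
by case: (nat_of_ord i) im2 im => [|n] // _ _; rewrite /= ?subrr ?subr0.
Qed.

End HCycles.

(** * The maps H are single cycles *)

Lemma fconnect_iter_fun (T : finType) (f : T -> T) n x y :
  fconnect (iter n f) x y -> fconnect f x y.
Proof. by move/iter_findex <-; rewrite -iterM; apply: fconnect_iter. Qed.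

Section HConnect.
Variable m : nat.
Hypothesis m_gt3 : (3 < m)%N.
Let m_gt1 : (1 < m)%N. Proof. by lia. Qed.
Implicit Types (q : 'Z_m * 'Z_m) (e c i : 'I_3).

Lemma eqZ (x y : nat) : (x < 5 * m)%N -> (y < 5 * m)%N ->
  (x%:R == y%:R :> 'Z_m) =
  [|| x == y, x == y + m, x == y + 2 * m, x == y + 3 * m, x == y + 4 * m,
      y == x + m, y == x + 2 * m, y == x + 3 * m | y == x + 4 * m]%N.
Proof.
have main (a b : nat) : (a < 5 * m)%N -> (b <= a)%N -> (a%:R == b%:R :> 'Z_m) =
    [|| a == b, a == b + m, a == b + 2 * m, a == b + 3 * m | a == b + 4 * m]%N.
  move=> a5 ba; rewrite Zp_nat_eq // eqn_mod_dvd //.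
  apply/dvdnP/idP=> [[j jE]|].
    have -> : a = (b + j * m)%N by rewrite -jE subnKC.
    have : (j < 5)%N by rewrite -(ltn_pmul2r (ltnW m_gt1)) -jE; lia.
    by case: j {jE} => [|[|[|[|[|//]]]]] _; rewrite ?mul0n ?mul1n ?addn0 ?eqxx ?orbT.
  have mulE j : a = (b + j * m)%N -> exists k, (a - b = k * m)%N.
    by move=> ->; exists j; rewrite addKn.
  by case/or4P=> [||| /orP[]] /eqP E; [apply: (mulE 0%N) | apply: (mulE 1%N) | apply: (mulE 2%N)
    | apply: (mulE 3%N) | apply: (mulE 4%N)]; rewrite E ?addn0 ?mul1n.
move=> x5 y5; have [yx|/ltnW xy] := leqP y x.
  rewrite main //; move: m_gt1 yx; lia.
by rewrite eq_sym main //; move: m_gt1 xy; lia.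
Qed.

Lemma sym_section x y : fconnect (section_map (m := m) 0) x y -> fconnect (section_map 0) y x.
Proof. by rewrite (fconnect_sym (@section_map_inj m m_gt3 0)). Qed.

(** In these coordinates the drift (1, -2) adds 1 to a. *)
Definition ptA (a b : nat) : 'Z_m * 'Z_m := (a%:R, b%:R - (2 * a)%:R).
(** In these coordinates the drift (1, 3) adds 1 to a. *)
Definition ptB (a b : nat) : 'Z_m * 'Z_m := (a%:R, (b + 3 * a)%:R).

Lemma eqZ0 (x : nat) : (x < 5 * m)%N ->
  (x%:R == 0 :> 'Z_m) = [|| x == 0, x == m, x == 2 * m, x == 3 * m | x == 4 * m]%N.
Proof. by move=> x5; rewrite (@eqZ x 0) //; move: m_gt1 x5; lia. Qed.

Lemma eqZ1 (x : nat) : (x < 5 * m)%N -> (x%:R == 1 :> 'Z_m) =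
  [|| x == 1, x == m.+1, x == (2 * m).+1, x == (3 * m).+1 | x == (4 * m).+1]%N.
Proof. by move=> x5; rewrite (@eqZ x 1) //; move: m_gt1 x5; lia. Qed.

Lemma eqZN (x : nat) : (x.+1 < 5 * m)%N -> (x%:R == -1 :> 'Z_m) =
  [|| x.+1 == m, x.+1 == 2 * m, x.+1 == 3 * m | x.+1 == 4 * m]%N.
Proof. by move=> x5; rewrite -subr_eq0 opprK natr1 eqZ0. Qed.

Lemma eqZ2 (x y : nat) : (x <= m)%N -> (y <= (2 * m).+1)%N ->
  (x%:R == y%:R :> 'Z_m) = [|| x == y + m, x == y, y == x + m | y == x + 2 * m]%N.
Proof. by move=> x5 y5; rewrite eqZ; move: m_gt3 x5 y5; lia. Qed.

Lemma column_eq (a : nat) : (0 < a <= m)%N ->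
  [/\ (a%:R == 0 :> 'Z_m) = (a == m), (a%:R == 1 :> 'Z_m) = (a == 1%N)
    & (a%:R == -1 :> 'Z_m) = (a.+1 == m)].
Proof.
move=> am; have -> : -1 = (m.-1)%:R :> 'Z_m.
  by apply/eqP; rewrite eq_sym -subr_eq0 opprK natr1 prednK ?natr_m0 //; move: am; lia.
by split; [rewrite (@eqZ2 a 0) | rewrite (@eqZ2 a 1) | rewrite eqZ2];
  move: am m_gt3; clear; lia.
Qed.

Lemma exceptionalA a b : (0 < a <= m)%N -> (b < m)%N ->
  exceptional1 (ptA a b) = shearA1 m a b /\ exceptional2 (ptA a b) = shearA2 m a b.
Proof.
move=> am bm; have am2 : (2 * a <= 2 * m)%N by move: am; lia.
have [c0 c1 cN] := column_eq am.
rewrite /exceptional1 /exceptional2 /ptA !xpair_eqE -[(_, _).1]/(a%:R).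
rewrite -[(_, _).2]/(b%:R - (2 * a)%:R) c0 c1 cN {c0 c1 cN}.
have -> : (b%:R - (2 * a)%:R == -1 :> 'Z_m) = (b.+1%:R == (2 * a)%:R :> 'Z_m).
  by rewrite subr_eq addrC -subr_eq opprK natr1.
rewrite subr_eq0 [b%:R - _ == 1]subr_eq addrC natr1 !eqZ2 //; try by move: am bm; lia.
have [aE|a_m] := eqVneq a m; first by rewrite aE /shearA1 /shearA2; split; move: bm m_gt3;
  clear; lia.
have [aE|a_1] := eqVneq a 1%N; first by rewrite aE /shearA1 /shearA2; split; move: bm m_gt3;
  clear; lia.
have [aE|a_N] := eqVneq a.+1 m; rewrite /shearA1 /shearA2 ?(negPf a_m) ?(negPf a_1) ?(negPf a_N).
  by rewrite aE eqxx /=; split; move: am bm m_gt3 aE; clear; lia.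
by rewrite /= ?orbF ?andbT; split=> //; move: am bm a_m a_1 a_N m_gt3; clear; lia.
Qed.

Lemma exceptionalB a b : (4 < m)%N -> (0 < a <= m)%N -> (b < m)%N ->
  exceptional1 (ptB a b) = shearB1 m a b /\ exceptional2 (ptB a b) = shearB2 m a b.
Proof.
move=> m_gt4 am bm; have am3 : (3 * a <= 3 * m)%N by move: am; lia.
have [c0 c1 cN] := column_eq am.
rewrite /exceptional1 /exceptional2 /ptB !xpair_eqE -[(_, _).1]/(a%:R).
rewrite -[(_, _).2]/((b + 3 * a)%:R) c0 c1 cN {c0 c1 cN}.
rewrite !eqZ0 ?eqZ1 ?eqZN; try by move: am3 bm; lia.
have [aE|a_m] := eqVneq a m; first by rewrite aE /shearB1 /shearB2; split; move: bm m_gt4;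
  clear; lia.
have [aE|a_1] := eqVneq a 1%N; first by rewrite aE /shearB1 /shearB2; split; move: bm m_gt4;
  clear; lia.
have [aE|a_N] := eqVneq a.+1 m; rewrite /shearB1 /shearB2 ?(negPf a_m) ?(negPf a_1) ?(negPf a_N).
  by rewrite aE eqxx /=; split; move: am bm m_gt4 aE; clear; lia.
by rewrite /= ?orbF ?andbT; split=> //; move: am bm a_m a_1 a_N m_gt4; clear; lia.
Qed.

Lemma ptA_surj q : exists a b, [/\ (0 < a <= m)%N, (b < m)%N & q = ptA a b].
Proof.
case: q => x y; pose a := if val x == 0%N then m else val x.
have xE : a%:R = x.
  rewrite /a; case: eqP => [E|_]; last exact: natr_Zp.
  by rewrite natr_m0 //; apply: val_inj; rewrite E.
exists a, (val (y + (2 * a)%:R)); split.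
- by have := ltn_Zm x m_gt1; rewrite /a; case: eqP => E; move: E m_gt3; rewrite /=; lia.
- exact: ltn_Zm.
by rewrite /ptA xE natr_Zp addrK.
Qed.

Lemma ptB_surj q : exists a b, [/\ (0 < a <= m)%N, (b < m)%N & q = ptB a b].
Proof.
case: q => x y; pose a := if val x == 0%N then m else val x.
have xE : a%:R = x.
  rewrite /a; case: eqP => [E|_]; last exact: natr_Zp.
  by rewrite natr_m0 //; apply: val_inj; rewrite E.
exists a, (val (y - (3 * a)%:R)); split.
- by have := ltn_Zm x m_gt1; rewrite /a; case: eqP => E; move: E m_gt3; rewrite /=; lia.
- exact: ltn_Zm.
by rewrite /ptB xE natrD natr_Zp subrK.
Qed.

Lemma section_map0 q : section_map 0 q = q + drift m 0 +
  if exceptional2 q then (1, 0) else if exceptional1 q then (0, 1) else 0.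
Proof.
rewrite /section_map /section_step sigma_star0 // addrAC; congr (_ + _).
by case: ifP => _; [|case: ifP => _].
Qed.

Lemma addZZ (a b c d : 'Z_m) : (a, b) + (c, d) = (a + c, b + d). Proof. by []. Qed.

Lemma section_connect0 q q' : ~~ odd m -> fconnect (section_map 0) q q'.
Proof.
move=> m_even; pose R := fconnect (section_map (m := m) 0).
have R_refl x : R x x by exact: connect0.
have R_sym x y : R x y -> R y x by exact: sym_section.
have R_trans x y z : R x y -> R y z -> R x z by exact: connect_trans.
have step x y : section_map 0 x = y -> R x y by move=> <-; exact: fconnect1.
suff [z Rz] : exists z, forall x, R x z by apply: R_trans (Rz q) (R_sym _ _ (Rz q')).
have [m3|m3] := boolP (3 %| m)%N.
  have mE : m = (3 * (m %/ 3))%N by rewrite mulnC divnK.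
  have m_gt4 : (4 < m)%N by move: m_gt3 m3 m_even; lia.
  eexists => x; have [a [b [am bm ->]]] := ptB_surj x.
  apply: (@rowsB (m %/ 3) _ R ptB) => //; rewrite -?mE //; try by move: m_gt4 mE m_even; lia.
  - by move=> a' b'; rewrite /ptB mulnDr addnA !natrD natr_m0 // !addr0.
  - by move=> a' b'; rewrite /ptB !natrD natr_m0 // addr0.
  move=> a' b' am' bm'; apply: step.
  have [e1 e2] := exceptionalB m_gt4 am' bm'.
  rewrite section_map0 e1 e2 drift0 // m3 /ptB addZZ.
  case: ifP => _; [|case: ifP => _]; rewrite ?addr0 ?addZZ; congr (_, _).
  - by rewrite -!natr1; ring.
  - rewrite !natrD natrB ?natr_m0 //; last by move: m_gt3; lia.
    by rewrite !mulnS !natrD; ring.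
  - by rewrite addr0 -natr1.
  - by rewrite !mulnS -!natr1 !natrD; ring.
  - by rewrite -natr1.
  by rewrite !mulnS !natrD; ring.
have mE : m = (2 * (m %/ 2))%N by rewrite mulnC divnK // dvdn2.
eexists => x; have [a [b [am bm ->]]] := ptA_surj x.
apply: (@rowsA (m %/ 2) _ R ptA) => //; rewrite -?mE //; try by move: m_gt3 mE m3; lia.
- by move=> a' b'; rewrite /ptA mulnDr !natrD natr_m0 // !addr0.
- by move=> a' b'; rewrite /ptA !natrD natr_m0 // addr0.
move=> a' b' am' bm'; apply: step.
have [e1 e2] := exceptionalA am' bm'.
rewrite section_map0 e1 e2 drift0 // (negPf m3) /ptA addZZ.
case: ifP => _; [|case: ifP => _]; rewrite ?addr0 ?addZZ; congr (_, _).
- by rewrite -!natr1; ring.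
- by rewrite !mulnS !natrD; ring.
- by rewrite addr0 -natr1.
- by rewrite !mulnS -!natr1 !natrD; ring.
- by rewrite -natr1.
by rewrite !mulnS !natrD; ring.
Qed.

Lemma section_connect e q q' : ~~ odd m -> fconnect (section_map e) q q'.
Proof.
move=> m_even; elim/I3_R: e q q' => [|e IHe] q q'; first exact: section_connect0.
have [{}q ->] := R_surj q; have [{}q' ->] := R_surj q'.
by apply: fconnect_semiconj (IHe q q') => x; apply: section_map_R.
Qed.

(** Every vertex lies on the orbit of a vertex of height one, where the return
    map is connected. *)
Lemma H_connect c v v' : ~~ odd m -> fconnect (@H_map m c) v v'.
Proof.
move=> m_even; have sym := fconnect_sym (@H_inj m m_gt3 c).
have climb n h q : exists q', iter n (H_map c) (vq h q) = vq (h + n%:R) q'.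
  elim: n => [|n [q' IHn]]; first by exists q; rewrite addr0.
  by rewrite iterS IHn H_step; eexists; rewrite -natr1 addrA.
have to1 x : exists q, fconnect (H_map c) x (vq 1 q).
  have [h [q ->]] := vqK x; have [q' E] := climb (val (1 - h)) h q; exists q'.
  have -> : vq 1 q' = iter (val (1 - h)) (H_map c) (vq h q).
    by rewrite E natr_Zp addrC subrK.
  exact: fconnect_iter.
have [q xq] := to1 v; have [q' xq'] := to1 v'.
apply: connect_trans xq _; rewrite sym; apply: connect_trans xq' _; rewrite sym.
apply: (@fconnect_iter_fun _ _ m).
apply: fconnect_semiconj (section_connect (tperm (1 : 'I_3) (2 : 'I_3) c) q q' m_even) => x.
exact: return_H.
Qed.

End HConnect.

(** * The recoloured vertices of the base torus *)

Section Recolouring.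
Variable m : nat.
Hypothesis m_gt3 : (3 < m)%N.
Let m_gt1 : (1 < m)%N. Proof. by lia. Qed.
Implicit Types (v : vertex m 3) (c : 'I_3) (h w y : 'Z_m).

Lemma unit_vec_inj n : injective (@unit_vec m n).
Proof.
move=> i j /rowP/(_ i); rewrite !mxE eqxx /= eqxx /=.
by case: eqP => // _ /eqP; rewrite -(inj_eq val_inj).
Qed.

Lemma recol_dir v c : F_dir v (recol v c) = H_dir v c.
Proof. by have /addrI/unit_vec_inj := recolP v c. Qed.

Lemma recol_id v c : (recol v c == c) = (F_dir v c == H_dir v c).
Proof. by rewrite -recol_dir eq_sym (inj_eq (@F_dir_inj m v)). Qed.

Lemma H_dir_vert h w y c : H_dir (vert h w y) c =
  if val h == 1%N then sigma_star (y, w - 3%:R) (tperm (1 : 'I_3) 2 c)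
  else tperm (1 : 'I_3) 2 c + (s_exp m (val h))%:R.
Proof. by rewrite /H_dir /sigma height_vert yc_vert wc_vert. Qed.

Lemma F_dir_vert h w y c : F_dir (vert h w y) c = fdir (val h) (val w) c.
Proof. by rewrite /F_dir height_vert wc_vert. Qed.

Lemma tperm12 : [/\ tperm (1 : 'I_3) 2 0 = 0, tperm (1 : 'I_3) 2 1 = 2 & tperm (1 : 'I_3) 2 2 = 1].
Proof. by split; [rewrite tpermD | rewrite tpermL | rewrite tpermR]. Qed.

Definition agree h w y := [forall c, F_dir (vert h w y) c == H_dir (vert h w y) c].

Lemma agreeE h w y : agree h w y =
  [&& F_dir (vert h w y) 0 == H_dir (vert h w y) 0,
      F_dir (vert h w y) 1 == H_dir (vert h w y) 1
    & F_dir (vert h w y) 2 == H_dir (vert h w y) 2].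
Proof.
apply/forallP/and3P=> [H|[H0 H1 H2]]; first by split; apply: H.
exact: I3_ind.
Qed.

(** Off height one the rows of F and H depend only on the height and on whether
    w = 0. *)
Lemma agree_off1 h w y : val h != 1%N ->
  agree h w y = (val h == 0%N) || ((val h == 2%N) && (val w == 0%N)).
Proof.
move=> h1; have [t0 t1 t2] := tperm12.
rewrite agreeE !F_dir_vert !H_dir_vert (negPf h1) t0 t1 t2 /fdir /s_exp (negPf h1).
case: (val h) h1 => [|[|[|n]]] //=.
- by case: ifP.
- by case: (val w) => [|n].
move=> _; case: ifP => _; last by [].
by case: ifP.
Qed.

Lemma line_act_id z (t : 'Z_m) :
  [&& 0 == line_act z t 0, 2 == line_act z t 2 & 1 == line_act z t 1] = false.
Proof.
by elim/I3_ind: z; rewrite /line_act; move: (t == 1) (t == -1) => [] [].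
Qed.

Lemma line_act_swap z (t : 'Z_m) :
  [&& 1 == line_act z t 0, 2 == line_act z t 2 & 0 == line_act z t 1] =
  [&& z == e_w, t != 1 & t != -1].
Proof.
by elim/I3_ind: z; rewrite /line_act; move: (t == 1) (t == -1) => [] [].
Qed.

(** For w < 2 the rows agree where sigma* is the identity. Otherwise F
    exchanges 0 and 1, up to the transposition in the definition of H; this is
    tau_2, the value of sigma* on the line (-t, 0) away from t = 1 and t =
    -1. *)
Lemma agree1 w y : agree 1 w y =
  if (val w < 2)%N then (y != 0) && (y != 3%:R - w)
  else (w == 3%:R) && [&& y != 0, y != 1 & y != -1].
Proof.
have [t0 t1 t2] := tperm12; have v1 : val (1 : 'Z_m) = 1%N by rewrite -[1]/(1%:R) val_Zm.
rewrite agreeE !F_dir_vert !H_dir_vert v1 eqxx t0 t1 t2.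
set q := (y, _); have [w2|w2] := ltnP (val w) 2.
  have w3 : w - 3%:R != 0.
    rewrite subr_eq0; apply: contraTneq w2 => ->; rewrite val_Zm //.
  have fE : fdir 1 (val w) =1 row3 e_x e_w e_y.
    by rewrite /fdir; case: (val w) w2 => [|[|n]].
  have [[z [t [tn qE]]]|off] := on_lineP q; last first.
    rewrite !fE !sigma_star_off //=; apply/esym/andP; split.
      by apply: contraNneq (off e_y _ w3) => y0; rewrite -[e_y]/1 line1 // /q y0.
    have w3' : 3%:R - w != 0 by rewrite -opprB oppr_eq0.
    apply: contraNneq (off e_x _ w3') => yE.
    by rewrite -[e_x]/0 line0 opprB /q yE.
  rewrite !fE qE !sigma_star_line // line_act_id.
  move: qE; elim/I3_ind: z; rewrite /q.
  - rewrite -[e_x]/0 line0 => /eqP; rewrite xpair_eqE => /andP[/eqP-> /eqP E].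
    by rewrite -opprB E opprK eqxx andbF.
  - by rewrite -[e_y]/1 line1 // => /eqP; rewrite xpair_eqE => /andP[/eqP-> _]; rewrite eqxx.
  by rewrite -[e_w]/2 line2 // => /eqP; rewrite xpair_eqE (negPf w3) andbF.
have fE : fdir 1 (val w) =1 row3 e_y e_w e_x.
  by rewrite /fdir; case: (val w) w2 => [|[|n]].
have [[z [t [tn qE]]]|off] := on_lineP q; last first.
  rewrite !fE !sigma_star_off //=; apply/esym/negbTE/negP => /andP[/eqP wE /and3P[y0 _ _]].
  have ny : - y != 0 by rewrite oppr_eq0.
  by case/eqP: (off e_w (- y) ny); rewrite -[e_w]/2 line2 // opprK /q wE subrr.
rewrite !fE qE !sigma_star_line // line_act_swap.
move: qE; elim/I3_ind: z; rewrite /q /=.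
- rewrite -[e_x]/0 line0 => /eqP; rewrite xpair_eqE => /andP[/eqP-> /eqP E].
  by rewrite -subr_eq0 E oppr_eq0 (negPf tn).
- by rewrite -[e_y]/1 line1 // => /eqP; rewrite xpair_eqE => /andP[/eqP-> _]; rewrite eqxx andbF.
rewrite -[e_w]/2 line2 // => /eqP; rewrite xpair_eqE subr_eq0 => /andP[/eqP-> ->].
by rewrite oppr_eq0 tn !eqr_oppLR opprK andbC.
Qed.

Lemma sum_delta (T : finType) (x : T) (G : T -> nat) :
  (\sum_z (z == x) * G z = G x)%N.
Proof.
rewrite (bigD1 x) //= eqxx mul1n big1 ?addn0 // => z /negPf ->.
by rewrite mul0n.
Qed.

Lemma sum_avoid (s : seq 'Z_m) : uniq s -> (\sum_(y : 'Z_m) (y \notin s) = m - size s)%N.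
Proof.
move=> us; rewrite -big_mkcond /= sum1_card.
have := cardC (mem s); rewrite (card_uniqP us) card_Zm // => E.
apply: (@addnI (size s)); rewrite [LHS]E subnKC //.
by rewrite -[X in (_ <= X)%N]E leq_addr.
Qed.

Lemma card_U : #|U_set m| = (m ^ 3 - m ^ 2 - 4 * m + 7)%N.
Proof.
have one0 : (1 == 0 :> 'Z_m) = false by exact: oner_eq0.
have sm j k : (j < 4)%N -> (k < 4)%N -> (j%:R == k%:R :> 'Z_m) = (j == k).
  by move=> j4 k4; rewrite Zp_nat_eq_small //; lia.
(* At height one there is agreement for w = 0, 1 and 3 only. *)
have agreeN h w y : agree h w y = (
    (h == 0%:R) + ((h == 2%:R) * (w == 0%:R) +
    (h == 1%:R) * ((w == 0%:R) * (y \notin [:: 0%:R; 3%:R : 'Z_m])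
                 + ((w == 1%:R) * (y \notin [:: 0%:R; 2%:R : 'Z_m])
                 + (w == 3%:R) * (y \notin [:: 0%:R; 1%:R; (-1)%R : 'Z_m])))))%N :> nat.
  have vE j x : (j < 4)%N -> (val x == j) = (x == j%:R :> 'Z_m).
    by move=> j4; rewrite -[in RHS](natr_Zp x) Zp_nat_eq_small //; [exact: ltn_Zm | lia].
  have ltE x : (val x < 2)%N = (x == 0%:R :> 'Z_m) || (x == 1%:R).
    by rewrite -!vE //; case: (val x) => [|[|n]].
  have [->|h1] := eqVneq h 1%:R.
    rewrite agree1 ltE !sm //= !inE.
    have [->|w0] := eqVneq w 0%:R.
      by rewrite !sm //= subr0 negb_or !mul1n !mul0n !addn0.
    have [->|w1] := eqVneq w 1%:R.
      rewrite !sm //= (_ : 3%:R - 1%:R = 2%:R :> 'Z_m) ?negb_or ?mul1n ?mul0n ?addn0 //; ring.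
    by case: (w == 3%:R); rewrite /= ?negb_or ?mul1n ?mul0n ?addn0.
  rewrite agree_off1 ?vE // addn0.
  have [->|h0] := eqVneq h 0%:R; first by rewrite !sm.
  by case: (h == 2%:R); case: (w == 0%:R).
have cN : #|~: U_set m| = (m * m + (m + ((m - 2) + ((m - 2) + (m - 3)))))%N.
  transitivity (\sum_(h : 'Z_m) \sum_(w : 'Z_m) \sum_(y : 'Z_m) agree h w y)%N.
    transitivity #|[set z : 'Z_m * 'Z_m * 'Z_m | agree z.1.1 z.1.2 z.2]|.
      rewrite -(on_card_preimset (f := @vert3 m)); last exact/onW_bij/vert3_bij.
      apply: eq_card => -[[h w] y]; rewrite !inE /= /agree negb_exists.
      by apply: eq_forallb => c; rewrite negbK.
    rewrite -sum1dep_card big_mkcond /= !pair_bigA /=.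
    by apply: eq_bigr => z _; case: agree.
  have u2 j : (0 < j < 4)%N -> uniq [:: 0%:R; j%:R : 'Z_m].
    by move=> j4; rewrite /= inE sm; move: j4; lia.
  have u3 : uniq [:: 0%:R; 1%:R; -1 : 'Z_m].
    have N0 : (0%:R == -1 :> 'Z_m) = false by rewrite eq_sym oppr_eq0 one0.
    have N1 : (1%:R == -1 :> 'Z_m) = false.
      by rewrite -subr_eq0 opprK -(natrD _ 1 1) Zp_nat_eq0 // gtnNdvd //; lia.
    by rewrite /= !inE sm //= N0 N1.
  have sumY h w : (\sum_(y : 'Z_m) agree h w y = (h == 0%:R) * m + ((h == 2%:R) * ((w == 0%:R) * m)
      + (h == 1%:R) * ((w == 0%:R) * (m - 2) + ((w == 1%:R) * (m - 2) + (w == 3%:R) * (m - 3)))))%N.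
    rewrite (eq_bigr _ (fun y _ => agreeN h w y)) !big_split /= -!big_distrr /= !big_split /=.
    rewrite -!big_distrr /= !sum_avoid ?u2 // !sum_nat_const card_Zm //.
    by congr (_ + (_ + _))%N; ring.
  have sumW h : (\sum_(w : 'Z_m) \sum_(y : 'Z_m) agree h w y = (h == 0%:R) * (m * m)
      + ((h == 2%:R) * m + (h == 1%:R) * ((m - 2) + ((m - 2) + (m - 3)))))%N.
    rewrite (eq_bigr _ (fun w _ => sumY h w)) !big_split /= -!big_distrr /= !big_split /=.
    by rewrite !sum_delta sum_nat_const card_Zm //; congr (_ + (_ + _))%N; ring.
  by rewrite (eq_bigr _ (fun h _ => sumW h)) !big_split /= !sum_delta.
have := cardsC (U_set m); rewrite cN card_mx card_Zm //.
have -> : (m ^ (1 * 3) = m * (m * m))%N by rewrite mul1n !expnS expn0 muln1.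
have -> : (m ^ 2 = m * m)%N by rewrite expnS expn1.
have : (4 * (m * m) <= m * (m * m))%N by rewrite leq_mul2r m_gt3 orbT.
have : (4 * m <= m * m)%N by rewrite leq_mul2r m_gt3 orbT.
move: (m * (m * m))%N (m * m)%N => a b; lia.
Qed.

(** The recolouring exchanges F_0 and F_2 at height 3, and F_0 and F_1 at
    height 2 for w other than 0. *)
Lemma recol_moves c : exists2 v, v \in U_set m & recol v c != c.
Proof.
suff [v vc] : exists v, F_dir v c != H_dir v c.
  by exists v; rewrite ?recol_id // inE; apply/existsP; exists c.
have [t0 t1 t2] := tperm12; have v3 : val (3%:R : 'Z_m) = 3%N by exact: val_Zm.
have v2 : val (2%:R : 'Z_m) = 2%N by rewrite val_Zm //; lia.
have v1 : val (1%:R : 'Z_m) = 1%N by exact: val_Zm.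
elim/I3_ind: c; [exists (vert 3%:R 0 0) | exists (vert 2%:R 1%:R 0) | exists (vert 3%:R 0 0)];
  rewrite F_dir_vert H_dir_vert ?v3 ?v2 ?v1 /=.
- by rewrite -[e_x]/(0 : 'I_3) t0 /s_exp /=; case: ifP.
- by rewrite -[e_y]/(1 : 'I_3) t1.
by rewrite -[e_w]/(2 : 'I_3) t2 /s_exp /=; case: ifP.
Qed.

(** The rows of F and H agree in the exiting colour, so the excursions of F_g
    are not affected by the recolouring of their first step. *)
Lemma exit_recol p g v : v = exit_vertex m (node (inl g : colour p) (parity_class v)) ->
  recol v g = g.
Proof.
move=> vE; apply/eqP; rewrite recol_id vE {vE}; move: (parity_class v) => e.
have [t0 t1 t2] := tperm12; have v1 : val (1%:R : 'Z_m) = 1%N by exact: val_Zm.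
have v2 : val (2%:R : 'Z_m) = 2%N by rewrite val_Zm //; lia.
elim/I3_ind: g; rewrite /exit_vertex /= /F_node /= inordK /=; try by case: (e).
- by rewrite F_dir_vert H_dir_vert /= -[e_x]/(0 : 'I_3) t0 /s_exp /=; case: ifP.
- have /forallP/(_ e_y) : agree 1 0 1; last by [].
  rewrite agree1 (_ : (val (0%R : 'Z_m) < 2)%N = true) // oner_eq0 subr0.
  by rewrite -[X in X != _]/(1%:R) Zp_nat_eq_small.
have -> : (vert 2 (odd (2 + e))%:R 0) = vert 2%:R e%:R 0 :> vertex m 3 by case: (e).
rewrite F_dir_vert H_dir_vert v2 -[e_w]/(2 : 'I_3) t2.
by rewrite /fdir; case: (_ && _).
Qed.

End Recolouring.

(** * Recolouring the last stage *)

(** If every point is reached from its own image, the map is onto. *)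
Lemma connect_inj (T : finType) (f : T -> T) :
  (forall x y, fconnect f x y) -> single_cycle f.
Proof.
move=> conn; split=> //.
have surj y : exists x, f x = y.
  by have /iter_findex E := conn (f y) y; exists (iter (findex f (f y) y) f y); rewrite -iterS
    iterSr.
have [g gK] := fin_all_exists surj.
by apply: can_inj; apply: canF_sym gK.
Qed.

Section Final.
Variables (m p n : nat).
Hypotheses (m_gt3 : (3 < m)%N) (m_even : ~~ odd m) (p_ge2 : (2 <= p)%N).
Let k := p./2.
Variables (s : stage m p n) (turn : bool) (rem : bool -> nat).
Hypothesis I : inv k (@exit_vertex m p) s turn rem.
Let S := st_map s.
Let B := st_base s.
Let L := st_lift s.
Let S' := recolour L S.
Let P := inv_pre I.
Let LK : cancel L B := inv_lift P.
Let step_inj c : injective (S c).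
Proof. by have [/(_ c)/bij_inj] := inv_fact P. Qed.
Let m_gt1 : (1 < m)%N. Proof. by move: m_gt3; lia. Qed.

Definition on_base u := L (B u) == u.
(** [recol] is the identity at vertices outside U_m, so these need not be
    distinguished from U_m here. *)
Definition recol_at u : {perm 'I_3} := if on_base u then recol (B u) else 1%g.

Lemma on_base_lift v : on_base (L v). Proof. by rewrite /on_base LK. Qed.

Lemma recolour_F f u : S' (inl f) u = S (inl (recol_at u f)) u.
Proof.
rewrite /S' /recolour /recol_at /on_base; case: pickP => [v /andP[_ /eqP <-]|noU].
  by rewrite LK eqxx.
case: ifP => [/eqP uE|_]; last by rewrite perm1.
suff -> : recol (B u) f = f by [].
apply/eqP; rewrite recol_id; have := noU (B u); rewrite uE eqxx andbT.
by move=> /negbT; rewrite inE negb_exists => /forallP/(_ f); rewrite negbK.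
Qed.

Lemma recolour_lift f v : S' (inl f) (L v) = S (inl (recol v f)) (L v).
Proof. by rewrite recolour_F /recol_at on_base_lift LK. Qed.

Lemma recolour_off f u : ~~ on_base u -> S' (inl f) u = S (inl f) u.
Proof. by move=> uN; rewrite recolour_F /recol_at (negPf uN) perm1. Qed.

Let nu (f : 'I_3) (v : vertex m 3) : node_type p := node (inl f : colour p) (parity_class v).

Lemma nu_F f v : nu f (init_map k (inl f : colour p) v) = nu f v.
Proof. exact: parity_inv. Qed.

Lemma nu_iter f j x : nu f (B (iter j (S (inl f)) x)) = nu f (B x).
Proof. by elim: j => //= j IHj; rewrite -IHj -[in RHS]nu_F -(inv_base P). Qed.

Lemma iter_off (f : 'I_3) j x : (forall i, (i < j)%N -> ~~ on_base (iter i (S (inl f)) x)) ->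
  iter j (S' (inl f)) x = iter j (S (inl f)) x.
Proof.
elim: j => // j IHj off; rewrite !iterS IHj => [|i ij]; last by apply: off; lia.
by rewrite recolour_off // off.
Qed.

Lemma step_lift f v : v != exit_vertex m (nu (recol v f) v) ->
  S' (inl f) (L v) = L (H_map f v).
Proof. by move=> vx; rewrite recolour_lift [LHS](inv_exit I) // recolP. Qed.

Lemma excursion f v : v = exit_vertex m (nu f v) ->
  fconnect (S (inl f)) (L v) (L (init_map k (inl f : colour p) v)) /\ recol v f = f.
Proof.
move=> vx; split; last exact: exit_recol vx.
by apply: (inv_cycle P); rewrite -/B !LK; apply: esym; exact: nu_F.
Qed.

(** If v is not an exit, one step suffices. At an exit the orbit of S_f leaves
    the copy of the base torus until its first return, and up to then the
    recolouring does not matter. The returning point is the copy of F_f(v'')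
    for some v''; if v'' were different from v it would not be an exit, and the
    copy of v'' would come just before the returning point. *)
Lemma fconnect_lift f v : fconnect (S' (inl f)) (L v) (L (H_map f v)).
Proof.
have [vx|/step_lift <-] := eqVneq v (exit_vertex m (nu (recol v f) v)); last exact: fconnect1.
have rf : recol v f = f by apply: (@perm_inj _ (recol v)); apply: exit_recol m_gt3 _ _ _ vx.
rewrite rf in vx; set T := S (inl f).
have ex : exists j, on_base (iter j.+1 T (L v)).
  exists (fingraph.order T (L v)).-1.
  by rewrite prednK ?order_gt0 // iter_order ?on_base_lift //; apply: step_inj.
have [j jB jmin] := ex_minnP ex.
have E : iter j.+1 (S' (inl f)) (L v) = iter j.+1 T (L v).
  rewrite !iterSr recolour_lift rf; apply: iter_off => i ij.
  by rewrite -iterSr; apply: contraTN ij => /jmin; rewrite leqNgt.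
suff -> : L (H_map f v) = iter j.+1 (S' (inl f)) (L v) by apply: fconnect_iter.
rewrite E -(eqP jB); set v' := B _; congr L.
have nu' : nu f v' = nu f v by rewrite /v' nu_iter LK.
have [G GK KG] := injF_bij (@init_map_inj m p (inl f)).
have [v''E|v''x] := eqVneq (G v') v.
  by rewrite recolP rf -v''E -[LHS]/(init_map k (inl f : colour p) _) KG.
have nu'' : nu f (G v') = nu f v by rewrite -nu_F KG.
have H : S (inl f) (L (G v')) = L v'.
  by rewrite [LHS](inv_exit I) ?KG // -/(nu f _) nu'' -vx.
rewrite (eqP jB) iterS in H; move/step_inj: H => H.
have [j0|j0] := posnP j.
  by have := congr1 B H; rewrite j0 /= !LK => v''E; rewrite v''E eqxx in v''x.
by have := jmin j.-1; rewrite prednK // -H on_base_lift => /(_ isT); lia.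
Qed.

Lemma fconnect_lifts f v v' : fconnect (S' (inl f)) (L v) (L v').
Proof.
have /iter_findex <- := H_connect m_gt3 f v v' m_even.
elim: (findex _ _ _) => [|j IHj] /=; first exact: connect0.
exact: connect_trans IHj (fconnect_lift _ _).
Qed.

Lemma reach_base f x : exists v, fconnect (S' (inl f)) x (L v).
Proof.
set T := S (inl f); have ex : exists j, on_base (iter j T x).
  have : fconnect T x (L (B x)) by apply: (inv_cycle P); rewrite -/B LK.
  by move/iter_findex => E; exists (findex T x (L (B x))); rewrite E on_base_lift.
have [j jB jmin] := ex_minnP ex; exists (B (iter j T x)).
rewrite (eqP jB) -iter_off ?fconnect_iter // => i ij.
by apply: contraTN ij => /jmin; rewrite leqNgt.
Qed.

(** The last point of the copy before y on the orbit of S_f is the copy of an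
    exit, unless it is y itself, and the recolouring does not act on f
    there. *)
Lemma reached_base f y : exists v, fconnect (S' (inl f)) (L v) y.
Proof.
set T := S (inl f); have ex : exists j, [exists v, iter j T (L v) == y].
  have : fconnect T (L (B y)) y by apply: (inv_cycle P); rewrite -/B LK.
  by move/iter_findex => E; exists (findex T (L (B y)) y); apply/existsP; exists (B y); apply/eqP.
have [j /existsP[v /eqP yE] jmin] := ex_minnP ex; exists v.
have off i : (i < j)%N -> ~~ on_base (iter i.+1 T (L v)) || (i.+1 == j).
  move=> ij; have [ijE|ijN] := eqVneq i.+1 j; rewrite ?orbT // orbF.
  apply/negP=> /eqP iB; have := jmin (j - i.+1)%N.
  have -> : [exists v, iter (j - i.+1) T (L v) == y].
    by apply/existsP; exists (B (iter i.+1 T (L v))); rewrite iB -iterD subnK ?yE.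
  by move=> /(_ isT); lia.
have [j0|j_gt0] := posnP j; first by move: yE; rewrite j0 => <-; apply: connect0.
have T1 : S' (inl f) (L v) = T (L v).
  have [vx|vx] := eqVneq v (exit_vertex m (nu f v)).
    by rewrite recolour_lift (excursion vx).2.
  have H : T (L v) = L (init_map k (inl f : colour p) v) := inv_exit I vx.
  have [j1|j1] := eqVneq j 1%N; last by have := off 0%N j_gt0; rewrite /= H on_base_lift eq_sym
    (negPf j1).
  have e0 : [exists v0, iter 0 T (L v0) == y].
    by apply/existsP; exists (init_map k (inl f : colour p) v); rewrite /= -H -yE j1.
  by have := jmin 0%N e0; rewrite j1.
suff -> : y = iter j (S' (inl f)) (L v) by apply: fconnect_iter.
rewrite -yE -(prednK j_gt0) !iterSr T1 iter_off // => i ij.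
rewrite -iterSr; have := off i; rewrite (_ : (i.+1 == j) = false) ?orbF; last by lia.
by apply; lia.
Qed.

Lemma recolour_cycle c : single_cycle (S' c).
Proof.
apply: connect_inj => x y; case: c => [f|l]; last by apply: (inv_cycle P).
have [v xv] := reach_base f x; have [v' v'y] := reached_base f y.
exact: connect_trans xv (connect_trans (fconnect_lifts f v v') v'y).
Qed.

Definition recolour_colour u (c : colour p) : colour p :=
  match c with inl f => inl (recol_at u f) | inr l => inr l end.

Lemma recolour_fact : factorizes (st_mult s) S' (fun c u => st_dir s (recolour_colour u c) u).
Proof.
have [bS dS cS] := inv_fact P.
have E c u : S' c u = S (recolour_colour u c) u.
  by case: c => [f|l] //; rewrite recolour_F.
split=> [c|c u|u i].
- by apply: injF_bij; case: (recolour_cycle c).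
- by rewrite E [LHS]dS.
have rI : injective (recolour_colour u).
  by case=> [f|l] [f'|l'] //= [/perm_inj ->].
rewrite -(cS u i); transitivity #|recolour_colour u @^-1: [set c | st_dir s c u == i]|.
  by apply: eq_card => c; rewrite !inE.
exact/on_card_preimset/onW_bij/injF_bij.
Qed.

Lemma recolour_neq f u : (S' (inl f) u != S (inl f) u) = (recol_at u f != f).
Proof.
rewrite recolour_F; apply/idP/idP; first by apply: contraNN => /eqP ->.
apply: contraNN; have [_ dS _] := inv_fact P.
rewrite /S !dS => /eqP/addrI/unit_vec_inj/(inv_F P) ->.
by [].
Qed.

Lemma changed_colours :
  [set c | [exists u, S' c u != S c u]] = [set inl f | f in [set: 'I_3]].
Proof.
apply/setP=> c; rewrite inE; apply/existsP/imsetP=> [[u]|[f _ ->]].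
  by case: c => [f _|l]; [exists f | rewrite /S' eqxx].
have [v vU vf] := recol_moves m_gt3 f; exists (L v).
by rewrite recolour_neq /recol_at on_base_lift LK.
Qed.

Lemma changed_sources :
  [set u | [exists c, S' c u != S c u]] = [set L v | v in U_set m].
Proof.
apply/setP=> u; rewrite inE; apply/existsP/imsetP=> [[[f|l]]|[v]].
- rewrite recolour_neq /recol_at; case: ifP => [/eqP uE fN|_]; last by rewrite perm1 eqxx.
  by exists (B u); rewrite // inE; apply/existsP; exists f; rewrite -recol_id.
- by rewrite eqxx.
rewrite inE => /existsP[f fN] ->; exists (inl f).
by rewrite recolour_neq /recol_at on_base_lift LK recol_id.
Qed.

End Final.

(** * The sequence of splits *)

Section Sequence.
Variables (m p : nat).
Let split j := ('I_j.+3 * (colour p -> vertex m j.+3 -> bool))%type.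
Variable s0 : stage m p 3.

Fixpoint stage_seq (i : forall j, 'I_j.+3)
    (delta : forall j, colour p -> vertex m j.+3 -> bool) (j : nat) : stage m p j.+3 :=
  match j with
  | 0 => s0
  | j'.+1 => next (stage_seq i delta j') (i j') (delta j')
  end.

(** Each split depends on the stage to which it is applied, so dependent choice
    is needed. *)
Lemma stage_choice (Q : forall j, stage m p j.+3 -> Prop) (N : nat) : Q 0%N s0 ->
  (forall j (s : stage m p j.+3), (j < N)%N -> Q j s -> exists i delta,
     balanced_split (st_mult s) (st_map s) i delta /\ Q j.+1 (next s i delta)) ->
  exists i delta, forall j, (j <= N)%N -> let s := stage_seq i delta j in
    Q j s /\ ((j < N)%N -> balanced_split (st_mult s) (st_map s) (i j) (delta j)).
Proof.
move=> Q0 QS.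
have pickable j (s : stage m p j.+3) : {d : split j | (j < N)%N -> Q j s ->
    balanced_split (st_mult s) (st_map s) d.1 d.2 /\ Q j.+1 (next s d.1 d.2)}.
  apply: constructive_indefinite_description.
  have [[jN Qs]|no] := excluded_middle_informative ((j < N)%N /\ Q j s).
    by have [i [delta H]] := QS j s jN Qs; exists (i, delta).
  by exists (ord0, fun _ _ => false) => jN Qs; case: no.
pose st := fix st j : stage m p j.+3 := match j with
  | 0 => s0 | j'.+1 => let d := sval (pickable j' (st j')) in next (st j') d.1 d.2 end.
pose i j := (sval (pickable j (st j))).1; pose delta j := (sval (pickable j (st j))).2.
have stE j : stage_seq i delta j = st j by elim: j => //= j ->.
exists i, delta => j jN; rewrite stE.
have Qst : Q j (st j).
  elim: j jN => // j IHj jN.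
  by have [] := svalP (pickable j (st j)) jN (IHj (ltnW jN)).
by split=> // jN'; have [] := svalP (pickable j (st j)) jN' Qst.
Qed.

Lemma stage_seq_mult i delta j : st_mult (stage_seq i delta j) = iter_mult (st_mult s0) i j.
Proof. by elim: j => //= j ->. Qed.

Lemma stage_seq_map i delta j : st_map (stage_seq i delta j) = iter_split (st_map s0) i delta j.
Proof. by elim: j => //= j ->. Qed.

End Sequence.

Lemma stage_seq_lift m p i delta j : st_lift (stage_seq (stage0 m p) i delta j) = zero_lift i j.
Proof. by elim: j => //= j ->. Qed.

Section Main.
Variables (m p : nat).
Hypotheses (m_gt3 : (3 < m)%N) (m_even : ~~ odd m) (p_ge2 : (2 <= p)%N).
Let k := p./2.

(** The first split is on the side of w, and then the sides alternate. *)
Definition rem_after (j : nat) (e : bool) : nat := (p - (j + ~~ e)./2)%N.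

Lemma inv_ext n (s : stage m p n) turn rem rem' : rem =1 rem' ->
  inv k (@exit_vertex m p) s turn rem -> inv k (@exit_vertex m p) s turn rem'.
Proof.
by move=> E [[? ? ? ? ? r ?] ? ?]; split=> //; split=> // e; rewrite r.
Qed.

Lemma stages_exist : exists i delta, forall j, (j <= p.*2)%N ->
  let s := stage_seq (stage0 m p) i delta j in
  ((0 < j)%N -> inv k (@exit_vertex m p) s (odd j) (rem_after j)) /\
  ((j < p.*2)%N -> balanced_split (st_mult s) (st_map s) (i j) (delta j)).
Proof.
(* The invariant starts with the first split; stage 0 is described exactly. *)
pose Q j (s : stage m p j.+3) := match j return stage m p j.+3 -> Prop with
  | 0 => fun s => s = stage0 m p
  | _ => fun s => inv k (@exit_vertex m p) s (odd j) (rem_after j) end s.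
have [|j s jp|i [delta H]] := @stage_choice m p (stage0 m p) Q p.*2; first by [].
  case: j s jp => [|j] s jp.
    move=> /= ->; have [delta [bal I]] := first_step m_gt3 m_even p_ge2.
    exists e_w, delta; split=> //; apply: inv_ext I => e.
    by rewrite /rem_after; case: e; rewrite /=; lia.
  move=> /= I; have rem0 : (0 < rem_after j.+1 (odd j.+1))%N.
    by rewrite /rem_after; move: jp; case: (boolP (odd j.+1)); lia.
  have [i [delta [bal I']]] := inv_step m_gt3 (parity_inv m_gt3 m_even p_ge2) I rem0.
  exists i, delta; split=> //; apply: inv_ext I' => e.
  by rewrite /rem_after; move: (jp); case: e; case: (boolP (odd j.+1)); lia.
exists i, delta => j jp s; have [Qs bal] := H j jp; split=> //.
by move: Qs; rewrite /s; case: (j).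
Qed.

End Main.

Local Close Scope ring_scope.

Theorem corollary8p7 (m d : nat) (m_ge4 : 4 <= m) (m_even : ~~ odd m)
    (d_ge7 : 7 <= d) (d_odd : odd d) :
  let p := (d - 3)./2 in
  let k := p./2 in
  let a0 := init_mult p k in
  let S0 : colour p -> vertex m 3 -> vertex m 3 := @init_map m p k in
  factorizes a0 S0 (@init_dir m p k) /\
  exists (i : forall j, 'I_j.+3)
         (delta : forall j, colour p -> vertex m j.+3 -> bool),
    let N := d - 3 in
    let a j := iter_mult a0 i j in
    let S j := iter_split S0 i delta j in
    let Ucopy j := [set zero_lift i j v | v in U_set m] in
    let S' := recolour (zero_lift i N) (S N) in
    [/\ forall j, j < N -> balanced_split (a j) (S j) (i j) (delta j),
        (forall l, a N l = 1) /\ is_factorization (fun=> 1) (S N),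
        Hamilton_decomposition d S',
        [/\ [set c | [exists u, S' c u != S N c u]]
              = [set inl f | f in [set: 'I_3]],
            [set u | [exists c, S' c u != S N c u]] = Ucopy N
          & #|Ucopy N| = m ^ 3 - m ^ 2 - 4 * m + 7]
      & forall j v, j < N -> v \in U_set m ->
          [set u in Ucopy j.+1 | base i j.+1 u == v] = [set zero_lift i j.+1 v]
          /\ zero_lift i j.+1 v \in zero_section m (i j)].
Proof.
move=> p k a0 S0; have p_ge2 : 2 <= p by rewrite /p; lia.
have NE : d - 3 = p.*2 by rewrite /p; lia.
split; first exact: init_factorizes.
have [i [delta H]] := stages_exist m_ge4 m_even p_ge2.
exists i, delta => N a S Ucopy S'.
pose s j := stage_seq (stage0 m p) i delta j.
have aE j : a j = st_mult (s j) by rewrite stage_seq_mult.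
have SE j : S j = st_map (s j) by rewrite stage_seq_map.
have LE j : zero_lift i j = st_lift (s j) by rewrite stage_seq_lift.
have I : inv k (@exit_vertex m p) (s N) (odd N) (rem_after p N).
  have [] := H N; rewrite {1}/N NE ?leqnn // => I _.
  by apply: I; lia.
have a1 l : a N l = 1.
  have pos := inv_pos (inv_pre I) l; have := inv_rem (inv_pre I) (st_side (s N) l).
  rewrite /rem_after [RHS](_ : _ = 0); last by move: NE; rewrite -/N; case: (st_side _ _); lia.
  move/eqP; rewrite sum_nat_eq0 => /forallP/(_ l); rewrite eqxx aE /=; lia.
have fact1 (S1 : colour p -> vertex m N.+3 -> vertex m N.+3) dir : factorizes (a N) S1 dir ->
  is_factorization (fun=> 1) S1.
  by case=> bS dS cS; exists dir; split=> // x l; rewrite cS a1.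
have S'E : S' = recolour (st_lift (s N)) (st_map (s N)) by rewrite /S' LE SE.
have UE j : Ucopy j = [set st_lift (s j) v | v in U_set m] by rewrite /Ucopy LE.
split.
- by move=> j jN; rewrite aE SE; apply: (H j _).2; rewrite -NE // ltnW.
- by split=> //; apply: (fact1 _ (st_dir (s N))); rewrite aE SE; apply: inv_fact (inv_pre I).
- split.
  + by rewrite /N; lia.
  + by rewrite card_sum card_sum !card_ord; lia.
  + by apply: fact1; rewrite aE S'E; apply: (recolour_fact m_ge4 m_even p_ge2 I).
  by move=> c; rewrite S'E; apply: (recolour_cycle m_ge4 m_even p_ge2 I).
- split.
  + by rewrite S'E SE; apply: (changed_colours m_ge4 I).
  + by rewrite S'E SE UE; apply: changed_sources I.
  by rewrite card_imset ?card_U //; apply: can_inj (zero_liftK i N).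
move=> j v jN vU; split; last by rewrite inE identK.
apply/setP=> u; rewrite !inE; apply/andP/eqP=> [[/imsetP[v' _ ->] /eqP]|->].
  by rewrite zero_liftK => ->.
by rewrite zero_liftK imset_f.
Qed.
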